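(* Let $\Lambda\in\mathfrak{sl}_n(\mathbb{C})$ be a diagonal matrix with simple spectrum (pairwise distinct eigenvalues) satisfying one of the following constraints: (i) $\Lambda\in\mathfrak{sl}_n(\mathbb{R})$; (ii) $n=2m$ and $\Lambda\in\mathfrak{sl}_{\mathbb{H}}$, i.e. $\Lambda=\mathrm{diag}(\lambda_1,\overline{\lambda}_1,\dots,\lambda_m,\overline{\lambda}_m)$; (iii) $n=p+q$ with $p\ge q$ and $\Lambda=\begin{pmatrix}\Lambda_q&0&0\\0&\mathrm{Im}_{p-q}&0\\0&0&-\overline{\Lambda}_q\end{pmatrix}$, where $\Lambda_q$ is a diagonal complex matrix of size $q$ and $\mathrm{Im}_{p-q}$ is a diagonal matrix of size $p-q$ with purely imaginary entries. Let the real form $\mathrm{G}_0$ be, respectively, (i) $\mathrm{SL}_n(\mathbb{R})$; (ii) $\mathrm{SL}_{\mathbb{H}}$; (iii) $c\,\mathrm{SU}(p,q)\,c^{-1}$, where $$c=g\begin{pmatrix}\mathrm{I}_{p-q}&0&0\\0&\tfrac{1}{\sqrt2}\mathrm{I}_q&\tfrac1{\sqrt2}\mathrm{I}^{\mathrm{op}}\\0&-\tfrac1{\sqrt2}\mathrm{I}^{\mathrm{op}}&\tfrac1{\sqrt2}\mathrm{I}_q\end{pmatrix},$$ $\mathrm{I}^{\mathrm{op}}$ is the $q\times q$ matrix with ones on the anti-diagonal and zeros elsewhere, and $g$ is the permutation matrix of $(1,2,\dots,p+q)\mapsto(1+q,2+q,\dots,p,1,2,\dots,q)$. Then the Toda vector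 field on $\mathfrak{sl}_n(\mathbb{C})$ is tangent to the $\mathrm{G}_0$-conjugacy class $\{h\Lambda h^{-1}: h\in\mathrm{G}_0\}$ of $\Lambda$, and there exists an atlas of this conjugacy class consisting of finitely many charts whose coordinates transform the Toda vector field into linear vector fields.
   Context: The Toda vector field on $\mathfrak{sl}_n(\mathbb{C})$ is $X'=[X,\pi_{\mathfrak{k}}X]$, where $\mathfrak{sl}_n(\mathbb{C})=\mathfrak{k}\oplus\mathfrak{u}$ with $\mathfrak{k}$ the traceless skew-Hermitian matrices and $\mathfrak{u}$ the traceless upper triangular matrices with real diagonal, and $\pi_{\mathfrak{k}}$ the projection onto $\mathfrak{k}$ along $\mathfrak{u}$. $\mathrm{SL}_{\mathbb{H}}\subset\mathrm{SL}_{2m}(\mathbb{C})$ is the group of matrices made of $2\times2$ blocks each of the form $\begin{pmatrix}a&b\\-\overline b&\overline a\end{pmatrix}$ (quaternions), and $\mathfrak{sl}_{\mathbb{H}}$ its Lie algebra (traceless matrices made of such blocks). $\mathrm{SU}(p,q)$ is the group of determinant one complex matrices preserving the pseudo-Hermitian form $-z_1\bar z_1-\dots-z_p\bar z_p+z_{p+1}\bar z_{p+1}+\dots+z_{p+q}\bar z_{p+q}$.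
   Formalization: In case (iii) the third diagonal block is taken as the negative conjugate of Λ_q with its diagonal entries in reversed order, because with the order as printed the claim fails for q≥2, e.g. p=q=2, Λ=diag(2,1,-2,-1); g is read as fixing p+1,…,p+q. *)

(* Defs.v *)
(* MathComp + MathComp-Analysis (+ real_closed's complex numbers R[i]). *)
From HB Require Import structures.
From mathcomp Require Import all_boot all_order all_algebra.
From mathcomp Require Import complex ring lra.
From mathcomp Require Import all_classical all_reals all_analysis.
Set Implicit Arguments. Unset Strict Implicit. Unset Printing Implicit Defensive.
Import Order.TTheory GRing.Theory Num.Theory.
Local Open Scope ring_scope.
Local Open Scope classical_set_scope.
Import numFieldNormedType.Exports.

(* ---------- C^k and smooth maps between real normed spaces ---------- *)
Section Smooth.
Variable R : realType.
Variables U V : normedModType R.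

(* Ck k f A : f is of class C^k on the (open) set A.
   C^0 = continuous at each point of A;
   C^(k+1) = differentiable at each point of A and every directional
             derivative x |-> ('d f x) v is C^k on A. *)
Fixpoint Ck (k : nat) (f : U -> V) (A : set U) : Prop :=
  match k with
  | 0 => forall x, A x -> {for x, continuous f}
  | k'.+1 => (forall x, A x -> differentiable f x) /\
             (forall v : U, Ck k' (fun x => 'd f x v) A)
  end.

Definition smooth_on (f : U -> V) (A : set U) : Prop := forall k, Ck k f A.
End Smooth.

(* ---------- complex matrices ---------- *)
Section Mx.
Variable R : realType.
Local Notation C := R[i].
Local Notation "x %:CC" := (real_complex R x) (at level 2, format "x %:CC").

(* entry access with natural-number indices (0-based), 0 outside the range *)
Definition mxn n (X : 'M[C]_n) (i j : nat) : C :=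
  match @insub nat (fun k => k < n)%N 'I_n i, @insub nat (fun k => k < n)%N 'I_n j with
  | Some i', Some j' => X i' j'
  | _, _ => 0
  end.

Definition conjm n (X : 'M[C]_n) : 'M[C]_n := map_mx (fun z => z^*) X.
Definition adjm n (X : 'M[C]_n) : 'M[C]_n := (conjm X)^T.

(* sl_n(C) = k (+) u *)
Definition in_k n (X : 'M[C]_n) : Prop := adjm X = - X /\ \tr X = 0.
Definition in_u n (X : 'M[C]_n) : Prop :=
  (forall i j : 'I_n, (j < i)%N -> X i j = 0) /\
  (forall i : 'I_n, (X i i)^* = X i i) /\ \tr X = 0.

(* The projection pi_k onto k along u (for traceless X): the k-component
   agrees with X strictly below the diagonal, is skew-Hermitian, and has
   diagonal the imaginary part of the diagonal of X. *)
Definition pik n (X : 'M[C]_n) : 'M[C]_n :=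
  \matrix_(i, j) if (j < i)%N then X i j
                 else if (i < j)%N then - (X j i)^*
                 else (X i i - (X i i)^*) / 2.

(* Toda vector field  X' = [X, pi_k X] *)
Definition toda n (X : 'M[C]_n) : 'M[C]_n := X *m pik X - pik X *m X.

Definition is_diag n (X : 'M[C]_n) : Prop := forall i j : 'I_n, i != j -> X i j = 0.
Definition simple_spectrum n (X : 'M[C]_n) : Prop := injective (fun i : 'I_n => X i i).

(* (i) SL_n(R) *)
Definition real_mx n (X : 'M[C]_n) : Prop := forall i j, (X i j)^* = X i j.
Definition SLnR n : set 'M[C]_n := [set h | \det h = 1 /\ real_mx h].

(* (ii) quaternionic matrices: n = 2m, made of 2x2 blocks (a b; -b^* a^* ) *)
Definition quat_mx n (m : nat) (X : 'M[C]_n) : Prop :=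
  forall k l, (k < m)%N -> (l < m)%N ->
    mxn X (2 * k).+1 (2 * l).+1 = (mxn X (2 * k) (2 * l))^* /\
    mxn X (2 * k).+1 (2 * l) = - (mxn X (2 * k) (2 * l).+1)^*.
Definition SLH n m : set 'M[C]_n := [set h | \det h = 1 /\ quat_mx m h].
Definition in_slH n m (X : 'M[C]_n) : Prop := quat_mx m X /\ \tr X = 0.

(* (iii) SU(p,q), n = p + q: preserves -|z_1|^2-..-|z_p|^2+|z_{p+1}|^2+..  *)
Definition Jpq n (p : nat) : 'M[C]_n :=
  \matrix_(i, j) if i == j then (if (i < p)%N then -1 else 1) else 0.
Definition SUpq n p : set 'M[C]_n :=
  [set h | \det h = 1 /\ adjm h *m @Jpq n p *m h = @Jpq n p].

(* the permutation (1,..,p+q) |-> (1+q,..,p,1,..,q,p+1,..,p+q) (0-based) *)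
Definition sigma_pq (p q j : nat) : nat :=
  (if j < p - q then j + q else if j < p then j - (p - q) else j)%N.
(* its permutation matrix g : g e_j = e_{sigma j} *)
Definition gperm n p q : 'M[C]_n :=
  \matrix_(i, j) (if nat_of_ord i == sigma_pq p q j then 1 else 0).
(* the middle matrix ( I_{p-q} 0 0 ; 0 I_q/sqrt2 Iop/sqrt2 ; 0 -Iop/sqrt2 I_q/sqrt2 ) *)
Definition cmid n p q : 'M[C]_n :=
  let r := (p - q)%N in
  let s := ((Num.sqrt (2 : R))^-1)%:CC in
  \matrix_(i, j)
    if (i < r)%N then (if i == j then 1 else 0)
    else if (i < r + q)%N then
      (if i == j then s
       else if nat_of_ord j == (r + q + (q - 1 - (i - r)))%N then s else 0)
    else
      (if i == j then s
       else if nat_of_ord j == (r + (q - 1 - (i - r - q)))%N then - s else 0).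
Definition cpq n p q : 'M[C]_n := @gperm n p q *m @cmid n p q.
Definition G0_iii n p q : set 'M[C]_n :=
  [set X | exists h, @SUpq n p h /\ X = @cpq n p q *m h *m invmx (@cpq n p q)].

(* shape of Lambda in case (iii) *)
Definition LambdaShape_iii n p q (L : 'M[C]_n) : Prop :=
  (forall k, (q <= k)%N -> (k < p)%N -> complex.Re (mxn L k k) = 0) /\
  (forall k, (k < q)%N -> mxn L (p + k) (p + k) = - (mxn L (q - 1 - k) (q - 1 - k))^*).

(* the three cases (Lambda, G0) *)
Definition case_i n (L : 'M[C]_n) (G0 : set 'M[C]_n) : Prop :=
  real_mx L /\ G0 = @SLnR n.
Definition case_ii n (L : 'M[C]_n) (G0 : set 'M[C]_n) : Prop :=
  exists m, n = (2 * m)%N /\ in_slH m L /\ G0 = @SLH n m.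
Definition case_iii n (L : 'M[C]_n) (G0 : set 'M[C]_n) : Prop :=
  exists p q, n = (p + q)%N /\ (q <= p)%N /\ LambdaShape_iii p q L /\
              G0 = @G0_iii n p q.

(* G0-conjugacy class of Lambda *)
Definition conj_class n (G0 : set 'M[C]_n) (L : 'M[C]_n) : set 'M[C]_n :=
  [set X | exists h, G0 h /\ X = h *m L *m invmx h].

(* ---------- realification M_n(C) ~ M_n(R) x M_n(R) ---------- *)
Definition realify n (X : 'M[C]_n) : ('M[R]_n * 'M[R]_n)%type :=
  (map_mx (@complex.Re R) X, map_mx (@complex.Im R) X).
Definition unrealify n (Y : ('M[R]_n * 'M[R]_n)%type) : 'M[C]_n :=
  \matrix_(i, j) Complex (Y.1 i j) (Y.2 i j).

(* a vector v (in realified coordinates) is tangent to the set S at X: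
   it is the velocity at 0 of a smooth curve staying in S near 0 *)
Definition tangent_to n (S : set 'M[C]_n) (X : 'M[C]_n) (v : 'M[C]_n) : Prop :=
  exists gam : R -> ('M[R]_n * 'M[R]_n)%type,
    smooth_on gam setT /\ gam 0 = realify X /\
    (\forall t \near (0 : R^o), S (unrealify (gam t))) /\
    'd gam 0 1 = realify v.

(* An atlas of S consisting of finitely many (N) charts in which the vector
   field F becomes linear.  Chart k: phi k : W k `&` S -> V k (open in R^d),
   with smooth immersive inverse psi k : V k -> W k `&` S (a homeomorphism),
   and in the coordinates v = phi k X the field reads  v' = v *m A k. *)
Definition linearizing_atlas n (S : set 'M[C]_n) (F : 'M[C]_n -> 'M[C]_n) : Prop :=
  let SR := (fun X => realify X) @` S in
  exists (N d : nat)
         (psi : 'I_N -> 'rV[R]_d -> ('M[R]_n * 'M[R]_n)%type)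
         (phi : 'I_N -> ('M[R]_n * 'M[R]_n)%type -> 'rV[R]_d)
         (V : 'I_N -> set 'rV[R]_d)
         (W : 'I_N -> set ('M[R]_n * 'M[R]_n)%type)
         (A : 'I_N -> 'M[R]_d),
    (forall X, S X -> exists k, W k (realify X)) /\
    forall k,
      [/\ open (V k), open (W k),
          psi k @` V k = W k `&` SR,
          (forall v, V k v -> phi k (psi k v) = v) &
          {within W k `&` SR, continuous phi k}] /\
      [/\ smooth_on (psi k) (V k),
          (forall v, V k v -> injective ('d (psi k) v)) &
          (forall v, V k v ->
             'd (psi k) v (v *m A k) = realify (F (unrealify (psi k v))))].
End Mx.
Arguments SLnR {R} n.
Arguments SLH {R} n m.
Arguments Jpq {R} n p.
Arguments SUpq {R} n p.
Arguments gperm {R} n p q.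
Arguments cmid {R} n p q.
Arguments cpq {R} n p q.
Arguments G0_iii {R} n p q.

(* sanity check: pik is the projection onto k along u on sl_n(C) *)
Lemma pik_spec (R : realType) n (X : 'M[R[i]]_n) : \tr X = 0 ->
  in_k (pik X) /\ in_u (X - pik X).
Proof.
move=> trX.
have trK : \tr (pik X) = 0.
  rewrite /mxtrace (eq_bigr (fun i => (X i i - (X i i)^*) / 2)); last first.
    by move=> i _; rewrite mxE ltnn.
  rewrite -mulr_suml sumrB -rmorph_sum.
  by move: trX; rewrite /mxtrace => ->; rewrite rmorph0 subrr mul0r.
split; [split=> // | split; [|split]].
- apply/matrixP=> i j; rewrite !mxE.
  case: (ltngtP j i) => [ji|ij|ji].
  + by rewrite rmorphN /= conjCK.
  + by rewrite opprK.
  + have -> : i = j by apply/val_inj.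
    rewrite rmorphM /= rmorphB /= conjCK fmorphV /= rmorph_nat.
    by rewrite -mulNr opprB.
- by move=> i j ji; rewrite !mxE ji subrr.
- move=> i; rewrite !mxE ltnn.
  rewrite rmorphB /= rmorphM /= rmorphB /= conjCK fmorphV /= rmorph_nat.
  by field.
- by rewrite raddfB /= trX trK subrr.
Qed.

(* Main.v *)
(** Let g be a matrix of left eigenvectors of X, so that g X = L g, and let w be a signed
    permutation matrix for which the leading minors of w^* g do not vanish.  After rescaling
    the rows, g = u k = w l b with u and l unipotent, upper and lower triangular respectively,
    k unitary and b upper triangular with positive diagonal.  The matrices u and l depend
    smoothly on X, and conversely they determine X, since u^{-1} w l = k b^{-1} and QR
    decompositions are unique.  Write L = A + P with A real and P imaginary, and let
    u' = [u, P], l' = [w^* A w, l], which is a linear system.  Then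
    S = g^{-1} (g' + P g) = k^{-1} (P k + k') is skew-Hermitian, and
    S - X = g^{-1} (g' - A g) = b^{-1} (b' - (w^* A w) b) is upper triangular with real
    diagonal, hence S = pi_k X, and X' = [X, g^{-1} g'] = [X, S] is the Toda field.

    The real forms are the matrices with J conj(x) J^* = x in cases (i) and (ii), and with
    x^* K x = K in case (iii), where K is antidiagonal outside a central block; J and K are
    signed permutation matrices compatible with a block decomposition.  By uniqueness of block
    LDU decompositions, the factors of u and l lying in the unipotent radicals of the two block
    triangular parabolics belong to the real form, and their Cayley transforms run through a
    real vector space; the remaining factor of l is an arbitrary unipotent lower triangular
    matrix inside the blocks.  Gauss elimination with pivoting by signed permutations of the
    real form shows that finitely many w suffice. *)
Require Import Defs.
From HB Require Import structures.
From mathcomp Require Import all_boot all_order all_algebra.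
From mathcomp Require Import fingroup perm complex ring lra zify.
From mathcomp Require Import all_classical all_reals all_analysis.
Import Order.TTheory GRing.Theory Num.Theory.
Local Open Scope ring_scope.
Local Open Scope classical_set_scope.
Import numFieldNormedType.Exports.
Set Implicit Arguments.
Unset Strict Implicit.
Unset Printing Implicit Defensive.

(** * Triangular and unitary matrices *)

(** The freedom in g is a diagonal row scaling D. Its modulus is spent on making u unipotent, its
    phase on making b positive; conversely, a scaling between two normalised g is unitary seen from
    u k and positive seen from l b, so it is 1. This gives uniqueness, and its infinitesimal form
    gives injectivity of the differential of a chart. Every pair of unipotent factors is reached, so
    a chart is parametrised by a whole vector space. Cayley transforms replace exponentials: they
    are rational, are their own inverses and commute with conjugation, so u' = [u, P] becomes an
    equation of the same shape for the coordinate. On each block the real form is, up to positive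
    scalars, a compact group, whose elements have in general no triangular factors in it. This is
    why the in-block factor of l is left free; what must be shown instead is that its unitary factor
    lies in the real form. The real forms are used without the condition on the determinant, so that
    rescalings do not leave them; determinant one is restored at the end by a diagonal matrix, which
    commutes with L. *)

Section Support.
Variables (F : fieldType) (n : nat).
Implicit Types (r : rel 'I_n) (x y : 'M[F]_n).

(** For a reflexive and transitive [r] these matrices form the incidence algebra of [r]. Triangular,
    diagonal, block diagonal and block unipotent matrices are all treated through this one
    notion. *)
Definition supp r x := forall i j, ~~ r i j -> x i j = 0.

Lemma supp_sub r s x : subrel r s -> supp r x -> supp s x.
Proof. by move=> rs xr i j nsij; apply: xr; apply: contra nsij; apply: rs. Qed.

Lemma supp_and r s x : supp r x -> supp s x -> supp [rel i j | r i j && s i j] x.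
Proof. by move=> xr xs i j /=; rewrite negb_and => /orP [/xr|/xs]. Qed.

Lemma supp_add r x y : supp r x -> supp r y -> supp r (x + y).
Proof. by move=> xr yr i j nr; rewrite mxE xr // yr // addr0. Qed.

Lemma supp_opp r x : supp r x -> supp r (- x).
Proof. by move=> xr i j nr; rewrite mxE xr // oppr0. Qed.

Lemma supp_sub2 r x y : supp r x -> supp r y -> supp r (x - y).
Proof. by move=> xr yr; apply: supp_add => //; apply: supp_opp. Qed.

Lemma supp_scale r a x : supp r x -> supp r (a *: x).
Proof. by move=> xr i j nr; rewrite mxE xr // mulr0. Qed.

Lemma supp_scalar r a : reflexive r -> supp r a%:M.
Proof. by move=> rr i j; rewrite mxE; case: eqVneq => // ->; rewrite rr. Qed.

Lemma supp_mul r x y : transitive r -> supp r x -> supp r y -> supp r (x *m y).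
Proof.
move=> tr xr yr i j nr; rewrite mxE big1 // => k _.
have [rik|/xr ->] := boolP (r i k); last by rewrite mul0r.
have [rkj|/yr ->] := boolP (r k j); last by rewrite mulr0.
by rewrite (tr _ _ _ rik rkj) in nr.
Qed.

Lemma supp_mul_diag r x y i :
  antisymmetric r -> supp r x -> supp r y -> (x *m y) i i = x i i * y i i.
Proof.
move=> ar xr yr; rewrite mxE (bigD1 i) //= big1 ?addr0 // => k ki.
have [rik|/xr ->] := boolP (r i k); last by rewrite mul0r.
have [rki|/yr ->] := boolP (r k i); last by rewrite mulr0.
by move: ki; rewrite (ar k i) ?eqxx // rki rik.
Qed.

End Support.

(* By Cayley-Hamilton the inverse is a polynomial in the matrix. *)
Lemma supp_inv (F : fieldType) n (r : rel 'I_n) (x : 'M[F]_n) :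
  reflexive r -> transitive r -> supp r x -> supp r (invmx x).
Proof.
move=> rr tr xr; have [xu|xn] := boolP (x \in unitmx); last by rewrite /invmx (negPf xn).
case: n r x rr tr xr xu => [|n] r x rr tr xr xu; first by move=> [].
have hs : forall q : {poly F}, supp r (horner_mx x q).
  elim/poly_ind => [|q c IH]; first by rewrite rmorph0 => i j _; rewrite mxE.
  rewrite rmorphD rmorphM /= horner_mx_X horner_mx_C.
  by apply: supp_add; [apply: supp_mul|apply: supp_scalar].
pose p := char_poly x; pose c := p.[0].
have c0 : c != 0.
  rewrite /c horner_coef0 char_poly_det mulf_neq0 ?signr_eq0 //.
  by move: xu; rewrite unitmxE unitfE.
have /factor_theorem [q Eq] : root (p - c%:P) 0.
  by rewrite /root hornerD hornerN hornerC subrr.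
have := Cayley_Hamilton x; rewrite -/p.
have -> : p = q * ('X - 0%:P) + c%:P by rewrite -Eq subrK.
rewrite subr0 rmorphD rmorphM /= horner_mx_X horner_mx_C => E.
have -> : invmx x = - c^-1 *: horner_mx x q.
  apply: (can_inj (mulmxK xu)); rewrite mulVmx // -scalemxAl.
  have -> : horner_mx x q *m x = - c%:M.
    by apply/eqP; rewrite -addr_eq0; apply/eqP.
  by rewrite scalerN scaleNr opprK scale_scalar_mx mulVf.
exact: supp_scale.
Qed.

Section Unip.
Variables (F : fieldType) (n : nat).
Implicit Types (r : rel 'I_n) (x y : 'M[F]_n).

Definition unidiag x := forall i, x i i = 1.

Lemma supp_inv_diag r x i :
  reflexive r -> transitive r -> antisymmetric r -> supp r x ->
  x \in unitmx -> invmx x i i = (x i i)^-1.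
Proof.
move=> rr tr ar xr xu; have := supp_mul_diag i ar xr (supp_inv rr tr xr).
rewrite mulmxV // mxE eqxx => E.
have x0 : x i i != 0.
  by apply: contra_eqN (esym E) => /eqP ->; rewrite mul0r eq_sym oner_neq0.
by apply: (mulfI x0); rewrite -E divff.
Qed.

Lemma unidiag_mul r x y : antisymmetric r -> supp r x -> supp r y ->
  unidiag x -> unidiag y -> unidiag (x *m y).
Proof. by move=> ar xr yr x1 y1 i; rewrite (supp_mul_diag i ar) // x1 y1 mulr1. Qed.

Lemma unidiag_inv r x : reflexive r -> transitive r -> antisymmetric r ->
  supp r x -> x \in unitmx -> unidiag x -> unidiag (invmx x).
Proof. by move=> rr tr ar xr xu x1 i; rewrite (supp_inv_diag i rr tr ar) // x1 invr1. Qed.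

Lemma supp_diag_eq x y : supp (fun i j => i == j) x -> supp (fun i j => i == j) y ->
  (forall i, x i i = y i i) -> x = y.
Proof.
move=> xd yd E; apply/matrixP => i j; case: (eqVneq i j) => [->//|ij].
by rewrite xd // yd.
Qed.

Lemma supp_diag_1 x : supp (fun i j => i == j) x -> unidiag x -> x = 1%:M.
Proof.
move=> xd x1; apply: supp_diag_eq => //; first by apply: supp_scalar => i; apply: eqxx.
by move=> i; rewrite x1 mxE eqxx.
Qed.

End Unip.

Section Triangular.
Variables (F : fieldType) (n : nat).
Implicit Types x y : 'M[F]_n.

Definition up_rel : rel 'I_n := fun i j => (i <= j)%N.
Definition low_rel : rel 'I_n := fun i j => (j <= i)%N.
Definition diag_rel : rel 'I_n := fun i j => i == j.

Lemma up_refl : reflexive up_rel. Proof. by move=> i; apply: leqnn. Qed.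
Lemma up_trans : transitive up_rel. Proof. by move=> j i k; apply: leq_trans. Qed.
Lemma up_anti : antisymmetric up_rel.
Proof. by move=> i j H; apply/val_inj/eqP; rewrite eqn_leq. Qed.
Lemma low_refl : reflexive low_rel. Proof. by move=> i; apply: leqnn. Qed.
Lemma low_trans : transitive low_rel.
Proof. by move=> j i k ij jk; apply: leq_trans jk ij. Qed.
Lemma low_anti : antisymmetric low_rel.
Proof. by move=> i j H; apply/val_inj/eqP; rewrite eqn_leq andbC. Qed.
Lemma diag_refl : reflexive diag_rel. Proof. by move=> i; apply: eqxx. Qed.
Lemma diag_trans : transitive diag_rel. Proof. by move=> j i k /eqP ->. Qed.
Lemma diag_anti : antisymmetric diag_rel. Proof. by move=> i j /andP [/eqP]. Qed.

Lemma supp_diagP x : supp up_rel x -> supp low_rel x -> supp diag_rel x.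
Proof.
move=> xu xl; apply: supp_sub (supp_and xu xl) => i j /= H.
by apply/eqP/val_inj/eqP; rewrite eqn_leq.
Qed.

Lemma supp_diag_up x : supp diag_rel x -> supp up_rel x.
Proof. by apply: supp_sub => i j /eqP ->; apply: leqnn. Qed.

Lemma supp_diag_low x : supp diag_rel x -> supp low_rel x.
Proof. by apply: supp_sub => i j /eqP ->; apply: leqnn. Qed.

Lemma supp_tr_up x : supp low_rel x -> supp up_rel x^T.
Proof. by move=> H i j nij; rewrite mxE H. Qed.

Lemma supp_tr_low x : supp up_rel x -> supp low_rel x^T.
Proof. by move=> H i j nij; rewrite mxE H. Qed.

Lemma det_low x : supp low_rel x -> \det x = \prod_i x i i.
Proof.
move=> H; apply: det_trig; apply/is_trig_mxP => i j ij; apply: H.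
by rewrite /low_rel /= -ltnNge.
Qed.

Lemma det_up x : supp up_rel x -> \det x = \prod_i x i i.
Proof.
move=> H; rewrite -det_tr det_low; last exact: supp_tr_low.
by apply: eq_bigr => i _; rewrite mxE.
Qed.

Lemma unip_low_unit x : supp low_rel x -> unidiag x -> x \in unitmx.
Proof.
move=> xl x1; rewrite unitmxE (det_low xl) big1 ?unitr1 //.
Qed.

Lemma unip_up_unit x : supp up_rel x -> unidiag x -> x \in unitmx.
Proof.
move=> xl x1; rewrite unitmxE (det_up xl) big1 ?unitr1 //.
Qed.

Lemma up_unit x : supp up_rel x -> (forall i, x i i != 0) -> x \in unitmx.
Proof. by move=> xl x1; rewrite unitmxE (det_up xl) unitfE; apply/prodf_neq0. Qed.

Lemma supp_low_inv x : supp low_rel x -> supp low_rel (invmx x).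
Proof. by apply: supp_inv; [apply: low_refl|apply: low_trans]. Qed.

Lemma unidiag_low_inv x : supp low_rel x -> unidiag x -> unidiag (invmx x).
Proof.
move=> xl x1; apply: (unidiag_inv low_refl low_trans low_anti) => //.
exact: unip_low_unit.
Qed.

Lemma unidiag_up_inv x : supp up_rel x -> unidiag x -> unidiag (invmx x).
Proof.
move=> xl x1; apply: (unidiag_inv up_refl up_trans up_anti) => //.
exact: unip_up_unit.
Qed.

Lemma supp_diag_mulE x y i j : supp diag_rel x -> (x *m y) i j = x i i * y i j.
Proof.
move=> xd; rewrite mxE (bigD1 i) //= big1 ?addr0 // => k ki.
by rewrite xd ?mul0r // /diag_rel eq_sym.
Qed.

Lemma supp_mul_diagE x y i j : supp diag_rel y -> (x *m y) i j = x i j * y j j.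
Proof.
move=> xd; rewrite mxE (bigD1 j) //= big1 ?addr0 // => k ki.
by rewrite xd ?mulr0.
Qed.

Lemma diag_conj_diag x y : supp diag_rel x -> x \in unitmx -> forall i, (x *m y *m invmx x) i i = y i i.
Proof.
move=> xd xu i.
have xi := supp_inv diag_refl diag_trans xd.
rewrite supp_mul_diagE // supp_diag_mulE // (supp_inv_diag i diag_refl diag_trans diag_anti) //.
rewrite mulrAC divff ?mul1r //.
by move: xu; rewrite unitmxE (det_low (supp_diag_low xd)) unitfE => /prodf_neq0 /(_ i isT).
Qed.

End Triangular.
Arguments up_rel {n}.
Arguments low_rel {n}.
Arguments diag_rel {n}.

(** * Unitary matrices and uniqueness of QR and LU factorisations *)

Section Adjoint.
Variables (R : realType) (n : nat).
Local Notation C := R[i].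
Implicit Types x y b : 'M[C]_n.

Lemma adjmE x i j : adjm x i j = (x j i)^*.
Proof. by rewrite !mxE. Qed.

Lemma adjmM x y : adjm (x *m y) = adjm y *m adjm x.
Proof.
apply/matrixP => i j; rewrite adjmE !mxE rmorph_sum /=; apply: eq_bigr => k _.
by rewrite rmorphM !adjmE mulrC.
Qed.

Lemma adjmK x : adjm (adjm x) = x.
Proof. by apply/matrixP => i j; rewrite !adjmE conjCK. Qed.

Lemma adjmD x y : adjm (x + y) = adjm x + adjm y.
Proof. by apply/matrixP => i j; rewrite !(adjmE, mxE) rmorphD. Qed.

Lemma adjmN x : adjm (- x) = - adjm x.
Proof. by apply/matrixP => i j; rewrite !(adjmE, mxE) rmorphN. Qed.

Lemma adjm1 : adjm (1%:M : 'M[C]_n) = 1%:M.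
Proof. by apply/matrixP => i j; rewrite !(adjmE, mxE) rmorph_nat eq_sym. Qed.

Lemma det_conjm x : \det (conjm x) = (\det x)^*.
Proof. exact: (det_map_mx Num.conj). Qed.

Lemma det_adjm x : \det (adjm x) = (\det x)^*.
Proof. by rewrite det_tr det_conjm. Qed.

Lemma adjm_unit x : (adjm x \in unitmx) = (x \in unitmx).
Proof. by rewrite !unitmxE det_adjm !unitfE fmorph_eq0. Qed.

Lemma adjm_inv x : adjm (invmx x) = invmx (adjm x).
Proof.
have [xu|xn] := boolP (x \in unitmx); last first.
  by rewrite /invmx (negPf xn) adjm_unit (negPf xn).
have au : adjm x \in unitmx by rewrite adjm_unit.
by apply: (can_inj (mulmxK au)); rewrite -adjmM mulmxV // adjm1 mulVmx.
Qed.

Lemma supp_adj_up x : supp low_rel x -> supp up_rel (adjm x).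
Proof. by move=> xl i j nij; rewrite adjmE xl ?rmorph0. Qed.

Lemma supp_adj_low x : supp up_rel x -> supp low_rel (adjm x).
Proof. by move=> xl i j nij; rewrite adjmE xl ?rmorph0. Qed.

Lemma unidiag_adj x : unidiag x -> unidiag (adjm x).
Proof. by move=> x1 i; rewrite adjmE x1 rmorph1. Qed.

Definition unitary x := adjm x *m x = 1%:M.

Lemma unitary_unit x : unitary x -> x \in unitmx.
Proof. by move=> /mulmx1_unit []. Qed.

Lemma unitary_inv x : unitary x -> invmx x = adjm x.
Proof.
move=> xU; have xu := unitary_unit xU.
by apply: (can_inj (mulmxK xu)); rewrite mulVmx.
Qed.

Lemma unitary_mul x y : unitary x -> unitary y -> unitary (x *m y).
Proof.
by move=> xU yU; rewrite /unitary adjmM mulmxA -(mulmxA (adjm y)) xU mulmx1.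
Qed.

Lemma unitary_adj x : unitary x -> unitary (adjm x).
Proof. by move=> xU; rewrite /unitary adjmK; apply: mulmx1C. Qed.

Lemma row_sqnorm_gt0 x i : x \in unitmx -> 0 < (x *m adjm x) i i.
Proof.
move=> xu; rewrite mxE lt_neqAle; apply/andP; split; last first.
  by apply: sumr_ge0 => k _; rewrite adjmE mul_conjC_ge0.
rewrite eq_sym psumr_neq0; last by move=> k _; rewrite adjmE mul_conjC_ge0.
apply: contraT => /hasPn H.
have xi0 k : x i k = 0.
  have := H k (mem_index_enum k); rewrite adjmE /= mul_conjC_gt0 negbK.
  by move/eqP.
have := congr1 (fun m : 'M[C]_n => m i i) (mulmxV xu).
rewrite /= !mxE big1 ?eqxx => [/eqP|k _]; last by rewrite xi0 mul0r.
by rewrite eq_sym oner_eq0.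
Qed.

(** The factor AN of the Iwasawa decomposition. In the order of [R[i]], a positive number is real,
    so the diagonal is real. *)
Definition posup b := supp up_rel b /\ forall i, 0 < b i i.

Lemma posup_unit b : posup b -> b \in unitmx.
Proof. by move=> [bu bp]; apply: up_unit => // i; rewrite gt_eqF. Qed.

Lemma posup_mul x b : posup x -> posup b -> posup (x *m b).
Proof.
move=> [xu xp] [bu bp]; split; first exact: supp_mul (@up_trans n) xu bu.
by move=> i; rewrite (supp_mul_diag i (@up_anti n) xu bu) mulr_gt0.
Qed.

Lemma posup_inv b : posup b -> posup (invmx b).
Proof.
move=> bP; have bU := posup_unit bP; case: (bP) => bu bp.
split; first exact: supp_inv (@up_refl n) (@up_trans n) bu.
move=> i; rewrite (supp_inv_diag i (@up_refl n) (@up_trans n) (@up_anti n)) //.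
by rewrite invr_gt0.
Qed.

(** The inverse of x is its adjoint, so x is the inverse of a lower triangular matrix as well. *)
Lemma unitary_up_diag x : supp up_rel x -> unitary x -> supp diag_rel x.
Proof.
move=> xu xU; apply: supp_diagP => //.
have -> : x = invmx (adjm x) by rewrite -unitary_inv // invmxK.
apply: supp_inv; [exact: low_refl|exact: low_trans|exact: supp_adj_low].
Qed.

Lemma unitary_posup1 x : posup x -> unitary x -> x = 1%:M.
Proof.
move=> [xu xp] xU; have xd := unitary_up_diag xu xU.
apply: supp_diag_1 => // i.
have := congr1 (fun m : 'M[C]_n => m i i) xU.
rewrite /= supp_mul_diagE // adjmE mxE eqxx => E.
have /ger0_norm nx : 0 <= x i i by apply: ltW.
move: E; rewrite -normCKC nx => /eqP.
by rewrite sqrf_eq1 => /orP [/eqP //|/eqP E]; have := xp i; rewrite E oppr_gt0 ltr10.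
Qed.

Lemma QR_unique k1 k2 b1 b2 : unitary k1 -> unitary k2 -> posup b1 -> posup b2 ->
  k1 *m b1 = k2 *m b2 -> k1 = k2 /\ b1 = b2.
Proof.
move=> k1U k2U b1P b2P E.
have u1 := posup_unit b1P.
have E2 : adjm k2 *m k1 = b2 *m invmx b1.
  by apply: (can_inj (mulmxK u1)); rewrite mulmxKV // -mulmxA E mulmxA k2U mul1mx.
have F : b2 *m invmx b1 = 1%:M.
  apply: unitary_posup1; first by apply: posup_mul => //; apply: posup_inv.
  by rewrite -E2; apply: unitary_mul => //; apply: unitary_adj.
split; last by rewrite -[b2](mulmxKV u1) F mul1mx.
by rewrite -[LHS]mul1mx -(mulmx1C k2U) -mulmxA E2 F mulmx1.
Qed.

Lemma LU_unique l1 l2 r1 r2 :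
  supp low_rel l1 -> unidiag l1 -> supp low_rel l2 -> unidiag l2 ->
  supp up_rel r1 -> supp up_rel r2 -> r1 \in unitmx ->
  l1 *m r1 = l2 *m r2 -> l1 = l2 :> 'M[C]_n /\ r1 = r2.
Proof.
move=> l1l l1d l2l l2d r1u r2u u1 E.
have lu2 := unip_low_unit l2l l2d.
have F : invmx l2 *m l1 = r2 *m invmx r1.
  by apply: (can_inj (mulmxK u1)); rewrite mulmxKV // -mulmxA E mulKmx.
have il2 := supp_inv (@low_refl n) (@low_trans n) l2l.
have G : invmx l2 *m l1 = 1%:M.
  apply: supp_diag_1; last first.
    apply: (unidiag_mul (@low_anti n)) => //.
    by apply: (unidiag_inv (@low_refl n) (@low_trans n) (@low_anti n)).
  apply: supp_diagP; last exact: supp_mul (@low_trans n) _ _.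
  by rewrite F; apply: supp_mul (@up_trans n) _ _ => //; apply: supp_inv (@up_refl n) (@up_trans n) _.
have El : l1 = l2 by rewrite -[l1](mulKVmx lu2) G mulmx1.
split=> //; apply: (can_inj (mulKmx lu2)); by rewrite -E El.
Qed.

(** [pik] reads only the entries below the diagonal and the imaginary part of the diagonal, and
    there X and s agree. *)
Lemma pik_unique (X s r : 'M[C]_n) : adjm s = - s -> supp up_rel r ->
  (forall i, (r i i)^* = r i i) -> X = s + r -> pik X = s.
Proof.
move=> sk ru rr ->; apply/matrixP => i j.
have E (p q : 'I_n) : (s q p)^* = - s p q.
  by rewrite -adjmE sk mxE.
rewrite mxE; case: ltnP => [ji|ij].
  by rewrite mxE ru ?addr0 // /up_rel -ltnNge.
case: ltnP => [ltij|ji].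
  by rewrite mxE ru ?addr0 ?E ?opprK // /up_rel -ltnNge.
have <- : i = j by apply/val_inj/eqP; rewrite eqn_leq ij.
by rewrite mxE rmorphD /= rr E; field.
Qed.

End Adjoint.

(** * Factorisations depending smoothly on the matrix *)

(* A class of real functions stable under the operations of Gauss elimination
   and Cholesky factorisation; it is used both for smooth functions on the whole
   space and for functions continuous at each point of an open set [A]. *)
Record fclass (R : realType) (T : Type) (A : set T) := FClass {
  cl :> (T -> R) -> Prop;
  cl_ext : forall f g, (forall x, A x -> f x = g x) -> cl f -> cl g;
  cl_cst : forall c, cl (fun=> c);
  cl_add : forall f g, cl f -> cl g -> cl (fun x => f x + g x);
  cl_mul : forall f g, cl f -> cl g -> cl (fun x => f x * g x);
  cl_inv : forall f, cl f -> (forall x, A x -> f x != 0) -> cl (fun x => (f x)^-1);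
  cl_sqrt : forall f, cl f -> (forall x, A x -> 0 < f x) ->
    cl (fun x => Num.sqrt (f x)) }.

Section ComplexClass.
Variables (R : realType) (T : Type) (A : set T) (K : fclass R A).
Local Notation C := R[i].
Implicit Types f g : T -> C.

Definition ccl f := K (fun x => complex.Re (f x)) /\ K (fun x => complex.Im (f x)).

Lemma ccl_ext f g : (forall x, A x -> f x = g x) -> ccl f -> ccl g.
Proof. by move=> E [fr fi]; split; [apply: cl_ext fr|apply: cl_ext fi] => x /E ->. Qed.

Lemma ccl_cst c : ccl (fun=> c).
Proof. by split; apply: cl_cst. Qed.

Lemma ccl_add f g : ccl f -> ccl g -> ccl (fun x => f x + g x).
Proof.
move=> [fr fi] [gr gi]; split.
- by apply: cl_ext (cl_add fr gr) => x _; case: (f x) (g x) => [a b] [c d].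
- by apply: cl_ext (cl_add fi gi) => x _; case: (f x) (g x) => [a b] [c d].
Qed.

Lemma ccl_mul f g : ccl f -> ccl g -> ccl (fun x => f x * g x).
Proof.
move=> [fr fi] [gr gi]; split.
- apply: cl_ext (cl_add (cl_mul fr gr) (cl_mul (cl_cst K (-1)) (cl_mul fi gi))) => x _.
  by case: (f x) (g x) => [a b] [c d] /=; rewrite mulN1r.
- apply: cl_ext (cl_add (cl_mul fr gi) (cl_mul fi gr)) => x _.
  by case: (f x) (g x) => [a b] [c d] /=.
Qed.

Lemma ccl_opp f : ccl f -> ccl (fun x => - f x).
Proof.
by move=> fc; apply: ccl_ext (ccl_mul (ccl_cst (-1)) fc) => x _; rewrite mulN1r.
Qed.

Lemma ccl_conj f : ccl f -> ccl (fun x => (f x)^*).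
Proof.
move=> [fr fi]; split; first by apply: cl_ext fr => x _; case: (f x).
by apply: cl_ext (cl_mul (cl_cst K (-1)) fi) => x _; case: (f x) => a b /=; rewrite mulN1r.
Qed.

Lemma ccl_real (f : T -> R) : K f -> ccl (fun x => (f x)%:C%C).
Proof. by move=> fc; split=> //; apply: cl_cst. Qed.

(** A class inverts real functions only, so 1/f is written as the conjugate of f divided by its real
    squared modulus. *)
Lemma ccl_inv f : ccl f -> (forall x, A x -> f x != 0) -> ccl (fun x => (f x)^-1).
Proof.
move=> fc f0.
have nc : ccl (fun x => f x * (f x)^*) by apply: ccl_mul => //; apply: ccl_conj.
have E x : f x * (f x)^* = (complex.Re (f x * (f x)^*))%:C%C.
  by case: (f x) => a b /=; apply/eqP; rewrite eq_complex /=; apply/andP; split=> //; apply/eqP; ring.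
have ic : ccl (fun x => ((complex.Re (f x * (f x)^*))^-1)%:C%C).
  apply: ccl_real; apply: cl_inv; first by case: nc.
  move=> x Ax; apply: contraTneq (f0 x Ax) => H.
  by rewrite -mul_conjC_eq0 E H eqxx.
apply: ccl_ext (ccl_mul (ccl_conj fc) ic) => x Ax /=.
have -> : ((complex.Re (f x * (f x)^*))^-1)%:C%C = (f x * (f x)^*)^-1.
  by rewrite [in RHS]E fmorphV.
by rewrite invfM mulrCA divff ?mulr1 // conjC_eq0 f0.
Qed.

Lemma ccl_sqrt f : ccl f -> (forall x, A x -> 0 < f x) ->
  exists2 g, ccl g & forall x, A x -> 0 < g x /\ g x * g x = f x.
Proof.
move=> [fr _] fp.
have fp' x : A x -> 0 < complex.Re (f x) /\ f x = (complex.Re (f x))%:C%C.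
  by move=> /fp; case: (f x) => a b; rewrite ltcE /= => /andP [/eqP -> ->].
exists (fun x => (Num.sqrt (complex.Re (f x)))%:C%C).
  by apply: ccl_real; apply: cl_sqrt => // x /fp' [].
move=> x /fp' [p E]; split; first by rewrite ltcR sqrtr_gt0.
by rewrite [RHS]E -rmorphM /= -expr2 sqr_sqrtr; [|exact: ltW].
Qed.

Lemma ccl_sum (I : Type) (s : seq I) (P : pred I) (F : I -> T -> C) :
  (forall i, ccl (F i)) -> ccl (fun x => \sum_(i <- s | P i) F i x).
Proof.
move=> Fc; elim: s => [|i s IH].
  by apply: ccl_ext (ccl_cst 0) => x _; rewrite big_nil.
case Pi : (P i).
  by apply: ccl_ext (ccl_add (Fc i) IH) => x _; rewrite big_cons Pi.
by apply: ccl_ext IH => x _; rewrite big_cons Pi.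
Qed.

Lemma ccl_prod (I : Type) (s : seq I) (P : pred I) (F : I -> T -> C) :
  (forall i, ccl (F i)) -> ccl (fun x => \prod_(i <- s | P i) F i x).
Proof.
move=> Fc; elim: s => [|i s IH].
  by apply: ccl_ext (ccl_cst 1) => x _; rewrite big_nil.
case Pi : (P i).
  by apply: ccl_ext (ccl_mul (Fc i) IH) => x _; rewrite big_cons Pi.
by apply: ccl_ext IH => x _; rewrite big_cons Pi.
Qed.

Definition mcl n (F : T -> 'M[C]_n) := forall i j, ccl (fun x => F x i j).

Lemma mcl_ext n (F G : T -> 'M[C]_n) :
  (forall x, A x -> F x = G x) -> mcl F -> mcl G.
Proof. by move=> E Fc i j; apply: ccl_ext (Fc i j) => x /E ->. Qed.

Lemma mcl_cst n (M : 'M[C]_n) : mcl (fun=> M).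
Proof. by move=> i j; apply: ccl_cst. Qed.

Lemma mcl_add n (F G : T -> 'M[C]_n) : mcl F -> mcl G -> mcl (fun x => F x + G x).
Proof.
by move=> Fc Gc i j; apply: ccl_ext (ccl_add (Fc i j) (Gc i j)) => x _; rewrite mxE.
Qed.

Lemma mcl_opp n (F : T -> 'M[C]_n) : mcl F -> mcl (fun x => - F x).
Proof.
by move=> Fc i j; apply: ccl_ext (ccl_opp (Fc i j)) => x _; rewrite mxE.
Qed.

Lemma mcl_mul n (F G : T -> 'M[C]_n) : mcl F -> mcl G -> mcl (fun x => F x *m G x).
Proof.
move=> Fc Gc i j.
apply: (@ccl_ext (fun x => \sum_k F x i k * G x k j)); first by move=> x _; rewrite mxE.
by apply: ccl_sum => k; apply: ccl_mul.
Qed.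

Lemma mcl_adj n (F : T -> 'M[C]_n) : mcl F -> mcl (fun x => adjm (F x)).
Proof.
by move=> Fc i j; apply: ccl_ext (ccl_conj (Fc j i)) => x _; rewrite adjmE.
Qed.

Lemma ccl_det n (F : T -> 'M[C]_n) : mcl F -> ccl (fun x => \det (F x)).
Proof.
move=> Fc; apply: ccl_sum => s; apply: ccl_mul; first exact: ccl_cst.
by apply: ccl_prod => i; apply: Fc.
Qed.

Lemma mcl_inv n (F : T -> 'M[C]_n) : mcl F -> (forall x, A x -> F x \in unitmx) ->
  mcl (fun x => invmx (F x)).
Proof.
move=> Fc Fu.
apply: (@mcl_ext _ (fun x => (\det (F x))^-1 *: \adj (F x))).
  by move=> x /Fu u; rewrite /invmx u.
move=> i j.
apply: (@ccl_ext (fun x => (\det (F x))^-1 * cofactor (F x) j i)).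
  by move=> x _; rewrite !mxE.
apply: ccl_mul.
  apply: ccl_inv; first exact: ccl_det.
  by move=> x /Fu; rewrite unitmxE unitfE.
apply: ccl_mul; first exact: ccl_cst.
apply: ccl_det => k l.
by apply: ccl_ext (Fc (lift j k) (lift i l)) => x _; rewrite !mxE.
Qed.

Lemma mcl_diag n (d : 'I_n -> T -> C) : (forall i, ccl (d i)) ->
  mcl (fun x => \matrix_(i, j) if i == j then d i x else 0).
Proof.
move=> dc i j; case E : (i == j).
  by apply: ccl_ext (dc i) => x _; rewrite mxE E.
by apply: ccl_ext (ccl_cst 0) => x _; rewrite mxE E.
Qed.

End ComplexClass.

(** * Leading minors and Gauss elimination with parameters *)

Section Lead.
Variables (F : fieldType) (n : nat).
Implicit Types (k : nat) (M N : 'M[F]_n).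

(* The leading block of size k, completed by the identity: its determinant is
   the k-th leading principal minor, without changing the size of the matrix. *)
Definition lead k M : 'M[F]_n :=
  \matrix_(i, j) if (i < k)%N && (j < k)%N then M i j else (i == j)%:R.

Lemma lead_mul_low k M N : supp low_rel M -> lead k (M *m N) = lead k M *m lead k N.
Proof.
move=> Ml; apply/matrixP => i j; rewrite !mxE.
case: (ltnP i k) => ik /=; last first.
  rewrite (bigD1 i) //= big1 ?addr0 => [|a ai].
    by rewrite !mxE ltnNge ik /= eqxx mul1r.
  by rewrite !mxE ltnNge ik /= eq_sym (negPf ai) mul0r.
case: (ltnP j k) => jk /=.
  apply: eq_bigr => a _; rewrite !mxE ik jk andbT /=.
  case: (ltnP a k) => // ka.
  have ia : (i < a)%N by apply: leq_trans ka.
  have -> : M i a = 0 by apply: Ml; rewrite /low_rel -ltnNge.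
  by rewrite -val_eqE /= ltn_eqF ?mul0r.
rewrite big1 => [|a _]; last first.
  rewrite !mxE ik [(j < k)%N]ltnNge jk andbF /=.
  case: (ltnP a k) => ka.
    by case: eqVneq ka => [->|_]; rewrite ?mulr0 // ltnNge jk.
  by case: eqVneq ka => [<-|_]; rewrite ?mul0r // leqNgt ik.
by case: eqVneq ik => [->|//]; rewrite ltnNge jk.
Qed.

Lemma lead_tr k M : (lead k M)^T = lead k M^T.
Proof. by apply/matrixP => i j; rewrite !mxE andbC eq_sym. Qed.

Lemma det_lead_up k M : supp up_rel M ->
  \det (lead k M) = \prod_(i < n | (i < k)%N) M i i.
Proof.
move=> Mu; rewrite det_up; last first.
  move=> i j nij; rewrite mxE Mu //; case: ifP => // _.
  by case: eqVneq nij => // ->; rewrite /up_rel leqnn.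
rewrite [RHS]big_mkcond /=; apply: eq_bigr => i _; rewrite mxE eqxx andbb.
by case: ifP.
Qed.

Lemma det_lead_low k M : supp low_rel M ->
  \det (lead k M) = \prod_(i < n | (i < k)%N) M i i.
Proof.
move=> Ml; rewrite -det_tr lead_tr det_lead_up; last exact: supp_tr_up.
by apply: eq_bigr => i _; rewrite mxE.
Qed.

(** The value k = n is included, so that M itself is invertible. *)
Definition lead_ok M := forall k, (k <= n)%N -> lead k M \in unitmx.

Lemma lead_ok_LU l r : supp low_rel l -> unidiag l -> supp up_rel r -> r \in unitmx ->
  lead_ok (l *m r).
Proof.
move=> ll l1 ru rU k _; rewrite lead_mul_low // unitmx_mul !unitmxE !unitfE.
rewrite det_lead_low // det_lead_up // big1 ?oner_neq0 //=.
move: rU; rewrite unitmxE det_up // unitfE => /prodf_neq0 H.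
by apply/prodf_neq0 => i _; apply: H.
Qed.

Lemma lead_full M : lead n M = M.
Proof. by apply/matrixP => i j; rewrite mxE !ltn_ord. Qed.

Lemma lead_ok_unit M : lead_ok M -> M \in unitmx.
Proof. by move=> /(_ n (leqnn n)); rewrite lead_full. Qed.

End Lead.

Section Elimination.
Variables (R : realType) (T : Type) (A : set T) (K : fclass R A) (n : nat).
Local Notation C := R[i].
Local Notation mcl := (mcl K).

(** No rows are exchanged, so the multipliers are given by one and the same formula for all x and
    stay in the class. The induction is on the number of cleared columns. *)
Lemma elimination (F : T -> 'M[C]_n) : mcl F -> (forall x, A x -> lead_ok (F x)) ->
  exists l : T -> 'M[C]_n, mcl l /\ forall x, A x ->
    [/\ supp low_rel (l x), unidiag (l x) & supp up_rel (l x *m F x)].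
Proof.
move=> Fc Fok.
suff H k : (k <= n)%N -> exists l : T -> 'M[C]_n, mcl l /\ forall x, A x ->
    [/\ supp low_rel (l x), unidiag (l x) &
        forall i j : 'I_n, (j < k)%N -> (j < i)%N -> (l x *m F x) i j = 0].
  have [l [lc lP]] := H n (leqnn n); exists l; split=> // x /lP [ll l1 lu].
  by split=> // i j; rewrite /up_rel -ltnNge => ji; apply: lu.
elim: k => [_|k IH kn].
  exists (fun=> 1%:M); split; first exact: mcl_cst.
  move=> x _; split=> //; first exact: supp_scalar (@low_refl n).
  by move=> i; rewrite mxE eqxx.
have [l [lc lP]] := IH (ltnW kn).
pose o := Ordinal kn; pose G x := l x *m F x.
have Gc : mcl G by apply: mcl_mul.
(* With k columns cleared, the leading block of size k + 1 is upper triangular; its determinant, a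
   nonzero minor, is the product of the pivots up to [o]. *)
have Goo x : A x -> G x o o != 0.
  move=> Ax; have [ll l1 lu] := lP x Ax.
  have := Fok x Ax k.+1 kn.
  have : lead k.+1 (l x) \in unitmx.
    by rewrite unitmxE det_lead_low // big1 ?unitr1.
  move=> u1 u2; have : lead k.+1 (G x) \in unitmx.
    by rewrite lead_mul_low // unitmx_mul u1.
  rewrite unitmxE unitfE det_up => [/prodf_neq0 /(_ o isT)|i j].
    by rewrite mxE ltnSn.
  rewrite /up_rel -ltnNge => ji; rewrite mxE.
  case: ifP => [/andP [ik jk]|_]; last by rewrite -val_eqE /= gtn_eqF.
  by apply: lu => //; apply: leq_trans ji _.
(* The multipliers of column k: left multiplication by 1 - c clears this column and keeps the
   columns before it. *)
pose c x : 'M[C]_n := \matrix_(i, j) if (j == o) && (k < i)%N then G x i o / G x o o else 0.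
have cE x i j : c x i j = if (j == o) && (k < i)%N then G x i o / G x o o else 0 by rewrite mxE.
have cc : mcl c.
  move=> i j; case E : ((j == o) && (k < i)%N).
    apply: (@ccl_ext _ _ _ _ (fun x => G x i o / G x o o)); first by move=> x _; rewrite cE E.
    by apply: ccl_mul => //; apply: ccl_inv.
  by apply: (@ccl_ext _ _ _ _ (fun=> 0)); [move=> x _; rewrite cE E|apply: ccl_cst].
have cl0 x : supp low_rel (c x).
  move=> i j; rewrite /low_rel -ltnNge => ij; rewrite cE.
  by case: eqVneq ij => //= ->; rewrite /= => ik; rewrite ltnNge (ltnW ik).
have cd x i : c x i i = 0 by rewrite cE; case: eqVneq => //= ->; rewrite ltnn.
have l1 x : supp low_rel (1%:M - c x).
  by apply: supp_sub2; [apply: supp_scalar (@low_refl n)|].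
have d1 x : unidiag (1%:M - c x) 
  by move=> i; rewrite mxE [X in X + _]mxE [X in _ + X]mxE cd eqxx subr0.
exists (fun x => (1%:M - c x) *m l x); split.
  apply: mcl_mul => //; apply: mcl_add; [exact: mcl_cst|exact: mcl_opp].
move=> x Ax; have [ll lu lz] := lP x Ax; split.
- exact: supp_mul (@low_trans n) _ _.
- exact: (unidiag_mul (@low_anti n)).
move=> i j jk ji; rewrite -mulmxA mulmxBl mul1mx -/(G x) [LHS]mxE.
rewrite [X in _ + X]mxE [X in _ - X]mxE (bigD1 o) //= big1 => [|a ao]; last first.
  by rewrite cE (negPf ao) mul0r.
rewrite cE eqxx /= addr0.
move: jk; rewrite ltnS leq_eqVlt => /orP [/eqP jk|jk].
  have -> : j = o by apply/val_inj.
  by rewrite -jk ji divfK ?subrr // Goo.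
rewrite (lz o j jk jk) mulr0 subr0; exact: lz.
Qed.

Lemma LU_class (F : T -> 'M[C]_n) : mcl F -> (forall x, A x -> lead_ok (F x)) ->
  exists l r : T -> 'M[C]_n, [/\ mcl l, mcl r & forall x, A x ->
    [/\ supp low_rel (l x), unidiag (l x), supp up_rel (r x), r x \in unitmx & F x = l x *m r x]].
Proof.
move=> Fc Fok; have [l [lc lP]] := elimination Fc Fok.
exists (fun x => invmx (l x)), (fun x => l x *m F x); split.
- by apply: mcl_inv => // x /lP [? ? ?]; apply: unip_low_unit.
- exact: mcl_mul.
move=> x Ax; have [ll l1 lu] := lP x Ax; have u := unip_low_unit ll l1; split=> //.
- exact: supp_inv (@low_refl n) (@low_trans n) _.
- exact: unidiag_inv (@low_refl n) (@low_trans n) (@low_anti n) _ _ _.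
- by rewrite unitmx_mul u; apply: lead_ok_unit; apply: Fok.
- by rewrite mulKmx.
Qed.

(** A row vector v killed by a leading block is supported on the first k coordinates, so v q^* q is
    orthogonal to v; then v q^* has norm zero. *)
Lemma lead_ok_pos (q : 'M[C]_n) : q \in unitmx -> lead_ok (adjm q *m q).
Proof.
move=> qu k kn; rewrite unitmxE unitfE; apply/negP => /eqP/eqP/det0P [v v0 vE].
have vz (j : 'I_n) : (k <= j)%N -> v 0 j = 0.
  move=> kj; have := congr1 (fun m : 'rV[C]_n => m 0 j) vE.
  rewrite /= !mxE (bigD1 j) //= big1 ?addr0 => [|a aj].
    by rewrite mxE ltnNge kj /= eqxx mulr1.
  by rewrite mxE [(j < k)%N]ltnNge kj andbF (negPf aj) mulr0.
pose y := v *m adjm q.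
have yz : \sum_a y 0 a * (y 0 a)^* = 0.
  have -> : \sum_a y 0 a * (y 0 a)^* = \sum_j (v *m (adjm q *m q)) 0 j * (v 0 j)^*.
    rewrite mulmxA -/y.
    transitivity (\sum_a \sum_j y 0 a * q a j * (v 0 j)^*).
      apply: eq_bigr => a _; rewrite [in X in _ * X]mxE rmorph_sum mulr_sumr.
      apply: eq_bigr => j _; rewrite rmorphM adjmE /= conjCK; ring.
    rewrite exchange_big; apply: eq_bigr => j _; rewrite [in RHS]mxE mulr_suml.
    by [].
  apply: big1 => j _; case: (ltnP j k) => jk; last by rewrite (vz j jk) rmorph0 mulr0.
  suff -> : (v *m (adjm q *m q)) 0 j = 0 by rewrite mul0r.
  have := congr1 (fun m : 'rV[C]_n => m 0 j) vE; rewrite /= [RHS]mxE => <-.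
  rewrite [LHS]mxE [RHS]mxE; apply: eq_bigr => a _.
  rewrite [in RHS]mxE jk andbT; case: (ltnP a k) => // ka.
  by rewrite vz // !mul0r.
have y0 : y = 0.
  apply/rowP => a; rewrite [RHS]mxE; apply/eqP; rewrite -mul_conjC_eq0.
  move/eqP: yz; rewrite psumr_eq0 => [/allP /(_ a (mem_index_enum a))//|b _].
  exact: mul_conjC_ge0.
have au : adjm q \in unitmx by rewrite adjm_unit.
by move: v0; rewrite -[v](mulmxK au) -/y y0 mul0mx eqxx.
Qed.

(* Cholesky: eliminate in F^* F, then take square roots on the diagonal. *)
Lemma QR_class (F : T -> 'M[C]_n) : mcl F -> (forall x, A x -> F x \in unitmx) ->
  exists b : T -> 'M[C]_n, mcl b /\ forall x, A x -> posup (b x) /\ unitary (F x *m invmx (b x)).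
Proof.
move=> Fc Fu; pose P x := adjm (F x) *m F x.
have Pc : mcl P by apply: mcl_mul => //; apply: mcl_adj.
have [l [lc lP]] := elimination Pc (fun x Ax => lead_ok_pos (Fu x Ax)).
(* As l P and l^* are upper triangular, so is D; being Hermitian it is diagonal, with positive
   entries. *)
pose D x := l x *m P x *m adjm (l x).
have Dc : mcl D by apply: mcl_mul; [apply: mcl_mul|apply: mcl_adj].
have DE x : D x = (l x *m adjm (F x)) *m adjm (l x *m adjm (F x)).
  by rewrite adjmM adjmK /D /P !mulmxA.
have Dp x : A x -> forall i, 0 < D x i i.
  move=> Ax i; rewrite DE; apply: row_sqnorm_gt0.
  have [ll l1 _] := lP x Ax.
  by rewrite unitmx_mul (unip_low_unit ll l1) adjm_unit Fu.
have Dd x : A x -> supp diag_rel (D x).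
  move=> Ax; have [ll l1 lu] := lP x Ax.
  have Du : supp up_rel (D x).
    by apply: supp_mul (@up_trans n) lu _; apply: supp_adj_up.
  apply: supp_diagP => //.
  have -> : D x = adjm (D x) by rewrite DE [RHS]adjmM [in RHS]adjmK.
  exact: supp_adj_low.
have /boolp.choice [s sP] : forall i, exists g, ccl K g /\ forall x, A x -> 0 < g x /\ g x * g x = D x i i.
  by move=> i; have [g gc gP] := ccl_sqrt (Dc i i) (fun x Ax => Dp x Ax i); exists g.
pose S x : 'M[C]_n := \matrix_(i, j) if i == j then s i x else 0.
have Sc : mcl S by apply: mcl_diag => i; case: (sP i).
have Sd x : supp diag_rel (S x) by move=> i j /negPf E; rewrite mxE /= -[i == j]/(diag_rel i j) E.
have Sp x : A x -> posup (S x).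
  move=> Ax; split; first exact: supp_diag_up.
  by move=> i; rewrite mxE eqxx; have [_ /(_ x Ax) []] := sP i.
have SS x : A x -> adjm (S x) *m S x = D x.
  move=> Ax; apply: supp_diag_eq.
  - apply: supp_mul (@diag_trans n) _ (Sd x) => i j nij.
    by rewrite adjmE Sd ?rmorph0 // /diag_rel eq_sym.
  - exact: Dd.
  move=> i; rewrite supp_mul_diagE // adjmE mxE eqxx.
  have [_ /(_ x Ax) [g0 gE]] := sP i.
  by rewrite -gE geC0_conj // ltW.
exists (fun x => S x *m adjm (invmx (l x))); split.
  apply: mcl_mul => //; apply: mcl_adj; apply: mcl_inv => // x Ax.
  by have [ll l1 _] := lP x Ax; apply: unip_low_unit.
move=> x Ax; have [ll l1 _] := lP x Ax; have lu := unip_low_unit ll l1.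
have bP : posup (S x *m adjm (invmx (l x))).
  apply: posup_mul; first exact: Sp.
  split.
    apply: supp_adj_up; exact: supp_inv (@low_refl n) (@low_trans n) _.
  move=> i; rewrite unidiag_adj ?ltr01 //.
  exact: unidiag_inv (@low_refl n) (@low_trans n) (@low_anti n) _ _ _.
split=> //; set b := S x *m _ in bP *.
have bu := posup_unit bP.
have E : adjm b *m b = P x.
  rewrite /b adjmM adjmK mulmxA -(mulmxA _ (adjm (S x))) SS // /D.
  have alu : adjm (l x) \in unitmx by rewrite adjm_unit.
  by rewrite adjm_inv !mulmxA mulmxK // mulVmx // mul1mx.
rewrite /unitary adjmM mulmxA -(mulmxA _ (adjm (F x))) -/(P x) -E.
rewrite mulmxA adjm_inv mulVmx ?adjm_unit // mul1mx mulmxV //.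
Qed.

End Elimination.

(** * Eigenvectors and the Toda field *)

Section SignedPerm.
Variables (R : realType) (n : nat).
Local Notation C := R[i].

Definition wmx (s : {perm 'I_n}) (e : {ffun 'I_n -> bool}) : 'M[C]_n :=
  \matrix_(i, j) ((-1) ^+ e i * (s i == j)%:R).

Definition sperm (w : 'M[C]_n) := exists s e, w = wmx s e.

Lemma wmx_mulE s e m (x : 'M[C]_(n, m)) i j : (wmx s e *m x) i j = (-1) ^+ e i * x (s i) j.
Proof.
rewrite mxE (bigD1 (s i)) //= big1 ?addr0 => [|k ki].
  by rewrite mxE eqxx mulr1.
by rewrite mxE eq_sym (negPf ki) mulr0 mul0r.
Qed.

Lemma mul_adj_wmxE s e m (x : 'M[C]_(m, n)) i j :
  (x *m adjm (wmx s e)) i j = x i (s j) * (-1) ^+ e j.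
Proof.
rewrite mxE (bigD1 (s j)) //= big1 ?addr0 => [|k ki].
  by rewrite adjmE mxE eqxx mulr1 rmorphXn rmorphN rmorph1.
by rewrite adjmE mxE eq_sym (negPf ki) mulr0 rmorph0 mulr0.
Qed.

Lemma wmx_unitary s e : unitary (wmx s e).
Proof.
apply: mulmx1C; apply/matrixP => i j; rewrite wmx_mulE adjmE mxE.
rewrite rmorphM rmorphXn rmorphN rmorph1 /= conjC_nat mxE eq_sym (inj_eq perm_inj).
by case: eqVneq => [->|_]; rewrite ?mulr0 // mulr1 -signr_addb addbb.
Qed.

Lemma sperm_unitary w : sperm w -> unitary w.
Proof. by move=> [s [e ->]]; apply: wmx_unitary. Qed.

Lemma sperm_mul w v : sperm w -> sperm v -> sperm (w *m v).
Proof.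
move=> [s [e ->]] [t [f ->]]; exists (s * t)%g, [ffun i => e i (+) f (s i)].
apply/matrixP => i j; rewrite wmx_mulE !mxE ffunE signr_addb permM.
by rewrite mulrA.
Qed.

Lemma sperm1 : sperm 1%:M.
Proof.
exists 1%g, [ffun=> false]; apply/matrixP => i j.
by rewrite !mxE ffunE perm1 expr0 mul1r.
Qed.

Lemma sperm_adj w : sperm w -> sperm (adjm w).
Proof.
move=> [s [e ->]]; exists s^-1%g, [ffun i => e (s^-1%g i)].
apply/matrixP => i j; rewrite adjmE !mxE ffunE.
rewrite rmorphM rmorphXn rmorphN rmorph1 /= conjC_nat.
rewrite (can2_eq (permK s) (permKV s)) eq_sym.
by case: eqVneq => [<-//|_]; rewrite !mulr0.
Qed.

Lemma sperm_conj_diag w : sperm w -> exists s : {perm 'I_n},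
  forall d : 'M[C]_n, supp diag_rel d -> supp diag_rel (w *m d *m adjm w) /\
    forall i, (w *m d *m adjm w) i i = d (s i) (s i).
Proof.
move=> [s [e ->]]; exists s => d dd.
have E i j : (wmx s e *m d *m adjm (wmx s e)) i j = (-1) ^+ e i * d (s i) (s j) * (-1) ^+ e j.
  by rewrite mul_adj_wmxE wmx_mulE.
split=> [i j nij|i]; rewrite E.
  by rewrite dd ?mulr0 ?mul0r // /diag_rel (inj_eq perm_inj).
by rewrite mulrAC -signr_addb addbb mul1r.
Qed.

Lemma sperm_adj_conj_diag w : sperm w -> exists s : {perm 'I_n},
  forall d : 'M[C]_n, supp diag_rel d -> supp diag_rel (adjm w *m d *m w) /\
    forall i, (adjm w *m d *m w) i i = d (s i) (s i).
Proof. by move=> /sperm_adj /sperm_conj_diag; rewrite adjmK. Qed.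

End SignedPerm.

Section Rep.
Variables (R : realType) (n : nat) (L : 'M[R[i]]_n).
Local Notation C := R[i].
Hypotheses (Ld : is_diag L) (Ls : simple_spectrum L).
Implicit Types X u l k b w : 'M[C]_n.

Lemma is_diag_supp : supp diag_rel L.
Proof. by move=> i j; apply: Ld. Qed.

Lemma commute_diag (x : 'M[C]_n) : x *m L = L *m x -> supp diag_rel x.
Proof.
move=> E i j nij; have := congr1 (fun m : 'M[C]_n => m i j) E.
rewrite /= supp_mul_diagE ?supp_diag_mulE; try exact: is_diag_supp.
move/eqP; rewrite mulrC -subr_eq0 -mulrBl mulf_eq0 subr_eq0 => /orP [/eqP /Ls ji|/eqP //].
by rewrite /diag_rel ji eqxx in nij.
Qed.

Lemma intertwiner_diag (g g1 X : 'M[C]_n) : g \in unitmx -> g *m X = L *m g ->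
  g1 *m X = L *m g1 -> supp diag_rel (g1 *m invmx g).
Proof.
move=> gu EX EX1; apply: commute_diag; apply: (can_inj (mulmxK gu)).
by rewrite -!mulmxA -EX mulKmx // EX1 mulVmx // mulmx1.
Qed.

(** The index w selects the chart, u and l carry the coordinates of X, while k and b are auxiliary
    factors of the same eigenvector matrix. *)
Definition rep w X u l k b :=
  [/\ supp up_rel u, unidiag u, supp low_rel l & unidiag l] /\
  [/\ unitary k, posup b, u *m k = w *m l *m b & u *m k *m X = L *m (u *m k)].

Lemma rep_unit w X u l k b : rep w X u l k b -> u *m k \in unitmx.
Proof.
move=> [[uu u1 _ _] [kU _ _ _]].
by rewrite unitmx_mul unip_up_unit // unitary_unit.
Qed.

Lemma rep_X_unique w X X1 u l k b k1 b1 : w \in unitmx ->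
  rep w X u l k b -> rep w X1 u l k1 b1 -> X = X1.
Proof.
move=> wu r r1; have gu := rep_unit r.
move: r r1 => [[uu u1 ll l1] [kU bP E EX]] [_ [k1U b1P E1 EX1]].
have uU := unip_up_unit uu u1.
have F k' b' : posup b' -> u *m k' = w *m l *m b' -> k' *m invmx b' = invmx u *m w *m l.
  move=> b'P E'; apply: (can_inj (mulmxK (posup_unit b'P))).
  rewrite -!mulmxA in E'.
  by rewrite mulmxKV ?posup_unit // -!mulmxA -E' mulKmx.
have [kk _] : k = k1 /\ invmx b = invmx b1.
  by apply: QR_unique => //; try exact: posup_inv; rewrite (F _ _ bP E) (F _ _ b1P E1).
by apply: (can_inj (mulKmx gu)); rewrite EX kk EX1.
Qed.

(** Two matrices of left eigenvectors differ by a diagonal D. Comparing the factors u k shows that D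
    is unitary, comparing the factors l b that its conjugate by w is positive, so D = 1. *)
Lemma rep_unique w X u l k b u1 l1 k1 b1 : sperm w ->
  rep w X u l k b -> rep w X u1 l1 k1 b1 -> u = u1 /\ l = l1.
Proof.
move=> wP r r1; have gu := rep_unit r; have g1u := rep_unit r1.
move: r r1 => [[uu ud ll ld] [kU bP E EX]] [[u1u u1d l1l l1d] [k1U b1P E1 EX1]].
set g := u *m k in gu E EX; set g1 := u1 *m k1 in g1u E1 EX1.
pose D := g1 *m invmx g.
have Dd : supp diag_rel D by apply: intertwiner_diag EX EX1.
have Dg : g1 = D *m g by rewrite /D mulmxKV.
have uU := unip_up_unit uu ud; have u1U := unip_up_unit u1u u1d.
have F : k1 *m adjm k = invmx u1 *m D *m u.
  apply: (can_inj (mulmxK (unitary_unit kU))).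
  rewrite /= -[LHS]mulmxA kU mulmx1 -[RHS]mulmxA -/g -[RHS]mulmxA -Dg /g1 mulKmx //.
have u1i := supp_inv (@up_refl n) (@up_trans n) u1u.
(* The unitary matrix k1 k^* equals u1^{-1} D u, which is upper triangular, so it is diagonal; its
   diagonal is that of D because u and u1 are unipotent. *)
have DE : k1 *m adjm k = D.
  have su : supp up_rel (invmx u1 *m D *m u).
    apply: supp_mul (@up_trans n) _ uu; apply: supp_mul (@up_trans n) u1i _.
    exact: supp_diag_up.
  apply: supp_diag_eq => //.
    apply: unitary_up_diag; first by rewrite F.
    by apply: unitary_mul => //; apply: unitary_adj.
  move=> i; rewrite F (supp_mul_diag i (@up_anti n)) //; last first.
    by apply: supp_mul (@up_trans n) u1i _; exact: supp_diag_up.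
  by rewrite supp_mul_diagE // ud mulr1 unidiag_up_inv // mul1r.
have DU : unitary D by rewrite -DE; apply: unitary_mul => //; apply: unitary_adj.
have wU := sperm_unitary wP.
have [s /(_ D Dd) [Dwd _]] := sperm_adj_conj_diag wP.
set Dw := adjm w *m D *m w in Dwd.
have DwU : unitary Dw.
  by apply: unitary_mul => //; apply: unitary_mul => //; apply: unitary_adj.
have Dwu := unitary_unit DwU.
have E2 : l1 *m b1 = Dw *m l *m invmx Dw *m (Dw *m b).
  rewrite [RHS]mulmxA mulmxKV // -[RHS]mulmxA /Dw -[RHS]mulmxA.
  rewrite [w *m (l *m b)]mulmxA -E -[RHS]mulmxA -Dg E1 -[in RHS](mulmxA w).
  by rewrite [RHS]mulmxA wU mul1mx.
have Dwl := supp_diag_low Dwd.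
have Dwi := supp_inv (@diag_refl n) (@diag_trans n) Dwd.
have sl : supp low_rel (Dw *m l *m invmx Dw).
  apply: supp_mul (@low_trans n) _ (supp_diag_low Dwi).
  exact: supp_mul (@low_trans n) Dwl ll.
have [bu bp] := bP; have [b1u b1p] := b1P.
have [El Eb] : l1 = Dw *m l *m invmx Dw /\ b1 = Dw *m b.
  apply: LU_unique => //.
  - by move=> i; rewrite diag_conj_diag.
  - by apply: supp_mul (@up_trans n) (supp_diag_up Dwd) bu.
  - exact: posup_unit.
(* From b1 = Dw b, both with positive diagonal, Dw is positive, and it is unitary. *)
have Dw1 : Dw = 1%:M.
  apply: unitary_posup1 => //; split; first exact: supp_diag_up.
  move=> i; have := b1p i; rewrite Eb supp_diag_mulE //.
  by rewrite pmulr_lgt0.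
have D1 : D = 1%:M.
  have -> : D = w *m Dw *m adjm w.
    have wU' := mulmx1C wU.
    by rewrite /Dw !mulmxA wU' mul1mx -mulmxA wU' mulmx1.
  by rewrite Dw1 mulmx1 (mulmx1C wU).
split; last by rewrite El Dw1 invmx1 mul1mx mulmx1.
apply: (can_inj (mulKmx (_ : invmx u1 \in unitmx))); first by rewrite unitmx_inv.
by rewrite mulVmx // -[LHS]/(invmx u1 *m u) -[RHS]D1 -DE F D1 mulmx1.
Qed.

Lemma skew_conj (k dk : 'M[C]_n) : unitary k -> adjm dk *m k + adjm k *m dk = 0 ->
  adjm (dk *m adjm k) = - (dk *m adjm k).
Proof.
move=> kU /eqP; rewrite addr_eq0 => /eqP E; have kU' := mulmx1C kU.
rewrite adjmM adjmK -[LHS]mulmx1 -kU' mulmxA -(mulmxA k) E.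
by rewrite mulmxN mulNmx !mulmxA kU' mul1mx.
Qed.

(** The infinitesimal version of [rep_unique]: the relations of [rep] are differentiated with X
    fixed. Now D = dg g^{-1} is diagonal, with imaginary entries because dk k^* is skew-Hermitian
    and with real entries because db b^{-1} has real diagonal, so D = 0. *)
Lemma rep_tangent_inj w X u l k b du dl dk db : sperm w -> rep w X u l k b ->
  supp up_rel du -> (forall i, du i i = 0) ->
  supp low_rel dl -> (forall i, dl i i = 0) ->
  adjm dk *m k + adjm k *m dk = 0 ->
  supp up_rel db -> (forall i, (db i i)^* = db i i) ->
  du *m k + u *m dk = w *m (dl *m b + l *m db) ->
  (du *m k + u *m dk) *m X = L *m (du *m k + u *m dk) ->
  du = 0 /\ dl = 0.
Proof.
move=> wP r duu dud dll dld dkE dbu dbr Eg EX; have gu := rep_unit r.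
move: r => [[uu ud ll ld] [kU bP E EL]]; set dg := _ + _ in Eg EX.
set g := u *m k in gu E EL; have kU' := mulmx1C kU.
pose D := dg *m invmx g.
have Dd : supp diag_rel D by apply: intertwiner_diag EL EX.
have Dg : dg = D *m g by rewrite /D mulmxKV.
pose ka := dk *m adjm k.
have kaS : adjm ka = - ka by apply: skew_conj.
have uU := unip_up_unit uu ud.
have E1 : du + u *m ka = D *m u.
  apply: (can_inj (mulmxK (unitary_unit kU))); rewrite /= mulmxDl -[u *m ka *m k]mulmxA.
  by rewrite /ka -(mulmxA dk) kU mulmx1 -/dg Dg /g mulmxA.
have kaE : ka = invmx u *m (D *m u - du) by rewrite -E1 addrC addKr mulKmx.
have kau : supp up_rel ka.
  rewrite kaE; apply: supp_mul (@up_trans n) _ _.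
    exact: supp_inv (@up_refl n) (@up_trans n) uu.
  apply: supp_sub2 => //.
  by apply: supp_mul (@up_trans n) _ uu; apply: supp_diag_up.
have kad : supp diag_rel ka.
  apply: supp_diagP => //; rewrite -[ka]opprK -kaS; apply: supp_opp.
  exact: supp_adj_low.
have kaD : ka = D.
  apply: supp_diag_eq => // i.
  have : du i i + (u *m ka) i i = (D *m u) i i by rewrite -E1 [RHS]mxE.
  rewrite dud add0r supp_diag_mulE // (supp_mul_diag i (@up_anti n)) //.
  by rewrite ud mulr1 mul1r.
have Dim i : (D i i)^* = - D i i by rewrite -adjmE -kaD kaS mxE.
have [s /(_ D Dd) [Dwd Dwi]] := sperm_adj_conj_diag wP.
set Dw := adjm w *m D *m w in Dwd Dwi.
have wU := sperm_unitary wP; have wU' := mulmx1C wU.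
have bU := posup_unit bP; have [bu bp] := bP.
have lU := unip_low_unit ll ld.
have E2 : Dw *m l *m b = dl *m b + l *m db.
  rewrite /Dw -[LHS]mulmxA -[LHS]mulmxA [w *m (l *m b)]mulmxA -E -[LHS]mulmxA -Dg Eg.
  by rewrite [LHS]mulmxA wU mul1mx.
have li := supp_inv (@low_refl n) (@low_trans n) ll.
have bi := posup_inv bP; have [biu bip] := bi.
have E3 : db *m invmx b = invmx l *m (Dw *m l) - invmx l *m dl.
  apply: (can_inj (mulmxK bU)); rewrite /= mulmxKV // -mulmxBr -mulmxA mulmxBl E2.
  by rewrite [dl *m b + _]addrC addrK mulKmx.
have ll1 : supp low_rel (invmx l *m (Dw *m l)).
  apply: supp_mul (@low_trans n) li _; apply: supp_mul (@low_trans n) _ ll.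
  exact: supp_diag_low.
have ll2 : supp low_rel (invmx l *m dl) by apply: supp_mul (@low_trans n) li _.
have dbd : supp diag_rel (db *m invmx b).
  apply: supp_diagP; first exact: supp_mul (@up_trans n) dbu biu.
  by rewrite E3; apply: supp_sub2.
have dbE i : (db *m invmx b) i i = Dw i i.
  rewrite E3 [LHS]mxE [X in _ + X]mxE.
  rewrite (supp_mul_diag i (@low_anti n) li dll) dld mulr0 subr0.
  have Dwl : supp low_rel (Dw *m l).
    by apply: supp_mul (@low_trans n) _ ll; exact: supp_diag_low.
  rewrite (supp_mul_diag i (@low_anti n) li Dwl) unidiag_low_inv // mul1r.
  by rewrite supp_diag_mulE // ld mulr1.
have Dw0 i : Dw i i = 0.
  have : (Dw i i)^* = Dw i i.
    rewrite -dbE (supp_mul_diag i (@up_anti n) dbu biu) rmorphM /= dbr.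
    by rewrite (geC0_conj (ltW (bip i))).
  rewrite Dwi Dim => /eqP; rewrite eq_sym -addr_eq0 -mulr2n mulrn_eq0 /=.
  by move/eqP.
have dz : supp diag_rel (0 : 'M[C]_n) by move=> i j _; rewrite mxE.
have DwZ : Dw = 0 by apply: supp_diag_eq => // i; rewrite Dw0 mxE.
have DZ : D = 0.
  have -> : D = w *m Dw *m adjm w.
    by rewrite /Dw !mulmxA wU' mul1mx -mulmxA wU' mulmx1.
  by rewrite DwZ mulmx0 mul0mx.
split; first by move: E1; rewrite kaD DZ mulmx0 addr0 mul0mx.
have dbZ : db *m invmx b = 0 by apply: supp_diag_eq => // i; rewrite dbE Dw0 mxE.
move: E3; rewrite dbZ DwZ mul0mx mulmx0 sub0r => /eqP; rewrite eq_sym oppr_eq0 => /eqP E3.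
by rewrite -[dl](mulKVmx lU) E3 mulmx0.
Qed.

Lemma rep_tangent_toda w X u l k b du dl dk db dX P A : sperm w -> rep w X u l k b ->
  L = P + A -> supp diag_rel A -> (forall i, (A i i)^* = A i i) -> adjm P = - P ->
  du = u *m P - P *m u ->
  dl = (adjm w *m A *m w) *m l - l *m (adjm w *m A *m w) ->
  adjm dk *m k + adjm k *m dk = 0 ->
  supp up_rel db -> (forall i, (db i i)^* = db i i) ->
  du *m k + u *m dk = w *m (dl *m b + l *m db) ->
  (du *m k + u *m dk) *m X + u *m k *m dX = L *m (du *m k + u *m dk) ->
  dX = toda X.
Proof.
move=> wP r LE Ad Ar PS duE dlE dkE dbu dbr Eg EX; have gu := rep_unit r.
move: r => [[uu ud ll ld] [kU bP E EL]]; set dg := _ + _ in Eg EX.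
set g := u *m k in gu E EL EX; have kU' := mulmx1C kU.
have [s /(_ A Ad) [Awd Awi]] := sperm_adj_conj_diag wP.
set Aw := adjm w *m A *m w in Awd Awi dlE.
have wU := sperm_unitary wP; have wU' := mulmx1C wU.
have wAw : w *m Aw = A *m w by rewrite /Aw !mulmxA wU' mul1mx.
clearbody Aw.
have bU := posup_unit bP; have [bu bp] := bP.
have bi := posup_inv bP; have [biu bip] := bi.
pose ka := dk *m adjm k.
have kaS : adjm ka = - ka by apply: skew_conj.
pose S := adjm k *m (P + ka) *m k.
have SS : adjm S = - S.
  by rewrite /S !adjmM adjmD adjmK PS kaS -opprD mulNmx mulmxN mulmxA.
pose r := invmx b *m (db - Aw *m b).
have kak : ka *m k = dk by rewrite /ka -mulmxA kU mulmx1.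
have gS : g *m S = u *m P *m k + u *m dk.
  rewrite /g /S !mulmxA -(mulmxA u) kU' mulmx1 -[in RHS]kak.
  by rewrite mulmxDr mulmxDl !mulmxA.
have dgE : dg = g *m S - P *m g.
  by rewrite gS /dg duE mulmxBl /g mulmxA addrAC.
clearbody g.
have dgE2 : dg = A *m g + g *m r.
  have -> : g *m r = w *m l *m (db - Aw *m b) by rewrite /r E !mulmxA mulmxK.
  rewrite Eg dlE E mulmxDr mulmxBl !mulmxBr !mulmxA wAw.
  by rewrite -!addrA; congr (_ + _); rewrite addrC.
have XE : X = S + - r.
  apply: (can_inj (mulKmx gu)); rewrite mulmxDr mulmxN EL LE mulmxDl.
  apply/eqP; rewrite eq_sym subr_eq -addrA -dgE2 dgE.
  by rewrite addrC subrK.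
have rE : r = invmx b *m db - invmx b *m (Aw *m b) by exact: mulmxBr.
have Abu : supp up_rel (Aw *m b).
  by apply: supp_mul (@up_trans n) _ bu; exact: supp_diag_up.
have ru : supp up_rel (- r).
  apply: supp_opp; rewrite rE; apply: supp_sub2; exact: supp_mul (@up_trans n) _ _.
have rr i : ((- r) i i)^* = (- r) i i.
  rewrite mxE rmorphN /=; congr (- _).
  rewrite rE mxE [X in _ + X]mxE rmorphD rmorphN /=.
  rewrite (supp_mul_diag i (@up_anti n) biu dbu) (supp_mul_diag i (@up_anti n) biu Abu).
  rewrite supp_diag_mulE // !rmorphM /= dbr Awi Ar.
  by rewrite (geC0_conj (ltW (bip i))) (geC0_conj (ltW (bp i))).
have pE : pik X = S := pik_unique SS ru rr XE.
clearbody S.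
rewrite /toda pE; apply: (can_inj (mulKmx gu)).
have -> : g *m dX = L *m dg - dg *m X by rewrite -EX addrC addKr.
rewrite dgE mulmxBr mulmxBl mulmxBr !mulmxA -EL.
have PL : P *m L = L *m P.
  have Pd : supp diag_rel P.
    have -> : P = L - A by rewrite LE addrK.
    by apply: supp_sub2 => //; exact: is_diag_supp.
  apply/matrixP => i j; rewrite supp_mul_diagE; last exact: is_diag_supp.
  rewrite supp_diag_mulE; last exact: is_diag_supp.
  case: (eqVneq i j) => [->|ij]; first by rewrite mulrC.
  by rewrite Pd // mulr0 mul0r.
rewrite -PL -[P *m L *m g]mulmxA -EL !mulmxA.
by rewrite opprB addrA subrK.
Qed.

End Rep.

Section RepClass.
Variables (R : realType) (T : Type) (A : set T) (K : fclass R A) (n : nat).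
Variables (L w : 'M[R[i]]_n).
Hypotheses (Ld : is_diag L) (wP : sperm w).
Local Notation C := R[i].
Local Notation mcl := (mcl K).

Lemma mulmxUK (p q y : 'M[C]_n) : unitary q -> p *m adjm q *m (q *m y) = p *m y.
Proof. by move=> qU; rewrite -mulmxA [adjm q *m _]mulmxA qU mul1mx. Qed.

Lemma conj_mul (y z : 'M[C]_n) :
  w *m y *m adjm w *m z = w *m (y *m (adjm w *m z *m w)) *m adjm w.
Proof.
have wU := mulmx1C (sperm_unitary wP).
by rewrite !mulmxA -[RHS]mulmxA wU mulmx1.
Qed.

(** Any unipotent u and l are admissible: a QR factorisation of u^{-1} w l gives k and the inverse
    of b, and X is then forced to be g^{-1} L g with g = u k. *)
Lemma rep_class (u l : T -> 'M[C]_n) : mcl u -> mcl l ->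
  (forall x, A x -> [/\ supp up_rel (u x), unidiag (u x), supp low_rel (l x) & unidiag (l x)]) ->
  exists k b X : T -> 'M[C]_n, [/\ mcl k, mcl b, mcl X &
    forall x, A x -> rep L w (X x) (u x) (l x) (k x) (b x)].
Proof.
move=> uc lc ul.
have uU x : A x -> u x \in unitmx by move=> /ul [? ? _ _]; apply: unip_up_unit.
have lU x : A x -> l x \in unitmx by move=> /ul [_ _ ? ?]; apply: unip_low_unit.
have wU := unitary_unit (sperm_unitary wP).
pose q x := invmx (u x) *m (w *m l x).
have qc : mcl q.
  by apply: mcl_mul; [apply: mcl_inv|apply: mcl_mul => //; apply: mcl_cst].
have qU x : A x -> q x \in unitmx.
  by move=> Ax; rewrite /q !unitmx_mul unitmx_inv uU // wU lU.
have [b [bc bP]] := QR_class qc qU.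
have bU x : A x -> b x \in unitmx by move=> /bP [/posup_unit].
have bic : mcl (fun x => invmx (b x)) by apply: mcl_inv.
pose k x := q x *m invmx (b x).
have kc : mcl k by apply: mcl_mul.
have ukU x : A x -> u x *m k x \in unitmx.
  by move=> Ax; rewrite unitmx_mul uU //=; apply: unitary_unit; case: (bP x Ax).
exists k, (fun x => invmx (b x)), (fun x => invmx (u x *m k x) *m L *m (u x *m k x)).
split; [exact: kc|exact: bic| |].
  have ukc : mcl (fun x => u x *m k x) by apply: mcl_mul.
  apply: (mcl_mul _ ukc); apply: mcl_mul; last exact: mcl_cst.
  exact: mcl_inv ukc ukU.
move=> x Ax; have [bp kU] := bP x Ax; split; first exact: ul.
split; [exact: kU|exact: posup_inv| |].
  by rewrite /k /q mulmxA mulKVmx ?uU.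
by rewrite -[_ *m L *m _]mulmxA mulKVmx // ukU.
Qed.

(* Every matrix of left eigenvectors can be rescaled by a diagonal matrix so as
   to satisfy the normalisation of [rep]. *)
Lemma rep_of_eigvecs (G : T -> 'M[C]_n) : mcl G ->
  (forall x, A x -> lead_ok (adjm w *m G x)) ->
  exists u l : T -> 'M[C]_n, [/\ mcl u, mcl l & forall x, A x ->
    forall X, G x *m X = L *m G x -> exists k b, rep L w X (u x) (l x) k b].
Proof.
move=> Gc Gok; have wU := sperm_unitary wP; have wU' := mulmx1C wU.
have GU x : A x -> G x \in unitmx.
  by move=> /Gok /lead_ok_unit; rewrite unitmx_mul => /andP [].
have Gic : mcl (fun x => invmx (G x)) by apply: mcl_inv.
(* Factoring the inverse of G puts the triangular factor on the left: G = B k with k unitary. *)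
have [b0 [b0c b0P]] : exists b, mcl b /\ forall x, A x -> posup (b x) /\
    unitary (invmx (G x) *m invmx (b x)).
  by apply: QR_class => // x Ax; rewrite unitmx_inv GU.
have b0U x : A x -> b0 x \in unitmx by move=> /b0P [/posup_unit].
pose B x := invmx (b0 x).
have Bc : mcl B by apply: mcl_inv.
have BP x : A x -> posup (B x) by move=> /b0P [? _]; apply: posup_inv.
have [lf [r [lfc rc lrP]]] : exists l r : T -> 'M[C]_n, [/\ mcl l, mcl r & forall x, A x ->
    [/\ supp low_rel (l x), unidiag (l x), supp up_rel (r x), r x \in unitmx &
      adjm w *m G x = l x *m r x]].
  by apply: LU_class => //; apply: mcl_mul => //; apply: mcl_cst.
have r0 x : A x -> forall i, r x i i != 0.
  move=> /lrP [_ _ ru rU _] i; move: rU.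
  by rewrite unitmxE unitfE det_up // => /prodf_neq0 /(_ i isT).
have /boolp.choice [s sP] : forall i, exists g, ccl K g /\
    forall x, A x -> 0 < g x /\ g x * g x = r x i i * (r x i i)^*.
  move=> i; have [||g gc gP] := @ccl_sqrt _ _ _ K (fun x => r x i i * (r x i i)^*).
  - by apply: ccl_mul => //; apply: ccl_conj.
  - by move=> x /r0 /(_ i) H; rewrite mul_conjC_gt0.
  by exists g.
(* The inverse phases of the pivots r_ii, where [s i] is the modulus of r_ii. *)
pose th x : 'M[C]_n := \matrix_(i, j) if i == j then (r x i i)^* / s i x else 0.
have thc : mcl th.
  apply: mcl_diag => i; apply: ccl_mul; first exact: ccl_conj.
  by apply: ccl_inv; [case: (sP i)|move=> x Ax; have [_ /(_ x Ax) [/gt_eqF ->]] := sP i].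
have diagE (d : 'I_n -> C) : supp diag_rel (\matrix_(i, j) if i == j then d i else 0).
  by move=> i j; rewrite mxE /diag_rel => /negPf ->.
have thd x : supp diag_rel (th x) by apply: diagE.
have thE x i : th x i i = (r x i i)^* / s i x by rewrite mxE eqxx.
(* The row scaling that makes B unipotent. *)
pose ai x : 'M[C]_n := \matrix_(i, j) if i == j then (B x i i)^-1 else 0.
have aic : mcl ai.
  apply: mcl_diag => i; apply: ccl_inv; first exact: Bc.
  by move=> x /BP [_ /(_ i) /gt_eqF ->].
have aid x : supp diag_rel (ai x) by apply: diagE.
have aiE x i : ai x i i = (B x i i)^-1 by rewrite mxE eqxx.
have [p1 p1P] := sperm_conj_diag wP; have [p2 p2P] := sperm_adj_conj_diag wP.
(* The rescaled eigenvector matrix is be ai G, with [be] the conjugate of [th] by w. Since be ai = w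
   tau w^*, the factor [tau] is the same scaling seen from the side of the LU factorisation. *)
pose tau x := th x *m (adjm w *m ai x *m w).
have tauc : mcl tau.
  by apply: mcl_mul => //; apply: mcl_mul; [apply: mcl_mul => //|]; apply: mcl_cst.
pose be x := w *m th x *m adjm w.
have bec : mcl be by apply: mcl_mul; [apply: mcl_mul => //|]; apply: mcl_cst.
have taud x : supp diag_rel (tau x).
  by apply: supp_mul (@diag_trans n) (thd x) _; case: (p2P _ (aid x)).
have tauE x i : tau x i i = th x i i * ai x (p2 i) (p2 i).
  by rewrite supp_diag_mulE //; case: (p2P _ (aid x)) => _ ->.
have thU x : A x -> unitary (th x).
  move=> Ax; apply: supp_diag_eq.
  - apply: supp_mul (@diag_trans n) _ (thd x) => i j nij.
    by rewrite adjmE thd ?rmorph0 // /diag_rel eq_sym.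
  - by apply: supp_scalar (@diag_refl n).
  move=> i; rewrite supp_mul_diagE // adjmE thE [RHS]mxE eqxx.
  have [_ /(_ x Ax) [s0 sE]] := sP i.
  rewrite rmorphM /= conjCK fmorphV /= (geC0_conj (ltW s0)).
  by rewrite mulrACA -invfM sE divff // mul_conjC_eq0 r0.
have tauU x : A x -> tau x \in unitmx.
  move=> Ax; apply: up_unit; first exact: supp_diag_up.
  move=> i; rewrite tauE aiE thE; have [_ Bp] := BP x Ax.
  have [_ /(_ x Ax) [s0 sE]] := sP i.
  by rewrite !mulf_neq0 ?invr_eq0 ?conjC_eq0 ?r0 ?gt_eqF.
exists (fun x => be x *m (ai x *m B x) *m adjm (be x)),
  (fun x => tau x *m lf x *m invmx (tau x)); split.
- by apply: mcl_mul; [apply: mcl_mul => //; apply: mcl_mul|apply: mcl_adj].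
- by apply: mcl_mul; [apply: mcl_mul|apply: mcl_inv].
move=> x Ax X GX; have [lfl lf1 ru rU lrE] := lrP x Ax.
have [b0p k0U] := b0P x Ax; have [Bu Bp] := BP x Ax.
have beU : unitary (be x).
  by rewrite /be; apply: unitary_mul; [apply: unitary_mul => //; apply: thU|apply: unitary_adj].
have bed : supp diag_rel (be x) by case: (p1P _ (thd x)).
have bead : supp diag_rel (adjm (be x)).
  by move=> i j nij; rewrite adjmE bed ?rmorph0 // /diag_rel eq_sym.
have aBu : supp up_rel (ai x *m B x).
  by apply: supp_mul (@up_trans n) _ Bu; apply: supp_diag_up.
pose k := be x *m adjm (invmx (G x) *m B x).
have kU : unitary k by apply: unitary_mul => //; apply: unitary_adj.
have GE : G x = B x *m adjm (invmx (G x) *m B x).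
  have Bi : B x = G x *m (invmx (G x) *m B x) by rewrite mulKVmx ?GU.
  have kU' : (invmx (G x) *m B x) *m adjm (invmx (G x) *m B x) = 1%:M by apply: mulmx1C.
  by rewrite {1}Bi -mulmxA kU' mulmx1.
have gE : be x *m (ai x *m B x) *m adjm (be x) *m k = be x *m ai x *m G x.
  rewrite mulmxUK // -[RHS]mulmxA -[LHS]mulmxA; congr (_ *m _).
  by rewrite -[LHS]mulmxA -GE.
have gE2 : be x *m ai x *m G x = w *m tau x *m adjm w *m G x.
  by congr (_ *m _); apply: conj_mul.
exists k, (tau x *m r x); split; split.
- apply: supp_mul (@up_trans n) _ (supp_diag_up bead).
  by apply: supp_mul (@up_trans n) (supp_diag_up bed) aBu.
- move=> i; rewrite -unitary_inv // diag_conj_diag //; last exact: unitary_unit.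
  by rewrite supp_diag_mulE // aiE mulVf // gt_eqF.
- apply: supp_mul (@low_trans n) _ (supp_low_inv (supp_diag_low (taud x))).
  by apply: supp_mul (@low_trans n) (supp_diag_low (taud x)) lfl.
- by move=> i; rewrite diag_conj_diag // tauU.
- exact: kU.
- split; first by apply: supp_mul (@up_trans n) (supp_diag_up (taud x)) ru.
  move=> i; rewrite supp_diag_mulE // tauE thE aiE.
  have [_ /(_ x Ax) [s0 sE]] := sP i.
  rewrite mulrAC mulr_gt0 ?invr_gt0 // mulrAC mulr_gt0 ?invr_gt0 //.
  by rewrite mulrC mul_conjC_gt0 r0.
- rewrite gE gE2 -[w *m tau x *m adjm w *m G x]mulmxA lrE.
  move: (tau x) (tauU x Ax) (lf x) (r x) => t tU y z.
  by rewrite !mulmxA mulmxKV.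
rewrite gE; set D := be x *m ai x.
have Dd : supp diag_rel D by apply: supp_mul (@diag_trans n) bed (aid x).
clearbody D.
have DL : D *m L = L *m D.
  apply/matrixP => i j; rewrite supp_mul_diagE; last exact: is_diag_supp.
  rewrite supp_diag_mulE; last exact: is_diag_supp.
  case: (eqVneq i j) => [->|ij]; first exact: mulrC.
  by rewrite (Dd i j ij) mul0r mulr0.
by rewrite -[LHS]mulmxA GX [LHS]mulmxA DL [RHS]mulmxA.
Qed.

End RepClass.

(** * Differential calculus on matrices *)

Section CkTheory.
Variables (R : realType) (U : normedModType R).

Lemma Ck_le (V : normedModType R) k (f : U -> V) A : Ck k.+1 f A -> Ck k f A.
Proof.
elim: k f => [|k IH] f [fd fk]; first by move=> x /fd; apply: differentiable_continuous.
by split=> // v; apply: IH; apply: fk.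
Qed.

Lemma Ck_cst (V : normedModType R) k (c : V) A : Ck k (fun _ : U => c) A.
Proof.
elim: k c => [|k IH] c /=; first by move=> x _; apply: cst_continuous.
split=> [x _|v]; first exact: (differentiable_cst c x).
rewrite (_ : (fun x => _) = (fun=> 0)); first exact: IH.
by apply/funext => x; rewrite (diff_cst c x).
Qed.

Lemma Ck_add (V : normedModType R) k (f g : U -> V) :
  Ck k f setT -> Ck k g setT -> Ck k (fun x => f x + g x) setT.
Proof.
elim: k f g => [|k IH] f g /= => [fc gc x _|[fd fk] [gd gk]].
  by apply: continuousD; [apply: fc|apply: gc].
split=> [x _|v]; first by apply: (differentiableD (fd x I) (gd x I)).
rewrite (_ : (fun x => _) = (fun x => 'd f x v + 'd g x v)); first by apply: IH.
by apply/funext => x; rewrite (diffD (fd x I) (gd x I)).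
Qed.

Lemma Ck_mul k (f g : U -> R) :
  Ck k f setT -> Ck k g setT -> Ck k (fun x => f x * g x) setT.
Proof.
elim: k f g => [|k IH] f g fc gc.
  by move=> x _; apply: continuousM; [apply: fc|apply: gc].
have [fd fk] := fc; have [gd gk] := gc.
split=> [x _|v]; first by apply: (differentiableM (fd x I) (gd x I)).
rewrite (_ : (fun x => _) = (fun x => f x * 'd g x v + g x * 'd f x v)).
  apply: Ck_add; apply: IH; [exact: Ck_le fc|exact: gk|exact: Ck_le gc|exact: fk].
by apply/funext => x; rewrite (diffM (fd x I) (gd x I)).
Qed.

(** The derivative is a product of 1/f, again 1/f, and the derivative of f. The induction on k
    therefore supplies the smoothness of its own factors; [Ck_sqrt] works in the same way. *)
Lemma Ck_inv k (f : U -> R) : (forall x, f x != 0) ->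
  Ck k f setT -> Ck k (fun x => (f x)^-1) setT.
Proof.
move=> f0; elim: k => [|k IH] fc.
  by move=> x _; apply: continuousV; [apply: f0|apply: fc].
have [fd fk] := fc.
split=> [x _|v]; first by apply: (differentiableV (fd x I) (f0 x)).
rewrite (_ : (fun x => _) = (fun x => -1 * ((f x)^-1 * (f x)^-1) * 'd f x v)).
  have := IH (Ck_le fc) => ic.
  apply: Ck_mul; last exact: fk.
  by apply: Ck_mul; [apply: Ck_cst|apply: Ck_mul].
apply/funext => x; rewrite (diffV (fd x I) (f0 x)) /=.
by rewrite mulN1r -invfM -expr2.
Qed.

Lemma diff_sqrt_comp (f : U -> R) x : differentiable f x -> 0 < f x ->
  differentiable (fun y => Num.sqrt (f y)) x /\
  forall v, 'd (fun y => Num.sqrt (f y)) x v = (2 * Num.sqrt (f x))^-1 * 'd f x v.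
Proof.
move=> fd f0; have sD := is_derive1_sqrt f0.
have sd : differentiable (@Num.sqrt R) (f x).
  by apply/derivable1_diffP; apply: ex_derive.
split; first exact: (differentiable_comp fd sd).
move=> v.
transitivity ('d (@Num.sqrt R) (f x) ('d f x v)).
  exact: (congr1 (fun h => h v) (diff_comp fd sd)).
rewrite (diff1E sd) derive1E (derive_sqrt f0).
exact: mulrC.
Qed.

Lemma Ck_sqrt k (f : U -> R) : (forall x, 0 < f x) ->
  Ck k f setT -> Ck k (fun x => Num.sqrt (f x)) setT.
Proof.
move=> f0; elim: k => [|k IH] fc.
  move=> x _; apply: (@continuous_comp _ _ _ f (@Num.sqrt R)); first exact: fc.
  exact: sqrt_continuous.
have [fd fk] := fc.
split=> [x _|v]; first by have [] := diff_sqrt_comp (fd x I) (f0 x).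
rewrite (_ : (fun x => _) = (fun x => (2 * Num.sqrt (f x))^-1 * 'd f x v)).
  apply: Ck_mul; last exact: fk.
  apply: Ck_inv => [x|].
    by rewrite mulf_neq0 ?pnatr_eq0 // gt_eqF // sqrtr_gt0.
  by apply: Ck_mul; [apply: Ck_cst|apply: IH; apply: Ck_le].
by apply/funext => x; have [_ H] := diff_sqrt_comp (fd x I) (f0 x); apply: H.
Qed.

Lemma Ck_scalel (V : normedModType R) k (f : U -> R) (e : V) :
  Ck k f setT -> Ck k (fun x => f x *: e) setT.
Proof.
elim: k f => [|k IH] f fc.
  move=> x _; apply: (@continuous_comp _ _ _ f ( *:%R ^~ e)); first exact: fc.
  exact: scalel_continuous.
have [fd fk] := fc.
split=> [x _|v]; first exact: (differentiableZl _ (fd x I)).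
rewrite (_ : (fun x => _) = (fun x => 'd f x v *: e)); first exact: (IH _ (fk v)).
by apply/funext => x; rewrite (diffZl _ (fd x I)).
Qed.

Lemma Ck_sum (V : normedModType R) k (I : Type) (s : seq I) (F : I -> U -> V) :
  (forall i, Ck k (F i) setT) -> Ck k (fun x => \sum_(i <- s) F i x) setT.
Proof.
move=> Fk; elim: s => [|i s IH].
  rewrite (_ : (fun x => _) = (fun=> 0)); first exact: Ck_cst.
  by apply/funext => x; rewrite big_nil.
rewrite (_ : (fun x => _) = (fun x => F i x + \sum_(j <- s) F j x)).
  exact: Ck_add.
by apply/funext => x; rewrite big_cons.
Qed.

Definition smooth_class : fclass R [set: U].
Proof.
apply: (@FClass R U [set: U] (fun f => smooth_on (f : U -> R) setT)).
- by move=> f g E; rewrite (_ : g = f) //; apply/funext => x; rewrite E.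
- by move=> c k; apply: Ck_cst.
- by move=> f g fs gs k; apply: Ck_add.
- by move=> f g fs gs k; apply: Ck_mul.
- by move=> f fs f0 k; apply: Ck_inv => // x; apply: f0.
- by move=> f fs f0 k; apply: Ck_sqrt => // x; apply: f0.
Defined.

End CkTheory.

(** An inner map with constant derivative suffices for the curves used later, and the derivatives of
    the composite are again composites with [a], which closes the induction on k. *)
Lemma Ck_comp_affine (R : realType) (T U V : normedModType R) k
    (f : U -> V) (a : T -> U) (m : T -> U) :
  (forall t, differentiable a t) -> (forall t v, 'd a t v = m v) ->
  Ck k f setT -> Ck k (f \o a) setT.
Proof.
move=> ad am; elim: k f => [|k IH] f fc.
  by move=> x _; apply: continuous_comp; [apply: differentiable_continuous|apply: fc].
have [fd fk] := fc.
split=> [x _|v]; first by apply: differentiable_comp; [apply: ad|apply: fd].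
rewrite (_ : (fun x => _) = ((fun y => 'd f y (m v)) \o a)); first exact: (IH _ (fk _)).
apply/funext => x; transitivity ('d f (a x) ('d a x v)); last by rewrite am.
exact: (congr1 (fun h => h v) (diff_comp (ad x) (fd _ I))).
Qed.

Lemma coord_smooth (R : realType) d (j : 'I_d) :
  smooth_class 'rV[R]_d (fun v => v 0 j).
Proof.
case=> [|k]; first by move=> x _; apply: coord_continuous.
split=> [x _|v]; first exact: differentiable_coord.
rewrite (_ : (fun x => _) = (fun=> v 0 j)); first exact: Ck_cst.
apply/funext => x.
have @f : {linear 'rV[R]_d -> R}.
  by exists (fun N : 'rV[R]_d => N 0 j); do 2![eexists]; do ?[constructor];
     rewrite ?mxE// => ? *; rewrite ?mxE//; move=> ?; rewrite !mxE.
by rewrite (_ : (fun _ => _) = f) // diff_lin //; apply: coord_continuous.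
Qed.

(** Used for the inverse of a chart, for which continuity on an open set has to be shown. *)
Definition continuous_class (R : realType) (T : topologicalType) (A : set T) :
  open A -> fclass R A.
Proof.
move=> Ao.
apply: (@FClass R T A (fun f => forall x, A x -> {for x, continuous (f : T -> R)})).
- move=> f g E fc x Ax; rewrite /prop_for /continuous_at -(E x Ax).
  apply: cvg_trans (fc x Ax); apply: near_eq_cvg.
  by apply: filterS (open_nbhs_nbhs (conj Ao Ax)) => y /E ->.
- by move=> c x _; apply: cst_continuous.
- by move=> f g fc gc x Ax; apply: continuousD; [apply: fc|apply: gc].
- by move=> f g fc gc x Ax; apply: continuousM; [apply: fc|apply: gc].
- by move=> f fc f0 x Ax; apply: continuousV; [apply: f0|apply: fc].
- move=> f fc f0 x Ax; apply: (@continuous_comp _ _ _ f (@Num.sqrt R)); first exact: fc.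
  exact: sqrt_continuous.
Defined.

Section Differentials.
Variables (R : realType) (U : normedModType R).
Local Notation C := R[i].
Local Notation K := (smooth_class U).

Definition dr (f : U -> R) (x v : U) : R := 'd f x v.

Lemma smooth_diff f x : K f -> differentiable (f : U -> R) x.
Proof. by move=> /(_ 1%N) [fd _]; apply: fd. Qed.

Lemma dr_cst c x v : dr (fun=> c) x v = 0.
Proof. exact: (congr1 (fun h => h v) (diff_cst c x)). Qed.

Lemma dr_add f g x v : K f -> K g -> dr (fun y => f y + g y) x v = dr f x v + dr g x v.
Proof.
move=> /(smooth_diff x) fd /(smooth_diff x) gd.
exact: (congr1 (fun h => h v) (diffD fd gd)).
Qed.

Lemma dr_mul f g x v : K f -> K g ->
  dr (fun y => f y * g y) x v = f x * dr g x v + g x * dr f x v.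
Proof.
move=> /(smooth_diff x) fd /(smooth_diff x) gd.
exact: (congr1 (fun h => h v) (diffM fd gd)).
Qed.

Definition dc (f : U -> C) (x v : U) : C :=
  Complex (dr (fun y => complex.Re (f y)) x v) (dr (fun y => complex.Im (f y)) x v).

Lemma dc_cst c x v : dc (fun=> c) x v = 0.
Proof. by rewrite /dc !dr_cst. Qed.

Lemma dc_add f g x v : ccl K f -> ccl K g -> dc (fun y => f y + g y) x v = dc f x v + dc g x v.
Proof.
move=> [fr fi] [gr gi]; rewrite /dc.
have -> : (fun y => complex.Re (f y + g y)) = (fun y => complex.Re (f y) + complex.Re (g y)).
  by apply/funext => y; case: (f y) (g y) => [a b] [c d].
have -> : (fun y => complex.Im (f y + g y)) = (fun y => complex.Im (f y) + complex.Im (g y)).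
  by apply/funext => y; case: (f y) (g y) => [a b] [c d].
by rewrite !dr_add.
Qed.

Lemma dc_mul f g x v : ccl K f -> ccl K g ->
  dc (fun y => f y * g y) x v = dc f x v * g x + f x * dc g x v.
Proof.
move=> [fr fi] [gr gi]; rewrite /dc.
have -> : (fun y => complex.Re (f y * g y)) =
    (fun y => complex.Re (f y) * complex.Re (g y) + -1 * (complex.Im (f y) * complex.Im (g y))).
  by apply/funext => y; case: (f y) (g y) => [a b] [c d] /=; rewrite mulN1r.
have -> : (fun y => complex.Im (f y * g y)) =
    (fun y => complex.Re (f y) * complex.Im (g y) + complex.Im (f y) * complex.Re (g y)).
  by apply/funext => y; case: (f y) (g y) => [a b] [c d] /=.
have cK := cl_cst K (-1); have rr := cl_mul fr gr; have ii := cl_mul fi gi.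
have ri := cl_mul fr gi; have ir := cl_mul fi gr.
rewrite (dr_add x v rr (cl_mul cK ii)) (dr_mul x v cK ii) dr_cst (dr_mul x v fr gr) (dr_mul x v fi gi).
rewrite (dr_add x v ri ir) (dr_mul x v fr gi) (dr_mul x v fi gr).
move: (dr _ x v) (dr _ x v) (dr _ x v) (dr _ x v) => p q r s.
case: (f x) (g x) => [a b] [c d] /=; apply/eqP; rewrite eq_complex /=.
by apply/andP; split; apply/eqP; ring.
Qed.

Lemma dc_conj f x v : ccl K f -> dc (fun y => (f y)^*) x v = (dc f x v)^*.
Proof.
move=> [fr fi]; rewrite /dc.
have -> : (fun y => complex.Re (f y)^*) = (fun y => complex.Re (f y)).
  by apply/funext => y; case: (f y).
have -> : (fun y => complex.Im (f y)^*) = (fun y => -1 * complex.Im (f y)).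
  by apply/funext => y; case: (f y) => a b; rewrite mulN1r.
rewrite (dr_mul x v (cl_cst K (-1)) fi) dr_cst mulr0 addr0 mulN1r.
by [].
Qed.

Lemma dc_sum (I : Type) (s : seq I) (F : I -> U -> C) x v : (forall i, ccl K (F i)) ->
  dc (fun y => \sum_(i <- s) F i y) x v = \sum_(i <- s) dc (F i) x v.
Proof.
move=> Fc; elim: s => [|i s IH].
  rewrite big_nil (_ : (fun y => _) = (fun=> 0)) ?dc_cst //.
  by apply/funext => y; rewrite big_nil.
rewrite big_cons -IH -dc_add //; last by apply: ccl_sum.
by congr dc; apply/funext => y; rewrite big_cons.
Qed.

Section Mx.
Variable n : nat.
Implicit Types F G : U -> 'M[C]_n.
Local Notation mcl := (mcl K).

Definition dm F x v : 'M[C]_n := \matrix_(i, j) dc (fun y => F y i j) x v.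

Lemma dm_cst M x v : dm (fun=> M) x v = 0.
Proof. by apply/matrixP => i j; rewrite !mxE dc_cst. Qed.

Lemma dm_add F G x v : mcl F -> mcl G -> dm (fun y => F y + G y) x v = dm F x v + dm G x v.
Proof.
move=> Fc Gc; apply/matrixP => i j; rewrite !mxE -dc_add; [|exact: Fc|exact: Gc].
by congr dc; apply/funext => y; rewrite mxE.
Qed.

Lemma dm_mul F G x v : mcl F -> mcl G ->
  dm (fun y => F y *m G y) x v = dm F x v *m G x + F x *m dm G x v.
Proof.
move=> Fc Gc; apply/matrixP => i j; rewrite !mxE.
transitivity (dc (fun y => \sum_k F y i k * G y k j) x v).
  by congr dc; apply/funext => y; rewrite mxE.
rewrite dc_sum => [|k]; last by apply: ccl_mul; [apply: Fc|apply: Gc].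
rewrite -big_split /=; apply: eq_bigr => k _.
by rewrite !mxE dc_mul; [|apply: Fc|apply: Gc].
Qed.

Lemma dm_adj F x v : mcl F -> dm (fun y => adjm (F y)) x v = adjm (dm F x v).
Proof.
move=> Fc; apply/matrixP => i j; rewrite adjmE !mxE -dc_conj; last exact: Fc.
by congr dc; apply/funext => y; rewrite adjmE.
Qed.

Definition cpart (p : 'I_n * 'I_n * bool) (M : 'M[C]_n) : R :=
  let z := M p.1.1 p.1.2 in if p.2 then complex.Re z else complex.Im z.

Definition rbasis (p : 'I_n * 'I_n * bool) : 'M[R]_n * 'M[R]_n :=
  let d := delta_mx p.1.1 p.1.2 in if p.2 then (d, 0) else (0, d).

(** This expansion transfers smoothness and differentials from real coordinates to maps with values
    in pairs of real matrices. *)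
Lemma realify_sum M : realify M = \sum_p cpart p M *: rbasis p.
Proof.
have fstE i j (F : 'I_n * 'I_n * bool -> 'M[R]_n * 'M[R]_n) :
    (\sum_p F p).1 i j = \sum_p (F p).1 i j.
  by apply: (big_morph (fun y : 'M[R]_n * 'M[R]_n => y.1 i j)) => [x y|]; rewrite mxE.
have sndE i j (F : 'I_n * 'I_n * bool -> 'M[R]_n * 'M[R]_n) :
    (\sum_p F p).2 i j = \sum_p (F p).2 i j.
  by apply: (big_morph (fun y : 'M[R]_n * 'M[R]_n => y.2 i j)) => [x y|]; rewrite mxE.
rewrite [RHS]surjective_pairing; congr pair; apply/matrixP => i j.
  rewrite fstE (bigD1 (i, j, true)) //= big1 => [|[[a b] [|]] /= ne].
  - by rewrite !mxE !eqxx mulr1 addr0.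
  - rewrite !mxE (_ : (i == a) && (j == b) = false) ?mulr0 //.
    by apply: contraNF ne => /andP [/eqP -> /eqP ->].
  - by rewrite !mxE mulr0.
rewrite sndE (bigD1 (i, j, false)) //= big1 => [|[[a b] [|]] /= ne].
- by rewrite !mxE !eqxx mulr1 addr0.
- by rewrite !mxE mulr0.
- rewrite !mxE (_ : (i == a) && (j == b) = false) ?mulr0 //.
  by apply: contraNF ne => /andP [/eqP -> /eqP ->].
Qed.

Lemma cpart_smooth p F : mcl F -> K (fun x => cpart p (F x)).
Proof.
by move=> Fc; have [Fr Fi] := Fc p.1.1 p.1.2; rewrite /cpart; case: p.2.
Qed.

Lemma diff_comb (V : normedModType R) (I : Type) (s : seq I) (f : I -> U -> R) (e : I -> V) x :
  (forall i, K (f i)) ->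
  is_diff x (fun y => \sum_(i <- s) f i y *: e i)
    (fun v => \sum_(i <- s) dr (f i) x v *: e i).
Proof.
move=> fc; elim: s => [|i s IH].
  have -> : (fun y => \sum_(i <- [::]) f i y *: e i) = cst 0.
    by apply/funext => y; rewrite big_nil.
  have -> : (fun v => \sum_(i <- [::]) dr (f i) x v *: e i) = 0.
    by apply/funext => y; rewrite big_nil.
  exact: is_diff_cst.
have -> : (fun y => \sum_(j <- i :: s) f j y *: e j) =
    (fun y => f i y *: e i) + (fun y => \sum_(j <- s) f j y *: e j).
  by apply/funext => y; rewrite big_cons.
have -> : (fun v => \sum_(j <- i :: s) dr (f j) x v *: e j) =
    (fun v => dr (f i) x v *: e i) + (fun v => \sum_(j <- s) dr (f j) x v *: e j).
  by apply/funext => y; rewrite big_cons.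
apply: is_diffD; have fd := smooth_diff x (fc i).
by apply: DiffDef; [apply: differentiableZl|apply: (diffZl _ fd)].
Qed.

Lemma realify_smooth F : mcl F -> smooth_on (fun x => realify (F x)) setT.
Proof.
move=> Fc k; rewrite (_ : (fun x => _) = (fun x => \sum_p cpart p (F x) *: rbasis p)).
  by apply: Ck_sum => p; apply: Ck_scalel; apply: cpart_smooth.
by apply/funext => x; rewrite realify_sum.
Qed.

Lemma realify_diff F x v : mcl F -> 'd (fun y => realify (F y)) x v = realify (dm F x v).
Proof.
move=> Fc; rewrite [RHS]realify_sum.
have -> : (fun y => realify (F y)) = (fun y => \sum_p cpart p (F y) *: rbasis p).
  by apply/funext => y; rewrite realify_sum.
have [_ H] := diff_comb (index_enum _) rbasis x (fun p => cpart_smooth p Fc).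
rewrite H.
apply: eq_bigr => p _; congr (_ *: _).
by rewrite /cpart mxE; case: p.2.
Qed.

End Mx.
End Differentials.

Section Realify.
Variables (R : realType) (n : nat).
Local Notation C := R[i].

Lemma realifyK : cancel (@realify R n) (@unrealify R n).
Proof.
by move=> X; apply/matrixP => i j; rewrite !mxE; case: (X i j).
Qed.

Lemma unrealify_continuous (A : set ('M[R]_n * 'M[R]_n)) (Ao : open A) :
  mcl (continuous_class R Ao) (@unrealify R n).
Proof.
move=> i j; split=> -[x1 x2] Ax; rewrite /prop_for /continuous_at.
- have -> : (fun x => complex.Re (unrealify x i j)) =
      (fun Y : 'M[R]_n => Y i j) \o (@fst _ 'M[R]_n).
    by apply/funext => y; rewrite /= mxE.
  have -> : complex.Re (unrealify (x1, x2) i j) = x1 i j by rewrite mxE.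
  by apply: cvg_comp; [exact: cvg_fst|exact: coord_continuous].
- have -> : (fun x => complex.Im (unrealify x i j)) =
      (fun Y : 'M[R]_n => Y i j) \o (@snd 'M[R]_n _).
    by apply/funext => y; rewrite /= mxE.
  have -> : complex.Im (unrealify (x1, x2) i j) = x2 i j by rewrite mxE.
  by apply: cvg_comp; [exact: cvg_snd|exact: coord_continuous].
Qed.

End Realify.

(** * Linear coordinates on real subspaces of complex matrices *)

Section RealBasis.
Variables (R : realType).
Local Notation C := R[i].

(** The subspace is known only as a predicate. A free family in E of maximal length spans E, as any
    further vector could be appended to it. *)
Lemma subspace_basis D (E : set 'rV[R]_D) :
  E 0 -> (forall a x y, E x -> E y -> E (a *: x + y)) ->
  exists d (B : 'M[R]_(d, D)), row_free B /\ forall v, E v <-> (v <= B)%MS.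
Proof.
move=> E0 EL.
pose P k := `[< exists B : 'M[R]_(k, D), row_free B /\ forall i, E (row i B) >].
have P0 : P 0%N.
  by apply/asboolP; exists 0; split; [rewrite /row_free mxrank0|case].
have PD k : P k -> (k <= D)%N.
  by move=> /asboolP [B [Bf _]]; rewrite -(eqP Bf); apply: rank_leq_col.
have [d /asboolP [B [Bf BE]] dmax] := ex_maxnP (ex_intro P 0%N P0) PD.
exists d, B; split=> // v; split; last first.
  move=> /submxP [y ->]; rewrite mulmx_sum_row.
  elim/big_ind : _ => //; first by move=> x z Ex Ez; rewrite -[x]scale1r; apply: EL.
  by move=> i _; rewrite -[_ *: _]addr0; apply: EL.
move=> Ev; apply: contraT => vB.
suff : P (d + 1)%N by move=> /dmax; rewrite addn1 ltnn.
apply/asboolP; exists (col_mx B v); split; last first.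
  move=> i; case: (splitP i) => j ij.
    have -> : i = lshift 1 j by apply/val_inj.
    by rewrite rowKu.
  have -> : i = rshift d j by apply/val_inj.
  by rewrite rowKd; have -> : row j v = v by apply/rowP => l; rewrite mxE ord1.
rewrite /row_free eqn_leq rank_leq_row /= -addsmxE.
suff : (\rank B < \rank (B + v)%MS)%N by rewrite (eqP Bf) addn1.
rewrite ltn_neqAle mxrankS ?addsmxSl // andbT.
rewrite (mxrank_leqif_sup (addsmxSl B v)); apply: contra vB => H.
exact: submx_trans (addsmxSr B v) H.
Qed.

Variable n : nat.

Definition lincomb d (e : 'I_d -> 'M[C]_n) (v : 'rV[R]_d) : 'M[C]_n :=
  \sum_k (v 0 k)%:C%C *: e k.

(** The coordinate map is defined on all matrices and real linear, so composing it with a function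
    of a class stays in the class, even where the function leaves E. *)
Lemma real_basis (E : set 'M[C]_n) : E 0 ->
  (forall (a : R) x y, E x -> E y -> E (a%:C%C *: x + y)) ->
  exists d (e : 'I_d -> 'M[C]_n) (phi : 'M[C]_n -> 'rV[R]_d),
    [/\ forall v, E (lincomb e v), forall v, phi (lincomb e v) = v,
        forall Z, E Z -> lincomb e (phi Z) = Z &
        forall (T : Type) (A : set T) (K : fclass R A) (F : T -> 'M[C]_n),
          mcl K F -> forall k, K (fun x => phi (F x) 0 k)].
Proof.
move=> E0 EL; pose I := ('I_n * 'I_n * bool)%type.
pose vec (M : 'M[C]_n) : 'rV[R]_#|{: I}| := \row_k cpart (enum_val k) M.
pose unvec (r : 'rV[R]_#|{: I}|) : 'M[C]_n :=
  \matrix_(i, j) Complex (r 0 (enum_rank (i, j, true))) (r 0 (enum_rank (i, j, false))).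
have vecK : cancel vec unvec.
  move=> M; apply/matrixP => i j; rewrite !mxE !enum_rankK /cpart /=.
  by case: (M i j).
have unvecK : cancel unvec vec.
  move=> r; apply/rowP => k; rewrite mxE /cpart !mxE /=.
  by case E1: (enum_val k) => [[i j] [|]] /=; rewrite -E1 enum_valK.
have vecL (a : R) x y : unvec (a *: x + y) = a%:C%C *: unvec x + unvec y.
  apply/matrixP => i j; rewrite !mxE; apply/eqP; rewrite eq_complex /=.
  by rewrite !mul0r subr0 addr0 !eqxx.
have unvec0 : unvec 0 = 0 by apply/matrixP => i j; rewrite !mxE.
have [d [B [Bf BE]]] : exists d (B : 'M[R]_(d, _)),
    row_free B /\ forall v, E (unvec v) <-> (v <= B)%MS.
  apply: (@subspace_basis _ (fun v => E (unvec v))); first by rewrite unvec0.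
  by move=> a x y Ex Ey; rewrite vecL; apply: EL.
pose e k := unvec (row k B).
have lcE v : lincomb e v = unvec (v *m B).
  rewrite mulmx_sum_row /lincomb; elim/big_rec2 : _ => [|k y1 y2 _ ->]; first by rewrite unvec0.
  by rewrite vecL.
(* The pseudo-inverse extends the coordinates on E to the whole space. *)
exists d, e, (fun M => vec M *m pinvmx B); split.
- by move=> v; rewrite lcE; apply/BE/submxMl.
- by move=> v; rewrite lcE unvecK mulmxKp.
- by move=> Z EZ; rewrite lcE mulmxKpV ?vecK //; apply/BE; rewrite vecK.
move=> T A K F Fc k.
apply: (@cl_ext _ _ _ K (fun x => \sum_(j <- index_enum _)
   cpart (enum_val j) (F x) * pinvmx B j k)).
  by move=> x _; rewrite [RHS]mxE; apply: eq_bigr => j _; congr (_ * _); rewrite mxE.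
elim: (index_enum _) => [|j s IH].
  by apply: cl_ext (cl_cst K 0) => x _; rewrite big_nil.
apply: cl_ext (cl_add (cl_mul (_ : K (fun x => cpart (enum_val j) (F x))) (cl_cst K (pinvmx B j k))) IH).
  by move=> x _; rewrite big_cons.
have [Fr Fi] := Fc (enum_val j).1.1 (enum_val j).1.2.
by rewrite /cpart; case: (enum_val j).2.
Qed.

Lemma lincombD d (e : 'I_d -> 'M[C]_n) v w :
  lincomb e (v + w) = lincomb e v + lincomb e w.
Proof.
rewrite /lincomb -big_split /=; apply: eq_bigr => k _.
by rewrite mxE rmorphD scalerDl.
Qed.

Lemma lincombZ d (e : 'I_d -> 'M[C]_n) (a : R) v :
  lincomb e (a *: v) = a%:C%C *: lincomb e v.
Proof.
rewrite /lincomb scaler_sumr; apply: eq_bigr => k _.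
by rewrite mxE rmorphM scalerA.
Qed.

Lemma lincomb_smooth d (e : 'I_d -> 'M[C]_n) : mcl (smooth_class 'rV[R]_d) (lincomb e).
Proof.
move=> i j.
apply: (@ccl_ext _ _ _ _ (fun v : 'rV[R]_d => \sum_k (v 0 k)%:C%C * e k i j)).
  by move=> x _; rewrite /lincomb summxE; apply: eq_bigr => k _; rewrite mxE.
apply: ccl_sum => k; apply: ccl_mul; last exact: ccl_cst.
by apply: ccl_real; apply: coord_smooth.
Qed.

Lemma dr_coord d (k : 'I_d) (x v : 'rV[R]_d) : dr (fun y : 'rV[R]_d => y 0 k) x v = v 0 k.
Proof.
have @f : {linear 'rV[R]_d -> R}.
  by exists (fun N : 'rV[R]_d => N 0 k); do 2![eexists]; do ?[constructor];
     rewrite ?mxE// => ? *; rewrite ?mxE//; move=> ?; rewrite !mxE.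
have fc : continuous f by apply: coord_continuous.
exact: (congr1 (fun h => h v) (diff_lin x fc)).
Qed.

Lemma dm_lincomb d (e : 'I_d -> 'M[C]_n) x v : dm (lincomb e) x v = lincomb e v.
Proof.
apply/matrixP => i j; rewrite mxE.
transitivity (dc (fun y : 'rV[R]_d => \sum_k (y 0 k)%:C%C * e k i j) x v).
  congr dc; apply/funext => y; rewrite /lincomb summxE.
  by apply: eq_bigr => k _; rewrite mxE.
have cc k : ccl (smooth_class 'rV[R]_d) (fun y : 'rV[R]_d => (y 0 k)%:C%C).
  by apply: ccl_real; apply: coord_smooth.
rewrite dc_sum => [|k]; last by apply: ccl_mul; [apply: cc|apply: ccl_cst].
rewrite /lincomb summxE; apply: eq_bigr => k _; rewrite mxE.
rewrite dc_mul; [|exact: cc|exact: ccl_cst].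
rewrite dc_cst mulr0 addr0; congr (_ * _).
by rewrite /dc /= dr_coord dr_cst.
Qed.

End RealBasis.

(** * Block decompositions and real forms *)

Section Blocks.
Variables (F : fieldType) (n : nat) (be : 'I_n -> nat).
Hypothesis be_mono : forall i j : 'I_n, (i <= j)%N -> (be i <= be j)%N.
Implicit Types x y l m u b : 'M[F]_n.

(* [bup_rel] and [blow_rel] are the supports of the unipotent radicals of two
   opposite parabolic subgroups, [blk_rel] that of their common Levi factor, and
   [mid_rel] that of the lower triangular matrices of the Levi factor. *)
Definition bup_rel : rel 'I_n := fun i j => (i == j) || (be i < be j)%N.
Definition blow_rel : rel 'I_n := fun i j => (i == j) || (be j < be i)%N.
Definition ble_rel : rel 'I_n := fun i j => (be i <= be j)%N.
Definition bge_rel : rel 'I_n := fun i j => (be j <= be i)%N.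
Definition blk_rel : rel 'I_n := fun i j => be i == be j.
Definition mid_rel : rel 'I_n := fun i j => (i == j) || ((be i == be j) && (j < i)%N).

Lemma be_lt (i j : 'I_n) : (be i < be j)%N -> (i < j)%N.
Proof. by move=> H; rewrite ltnNge; apply: contraL H => /be_mono; rewrite -leqNgt. Qed.

Lemma bup_refl : reflexive bup_rel. Proof. by move=> i; rewrite /bup_rel eqxx. Qed.
Lemma blow_refl : reflexive blow_rel. Proof. by move=> i; rewrite /blow_rel eqxx. Qed.
Lemma blk_refl : reflexive blk_rel. Proof. by move=> i; apply: eqxx. Qed.
Lemma mid_refl : reflexive mid_rel. Proof. by move=> i; rewrite /mid_rel eqxx. Qed.

Lemma bup_trans : transitive bup_rel.
Proof.
move=> j i k /orP [/eqP ->//|ij] /orP [/eqP <-|jk]; rewrite /bup_rel ?ij ?orbT //.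
by rewrite (ltn_trans ij jk) orbT.
Qed.
Lemma blow_trans : transitive blow_rel.
Proof.
move=> j i k /orP [/eqP ->//|ij] /orP [/eqP <-|jk]; rewrite /blow_rel ?ij ?orbT //.
by rewrite (ltn_trans jk ij) orbT.
Qed.
Lemma blk_trans : transitive blk_rel.
Proof. by move=> j i k /eqP ij /eqP jk; rewrite /blk_rel ij jk. Qed.
Lemma bge_trans : transitive bge_rel.
Proof. by move=> j i k ij jk; apply: leq_trans jk ij. Qed.
Lemma ble_trans : transitive ble_rel.
Proof. by move=> j i k ij jk; apply: leq_trans ij jk. Qed.

Lemma bup_up x : supp bup_rel x -> supp up_rel x.
Proof.
by apply: supp_sub => i j /orP [/eqP ->|/be_lt /ltnW //]; apply: leqnn.
Qed.
Lemma blow_low x : supp blow_rel x -> supp low_rel x.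
Proof.
by apply: supp_sub => i j /orP [/eqP ->|/be_lt /ltnW //]; apply: leqnn.
Qed.
Lemma mid_low x : supp mid_rel x -> supp low_rel x.
Proof.
by apply: supp_sub => i j /orP [/eqP ->|/andP [_ /ltnW //]]; apply: leqnn.
Qed.
Lemma mid_blk x : supp mid_rel x -> supp blk_rel x.
Proof.
by apply: supp_sub => i j /orP [/eqP ->|/andP [H _]]; [apply: eqxx|apply: H].
Qed.
Lemma low_bge x : supp low_rel x -> supp bge_rel x.
Proof. by apply: supp_sub => i j; apply: be_mono. Qed.
Lemma up_ble x : supp up_rel x -> supp ble_rel x.
Proof. by apply: supp_sub => i j; apply: be_mono. Qed.
Lemma blk_bge x : supp blk_rel x -> supp bge_rel x.
Proof. by apply: supp_sub => i j /eqP ij; rewrite /bge_rel ij. Qed.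
Lemma blk_ble x : supp blk_rel x -> supp ble_rel x.
Proof. by apply: supp_sub => i j /eqP ij; rewrite /ble_rel ij. Qed.
Definition bd x : 'M[F]_n := \matrix_(i, j) if be i == be j then x i j else 0.

Lemma bd_blk x : supp blk_rel (bd x).
Proof. by move=> i j /negPf nij; rewrite mxE -[be i == be j]/(blk_rel i j) nij. Qed.

Lemma bd_id x : supp blk_rel x -> bd x = x.
Proof.
move=> xb; apply/matrixP => i j; rewrite mxE; case: ifP => // /negbT H.
by rewrite xb.
Qed.

Lemma bd_diag x i : bd x i i = x i i.
Proof. by rewrite mxE eqxx. Qed.

Lemma bd_supp (r : rel 'I_n) x : supp r x -> supp r (bd x).
Proof. by move=> xr i j nij; rewrite mxE xr // if_same. Qed.

(** The projection of a parabolic subalgebra onto its Levi factor is multiplicative. *)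
Lemma bd_mul_ge x y : supp bge_rel x -> supp bge_rel y -> bd (x *m y) = bd x *m bd y.
Proof.
move=> xg yg; apply/matrixP => i j; rewrite !mxE.
case: eqVneq => ij; last first.
  rewrite big1 // => k _; rewrite !mxE; case: eqVneq => [ik|_]; last by rewrite mul0r.
  by case: eqVneq => [kj|_]; [rewrite ik kj eqxx in ij|rewrite mulr0].
apply: eq_bigr => k _; rewrite !mxE; case: (ltngtP (be i) (be k)) => ik.
- by rewrite xg ?mul0r // /bge_rel -ltnNge.
- rewrite [y k j]yg ?mulr0 ?mul0r // /bge_rel -ltnNge -ij //.
- by rewrite -ik ij eqxx.
Qed.

Lemma bd_tr x : (bd x)^T = bd x^T.
Proof. by apply/matrixP => i j; rewrite !mxE eq_sym. Qed.

Lemma bd_mul_le x y : supp ble_rel x -> supp ble_rel y -> bd (x *m y) = bd x *m bd y.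
Proof.
move=> xg yg; apply: trmx_inj; rewrite trmx_mul !bd_tr trmx_mul bd_mul_ge //.
- by move=> i j nij; rewrite mxE yg.
- by move=> i j nij; rewrite mxE xg.
Qed.

Lemma bd_unip x : supp blow_rel x \/ supp bup_rel x -> unidiag x -> bd x = 1%:M.
Proof.
move=> xs x1; apply: supp_diag_1; last by move=> i; rewrite bd_diag.
move=> i j nij; rewrite mxE; case: eqVneq => // ij.
by case: xs => ->; rewrite // /blow_rel /bup_rel (negPf nij) ij ltnn.
Qed.

Lemma blow_of_bd x : supp bge_rel x -> bd x = 1%:M -> supp blow_rel x /\ unidiag x.
Proof.
move=> xg x1; split=> [i j|i]; last by rewrite -bd_diag x1 mxE eqxx.
rewrite negb_or -leqNgt => /andP [ij]; rewrite leq_eqVlt => /orP [/eqP E|lt].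
  by have := congr1 (fun y : 'M[F]_n => y i j) x1; rewrite /= !mxE E eqxx (negPf ij).
by apply: xg; rewrite /bge_rel -ltnNge.
Qed.

Lemma bup_of_bd x : supp ble_rel x -> bd x = 1%:M -> supp bup_rel x /\ unidiag x.
Proof.
move=> xg x1; split=> [i j|i]; last by rewrite -bd_diag x1 mxE eqxx.
rewrite negb_or -leqNgt => /andP [ij]; rewrite leq_eqVlt => /orP [/eqP E|lt].
  by have := congr1 (fun y : 'M[F]_n => y i j) x1; rewrite /= !mxE E eqxx (negPf ij).
by apply: xg; rewrite /ble_rel -ltnNge.
Qed.

Lemma blk_inv x : supp blk_rel x -> supp blk_rel (invmx x).
Proof. by apply: supp_inv; [apply: blk_refl|apply: blk_trans]. Qed.

Lemma mid_of_low x : supp low_rel x -> supp blk_rel x -> supp mid_rel x.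
Proof.
move=> xl xb; apply: supp_sub (supp_and xl xb) => i j /= /andP [ji /eqP E].
rewrite /mid_rel E eqxx /= -val_eqE /=; move: ji; rewrite /low_rel leq_eqVlt eq_sym.
by [].
Qed.

(** By multiplicativity of [bd], dividing l by its block diagonal part leaves an element of the
    unipotent radical. *)
Lemma low_split l : supp low_rel l -> unidiag l ->
  [/\ supp mid_rel (bd l), unidiag (bd l), supp blow_rel (l *m invmx (bd l)) &
      unidiag (l *m invmx (bd l))].
Proof.
move=> ll l1; have bl := bd_supp ll; have b1 : unidiag (bd l) by move=> i; rewrite bd_diag.
have bu := unip_low_unit bl b1.
have [s1 s2] : supp blow_rel (l *m invmx (bd l)) /\ unidiag (l *m invmx (bd l)).
  have gl := low_bge ll; have gi := blk_bge (blk_inv (bd_blk l)).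
  apply: blow_of_bd; first exact: supp_mul bge_trans gl gi.
  by rewrite bd_mul_ge // (bd_id (blk_inv (bd_blk l))) mulmxV.
by split=> //; apply: mid_of_low => //; apply: bd_blk.
Qed.

Lemma bd_low_mul l m : supp blow_rel l -> unidiag l -> supp blk_rel m -> bd (l *m m) = m.
Proof.
move=> ll l1 mb; rewrite bd_mul_ge; last exact: blk_bge.
  by rewrite (bd_unip (or_introl ll) l1) mul1mx bd_id.
by apply: low_bge; apply: blow_low.
Qed.

Lemma up_split b : supp up_rel b -> b \in unitmx ->
  [/\ supp up_rel (bd b), bd b \in unitmx, supp bup_rel (invmx (bd b) *m b) &
      unidiag (invmx (bd b) *m b)].
Proof.
move=> bu bU; have bbu := bd_supp bu.
have bdU : bd b \in unitmx.
  apply: up_unit => // i; rewrite bd_diag.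
  by move: bU; rewrite unitmxE unitfE det_up // => /prodf_neq0 /(_ i isT).
have [s1 s2] : supp bup_rel (invmx (bd b) *m b) /\ unidiag (invmx (bd b) *m b).
  have gl := up_ble bu; have gi := blk_ble (blk_inv (bd_blk b)).
  apply: bup_of_bd; first exact: supp_mul ble_trans gi gl.
  by rewrite bd_mul_le // (bd_id (blk_inv (bd_blk b))) mulVmx.
by split.
Qed.

End Blocks.

(** * The Cayley transform *)

Section Cayley.
Variables (R : realType) (n : nat).
Local Notation C := R[i].

(** An involution exchanging 0 and 1. It exchanges unipotent and strictly triangular matrices, and
    the group and the Lie algebra of a real form wherever it is defined. *)
Definition cay (x : 'M[C]_n) : 'M[C]_n := (1%:M - x) *m invmx (1%:M + x).

Lemma one_add_unit (x : 'M[C]_n) (a : C) : (forall i, x i i = a) -> 1 + a != 0 ->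
  supp up_rel x \/ supp low_rel x -> 1%:M + x \in unitmx.
Proof.
move=> xd a0 xs; have E i : (1%:M + x) i i = 1 + a by rewrite !mxE eqxx xd.
have s1 := supp_scalar 1 (@up_refl n); have s2 := supp_scalar 1 (@low_refl n).
case: xs => xs; first by apply: up_unit => [|i]; [apply: supp_add|rewrite E].
rewrite unitmxE det_low; last by apply: supp_add.
by rewrite unitfE; apply/prodf_neq0 => i _; rewrite E.
Qed.

Lemma cayK (x : 'M[C]_n) : 1%:M + x \in unitmx ->
  1%:M + cay x = 2%:R *: invmx (1%:M + x) /\ cay (cay x) = x.
Proof.
move=> xu; have E : 1%:M + cay x = 2%:R *: invmx (1%:M + x).
  apply: (can_inj (mulmxK xu)); rewrite /= mulmxDl /cay mulmxKV // mul1mx.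
  by rewrite -scalemxAl mulVmx // scaler_nat mulr2n addrACA subrr addr0.
have F : 1%:M - cay x = 2%:R *: (x *m invmx (1%:M + x)).
  apply: (can_inj (mulmxK xu)); rewrite /= mulmxBl /cay mulmxKV // mul1mx.
  by rewrite -scalemxAl mulmxKV // scaler_nat mulr2n opprB [1%:M + x]addrC addrACA subrr addr0.
have c2 : (2%:R : C) != 0 by rewrite pnatr_eq0.
split=> //; rewrite /cay -/(cay x) F E invmxZ; last first.
  by rewrite unitmxZ ?unitfE // unitmx_inv.
rewrite invmxK -scalemxAl -scalemxAr scalerA divff // scale1r mulmxKV //.
Qed.

End Cayley.

(** * Iwasawa and triangular factorisations inside a real form *)

Section RealFormDef.
Variables (R : realType) (n : nat).
Local Notation C := R[i].

Definition rediag (L : 'M[C]_n) : 'M[C]_n :=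
  \matrix_(i, j) if i == j then (complex.Re (L i i))%:C%C else 0.

(* What the construction of the charts uses of a real form [Gs] with Lie algebra [gs];
   [blk i] is the number of the block containing the index [i].  The blocks have size 1
   for real matrices, size 2 for quaternionic ones, and for SU(p, q) size 1 except for a
   central block of size p - q. *)
Record realform (L : 'M[C]_n) := RealForm {
  blk : 'I_n -> nat;
  Gs : set 'M[C]_n;
  gs : set 'M[C]_n;
  blk_mono : forall i j : 'I_n, (i <= j)%N -> (blk i <= blk j)%N;
  gs0 : gs 0;
  gs_lin : forall (a : R) x y, gs x -> gs y -> gs (a%:C%C *: x + y);
  gs_br : forall x y, gs x -> gs y -> gs (x *m y - y *m x);
  Gs_unit : forall x, Gs x -> x \in unitmx;
  Gs_mul : forall x y, Gs x -> Gs y -> Gs (x *m y);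
  Gs_inv : forall x, Gs x -> Gs (invmx x);
  Gs_adj : forall x, Gs x -> Gs (adjm x);
  Gs_cay : forall y, gs y -> 1%:M + y \in unitmx -> 1%:M - y \in unitmx -> Gs (cay y);
  gs_cay : forall x, Gs x -> 1%:M + x \in unitmx -> gs (cay x);
  gs_Ad : forall x y, Gs x -> gs y -> gs (x *m y *m invmx x);
  Gs_LDU : forall l m u, supp (blow_rel blk) l -> unidiag l ->
    supp (blk_rel blk) m -> m \in unitmx -> supp (bup_rel blk) u -> unidiag u ->
    Gs (l *m m *m u) -> [/\ Gs l, Gs m & Gs u];
  Gs_pos_diag : forall m, m \in unitmx -> supp (blk_rel blk) m -> Gs (adjm m *m m) ->
    supp diag_rel (adjm m *m m);
  Gs_sqrt : forall d, supp diag_rel d -> (forall i, 0 < d i i) -> Gs (d *m d) -> Gs d;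
  Gs_mid : forall l s b, supp (mid_rel blk) l -> unidiag l -> unitary s -> posup b ->
    l = s *m b -> Gs s;
  Gs_cover : forall g, Gs g -> exists w, [/\ sperm w, Gs w & lead_ok (adjm w *m g)];
  gs_re : gs (rediag L);
  gs_im : gs (L - rediag L) }.

End RealFormDef.

Section RealForm.
Variables (R : realType) (n : nat) (L : 'M[R[i]]_n).
Hypotheses (Ld : is_diag L).
Variable rf : realform L.
Local Notation C := R[i].
Local Notation G := (Gs rf).
Local Notation be := (blk rf).
Local Notation bmono := (@blk_mono _ _ _ rf).

Lemma posup_diag (d : 'M[C]_n) : supp diag_rel d -> (forall i, 0 < d i i) -> posup d.
Proof. by move=> dd dp; split=> //; apply: supp_diag_up. Qed.

Lemma diag_adj (d : 'M[C]_n) : supp diag_rel d -> supp diag_rel (adjm d).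
Proof. by move=> dd i j nij; rewrite adjmE dd ?rmorph0 // /diag_rel eq_sym. Qed.

Lemma diag_sqrt (D : 'M[C]_n) : supp diag_rel D -> (forall i, 0 < D i i) ->
  exists d, [/\ supp diag_rel d, forall i, 0 < d i i, adjm d = d & d *m d = D].
Proof.
move=> Dd Dp; pose d : 'M[C]_n := \matrix_(i, j) if i == j then sqrtC (D i i) else 0.
have dd : supp diag_rel d by move=> i j /negPf; rewrite /diag_rel mxE => ->.
have dE i : d i i = sqrtC (D i i) by rewrite mxE eqxx.
have dp i : 0 < d i i by rewrite dE sqrtC_gt0.
exists d; split=> //.
  apply: supp_diag_eq => //; first exact: diag_adj.
  by move=> i; rewrite adjmE geC0_conj // ltW.
apply: supp_diag_eq => //; first exact: (supp_mul (@diag_trans n) dd dd).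
by move=> i; rewrite supp_diag_mulE // dE -expr2 sqrtCK.
Qed.

Lemma sqnorm_gt0 (m : 'M[C]_n) i : m \in unitmx -> 0 < (adjm m *m m) i i.
Proof. by move=> mu; have := @row_sqnorm_gt0 R n (adjm m) i; rewrite adjmK adjm_unit; apply. Qed.

(** As m^* m is diagonal, it has a positive diagonal square root d. Then m d^{-1} is unitary with
    positive triangular part, so m = d, which is in the real form by [Gs_sqrt]. *)
Lemma Gs_posup_blk m : posup m -> supp (blk_rel be) m -> G (adjm m *m m) ->
  supp diag_rel m /\ G m.
Proof.
move=> mp mb mG; have mu := posup_unit mp.
have Dd := Gs_pos_diag mu mb mG.
have [d [dd dp da dE]] := diag_sqrt Dd (fun i => sqnorm_gt0 i mu).
have dP := posup_diag dd dp; have du := posup_unit dP.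
have E : m *m invmx d = 1%:M.
  apply: unitary_posup1; first by apply: posup_mul => //; apply: posup_inv.
  rewrite /unitary adjmM adjm_inv da mulmxA -(mulmxA _ (adjm m)) -dE mulmxA mulVmx // mul1mx mulmxV //.
have -> : m = d by rewrite -[m](mulmxKV du) E mul1mx.
by split=> //; apply: Gs_sqrt => //; rewrite dE.
Qed.

Lemma blk_adj (x : 'M[C]_n) : supp (blk_rel be) x -> supp (blk_rel be) (adjm x).
Proof. by move=> xb i j nij; rewrite adjmE xb ?rmorph0 // /blk_rel eq_sym. Qed.

Lemma bup_adj (x : 'M[C]_n) : supp (bup_rel be) x -> supp (blow_rel be) (adjm x).
Proof.
move=> xb i j nij; rewrite adjmE xb ?rmorph0 //.
by move: nij; rewrite /blow_rel /bup_rel eq_sym.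
Qed.

(** Writing b = m y with m block diagonal and y block unipotent, b^* b = y^* (m^* m) y is a block
    LDU factorisation, whose factors lie in the real form. *)
Lemma Gs_posup b : posup b -> G (adjm b *m b) -> G b.
Proof.
move=> [bu bp] bG; have bU := posup_unit (conj bu bp).
have [mu mU ns n1] := up_split bmono bu bU.
set m := bd be b in mu mU ns n1; set y := invmx m *m b in ns n1.
have bE : b = m *m y by rewrite /y mulKVmx.
have mb : supp (blk_rel be) m := @bd_blk _ _ be b.
have mP : posup m by split=> // i; rewrite bd_diag.
clearbody y m.
have [] := @Gs_LDU _ _ _ rf (adjm y) (adjm m *m m) y.
- exact: bup_adj.
- exact: unidiag_adj.
- by apply: (supp_mul (@blk_trans n be) _ mb); apply: blk_adj.
- by rewrite unitmx_mul adjm_unit mU.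
- exact: ns.
- exact: n1.
- by move: bG; rewrite {1 2}bE adjmM !mulmxA.
move=> _ mG yG; rewrite bE; apply: Gs_mul => //.
by have [] := Gs_posup_blk mP mb mG.
Qed.

(** Apply [Gs_posup] to b, since b^* b = g^* g: the Iwasawa decomposition restricts to the real
    form. *)
Lemma Gs_QR g k b : G g -> unitary k -> posup b -> g = k *m b -> G k /\ G b.
Proof.
move=> gG kU bP gE; have bG : G b.
  apply: Gs_posup => //.
  have -> : adjm b *m b = adjm g *m g.
    by rewrite gE adjmM mulmxA -(mulmxA (adjm b)) kU mulmx1.
  by apply: Gs_mul => //; apply: Gs_adj.
split=> //; have -> : k = g *m invmx b by rewrite gE mulmxK // posup_unit.
by apply: Gs_mul => //; apply: Gs_inv.
Qed.

(** The class of all functions on a point turns the factorisation with parameters into one of a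
    single matrix. *)
Lemma QR_exists (x : 'M[C]_n) : x \in unitmx ->
  exists k b, [/\ unitary k, posup b & x = k *m b].
Proof.
move=> xu; pose K := FClass (R := R) (T := unit) (A := setT) (cl := fun _ => True)
  (fun _ _ _ _ => I) (fun _ => I) (fun _ _ _ _ => I) (fun _ _ _ _ => I)
  (fun _ _ _ => I) (fun _ _ _ => I).
have [||b [_ /(_ tt I) [bP kU]]] := @QR_class R unit setT K n (fun=> x).
- by move=> i j; split.
- by [].
by exists (x *m invmx (b tt)), (b tt); split=> //; rewrite mulmxKV // posup_unit.
Qed.

Lemma LU_exists (x : 'M[C]_n) : lead_ok x ->
  exists l r, [/\ supp low_rel l, unidiag l, supp up_rel r, r \in unitmx & x = l *m r].
Proof.
move=> xu; pose K := FClass (R := R) (T := unit) (A := setT) (cl := fun _ => True)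
  (fun _ _ _ _ => I) (fun _ => I) (fun _ _ _ _ => I) (fun _ _ _ _ => I)
  (fun _ _ _ => I) (fun _ _ _ => I).
have [||l [r [_ _ /(_ tt I) H]]] := @LU_class R unit setT K n (fun=> x).
- by move=> i j; split.
- by [].
by exists (l tt), (r tt).
Qed.

(** The factor m need not be in the real form. But m = s c with s unitary and in it, and the
    triangular c is absorbed by b, so k is the unitary factor of u^{-1} w l s. *)
Lemma rep_Gs w X u l m k b : sperm w -> G w -> G u -> G l ->
  supp (mid_rel be) m -> unidiag m -> rep L w X u (l *m m) k b -> G (u *m k).
Proof.
move=> wP wG uG lG ms m1 [[uu u1 _ _] [kU bP E _]].
have mu := unip_low_unit (mid_low ms) m1.
have [s [c [sU cP mE]]] := QR_exists mu.
have sG := Gs_mid ms m1 sU cP mE.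
pose g := invmx u *m w *m l *m s.
have gG : G g by do 3 (apply: Gs_mul => //); apply: Gs_inv.
have [k1 [b1 [k1U b1P gE]]] := QR_exists (Gs_unit gG).
have [k1G _] := Gs_QR gG k1U b1P gE.
have uU := Gs_unit uG; have bU := posup_unit bP.
have H : k1 *m (b1 *m c) = k *m invmx b.
  have gc : g *m c = invmx u *m (w *m (l *m m)) by rewrite /g mE !mulmxA.
  move: gE gc; clearbody g => gE gc; rewrite [LHS]mulmxA -gE gc; apply: (can_inj (mulmxK bU)).
  by rewrite /= (mulmxKV bU) -[LHS]mulmxA -E mulKmx.
have [<- _] := QR_unique k1U kU (posup_mul b1P cP) (posup_inv bP) H.
exact: Gs_mul.
Qed.

Lemma lead_ok_diag (D x : 'M[C]_n) : supp diag_rel D -> D \in unitmx ->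
  lead_ok x -> lead_ok (D *m x).
Proof.
move=> Dd DU xok k kn; rewrite lead_mul_low; last exact: supp_diag_low.
rewrite unitmx_mul xok // andbT unitmxE det_lead_low; last exact: supp_diag_low.
move: DU; rewrite unitmxE (det_low (supp_diag_low Dd)) !unitfE => /prodf_neq0 H.
by apply/prodf_neq0 => i _; apply: H.
Qed.

Lemma diag_commute (D : 'M[C]_n) : supp diag_rel D -> D *m L = L *m D.
Proof.
move=> Dd; have Ls := is_diag_supp Ld; apply/matrixP => i j.
rewrite supp_mul_diagE // supp_diag_mulE //.
by case: (eqVneq i j) => [->|ij]; rewrite ?(Dd i j ij) ?mul0r ?mulr0 // mulrC.
Qed.

Lemma Gs_up_bd x : supp up_rel x -> G x -> G (bd be x).
Proof.
move=> xu xG; have [mu mU ns n1] := up_split bmono xu (Gs_unit xG).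
have [] := @Gs_LDU _ _ _ rf 1%:M (bd be x) (invmx (bd be x) *m x).
- exact: supp_scalar (@blow_refl n be).
- by move=> i; rewrite mxE eqxx.
- exact: bd_blk.
- exact: mU.
- exact: ns.
- exact: n1.
- by rewrite mul1mx mulKVmx.
by [].
Qed.

Lemma diag_of_up (x : 'M[C]_n) : supp up_rel x -> x \in unitmx ->
  supp diag_rel (adjm x *m x) -> supp diag_rel x.
Proof.
move=> xu xU Dd; apply: supp_diagP => //.
have -> : x = invmx (adjm x) *m (adjm x *m x) by rewrite mulKmx // adjm_unit.
apply: (supp_mul (@low_trans n) _ (supp_diag_low Dd)).
by apply: supp_low_inv; apply: supp_adj_low.
Qed.

Lemma supp_conj_diag (r : rel 'I_n) (D x : 'M[C]_n) : transitive r -> reflexive r ->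
  supp diag_rel D -> supp r x -> supp r (D *m x *m adjm D).
Proof.
move=> rt rr Dd xr; have dr (y : 'M[C]_n) : supp diag_rel y -> supp r y.
  by apply: supp_sub => i j /eqP ->.
by apply: (supp_mul rt _ (dr _ (diag_adj Dd))); apply: supp_mul rt (dr _ Dd) xr.
Qed.

Lemma unidiag_conj_diag (D x : 'M[C]_n) : unitary D -> supp diag_rel D ->
  unidiag x -> unidiag (D *m x *m adjm D).
Proof.
move=> DU Dd x1 i; rewrite -unitary_inv // diag_conj_diag //.
exact: unitary_unit.
Qed.

Lemma mid_trans : transitive (mid_rel be).
Proof.
move=> j i k /orP [/eqP ->//|/andP [/eqP ij ji]] /orP [/eqP <-|/andP [/eqP jk kj]].
  by rewrite /mid_rel ij eqxx ji orbT.
by rewrite /mid_rel ij jk eqxx (ltn_trans kj ji) orbT.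
Qed.

(** The normalisation of [rep_of_eigvecs] is repeated with the additional demand that each diagonal
    rescaling belongs to the real form. *)
Lemma rep_of_Gs w X g : sperm w -> G w -> G g -> g *m X = L *m g ->
  lead_ok (adjm w *m g) ->
  exists u l m k b, [/\ G u, G l, supp (bup_rel be) u & supp (blow_rel be) l] /\
    [/\ unidiag l, supp (mid_rel be) m, unidiag m & rep L w X u (l *m m) k b].
Proof.
move=> wP wG gG gX gok; have wU := sperm_unitary wP; have wU' := mulmx1C wU.
have gU := Gs_unit gG.
have [k0 [b0 [k0U b0P gE0]]] : exists k b, [/\ unitary k, posup b & invmx g = k *m b].
  by apply: QR_exists; rewrite unitmx_inv.
have [k0G b0G] := Gs_QR (Gs_inv gG) k0U b0P gE0.
have BG := Gs_inv b0G; have BP := posup_inv b0P.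
have gE : g = invmx b0 *m adjm k0.
  apply: (can_inj (mulmxK (unitary_unit k0U))); rewrite /= -mulmxA k0U mulmx1.
  have b0U := posup_unit b0P; apply: (can_inj (mulmxK b0U)).
  by rewrite mulVmx // -mulmxA -gE0 mulmxV.
set B := invmx b0 in BG BP gE; have [Bu Bp] := BP; have BU := posup_unit BP.
have [mu mU ys y1] := up_split bmono Bu BU.
have mG := Gs_up_bd Bu BG.
have mb := @bd_blk _ _ be B.
have mP : posup (bd be B) by split=> // i; rewrite bd_diag.
have [md _] := Gs_posup_blk mP mb (Gs_mul (Gs_adj mG) mG).
(* The block part of B is diagonal by [Gs_posup_blk], so removing it is an admissible row
   scaling. *)
set m0 := bd be B in mu mU ys y1 mG mb mP md; pose d1 := invmx m0.
have d1G : G d1 by apply: Gs_inv.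
have d1d : supp diag_rel d1 by apply: supp_inv (@diag_refl n) (@diag_trans n) md.
have d1U := Gs_unit d1G.
set y := invmx m0 *m B in ys y1.
have yG : G y by apply: Gs_mul.
pose g1 := d1 *m g.
have g1G : G g1 by apply: Gs_mul.
have g1E : g1 = y *m adjm k0 by rewrite /g1 gE mulmxA.
have g1X : g1 *m X = L *m g1.
  by rewrite /g1 -[LHS]mulmxA gX [LHS]mulmxA diag_commute // -mulmxA.
have g1ok : lead_ok (adjm w *m g1).
  have [p /(_ d1 d1d) [dwd _]] := sperm_adj_conj_diag wP.
  have -> : adjm w *m g1 = (adjm w *m d1 *m w) *m (adjm w *m g).
    by rewrite -(mulmxA (adjm w *m d1)) (mulmxA w) wU' mul1mx mulmxA.
  apply: lead_ok_diag; [exact: dwd| |exact: gok].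
  by rewrite !unitmx_mul adjm_unit d1U (unitary_unit wU).
clearbody g1 d1 y m0 B.
have [lf [r [lfl lf1 ru rU lrE]]] := LU_exists g1ok.
have [ms m1 ls l1] := low_split bmono lfl lf1.
set m := bd be lf in ms m1 ls l1; set l := lf *m invmx m in ls l1.
have mdU := unip_low_unit (mid_low ms) m1.
have lfE : lf = l *m m by rewrite /l mulmxKV.
clearbody l m.
have [mru mrU nrs nr1] := up_split bmono ru rU.
set mr := bd be r in mru mrU nrs nr1.
have mrd i : mr i i = r i i by rewrite bd_diag.
have [lG MG _] : [/\ G l, G (m *m mr) & G (invmx mr *m r)].
  apply: Gs_LDU ls l1 _ _ nrs nr1 _.
  - apply: (supp_mul (@blk_trans n be)); [exact: mid_blk|exact: bd_blk].
  - by rewrite unitmx_mul mdU.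
  - have -> : l *m (m *m mr) *m (invmx mr *m r) = adjm w *m g1.
      by rewrite lrE lfE -!mulmxA mulKVmx.
    by apply: Gs_mul => //; apply: Gs_adj.
(* Only m mr is known to lie in the real form. Splitting off the unitary factor s of m moves the
   positive factor c next to mr. *)
have [s [c [sU cP mE]]] := QR_exists mdU.
have sG := Gs_mid ms m1 sU cP mE; have [cu cp] := cP.
pose x := c *m mr.
have xG : G x.
  have -> : x = invmx s *m (m *m mr) by rewrite /x mE -mulmxA mulKmx // (Gs_unit sG).
  by apply: Gs_mul => //; apply: Gs_inv.
have xu : supp up_rel x by apply: supp_mul (@up_trans n) cu mru.
have xd i : x i i = c i i * r i i by rewrite (supp_mul_diag i (@up_anti n) cu mru) mrd.
have zG := Gs_up_bd xu xG; have zb := @bd_blk _ _ be x.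
have zu : supp up_rel (bd be x) by apply: bd_supp.
have zd i : bd be x i i = c i i * r i i by rewrite bd_diag xd.
move: (bd be x) zG zb zu zd => z zG zb zu zd.
have zU := Gs_unit zG.
have zzG : G (adjm z *m z) by apply: Gs_mul => //; apply: Gs_adj.
have zzd := Gs_pos_diag zU zb zzG.
have zD := diag_of_up zu zU zzd.
have [d [dd dp da dE]] := diag_sqrt zzd (fun i => sqnorm_gt0 i zU).
have dG : G d by apply: Gs_sqrt => //; rewrite dE.
have dU := Gs_unit dG.
(* The diagonal matrix z has entries c_ii r_ii with c_ii positive, so its unitary part [th] consists
   of the phases of the pivots r_ii and lies in the real form. *)
pose th := z *m invmx d.
have thG : G th by apply: Gs_mul => //; apply: Gs_inv.
have thd : supp diag_rel th.
  by apply: (supp_mul (@diag_trans n) zD); apply: supp_inv (@diag_refl n) (@diag_trans n) dd.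
have thU : unitary th.
  rewrite /unitary /th adjmM adjm_inv da mulmxA -(mulmxA _ (adjm z)) -dE.
  by rewrite mulmxA mulVmx // mul1mx mulmxV.
have thz : th *m d = z by rewrite /th mulmxKV.
clearbody th.
have tad := diag_adj thd; have taU := unitary_adj thU.
(* The phase correction as it acts on the rows of g1: w^* ta = th^* w^*. *)
pose ta := w *m adjm th *m adjm w.
have taG : G ta by apply: Gs_mul; [apply: Gs_mul => //; apply: Gs_adj|apply: Gs_adj].
have [p /(_ _ tad) [tawd _]] := sperm_conj_diag wP.
have tawU : unitary ta.
  by apply: unitary_mul => //; [apply: unitary_mul|apply: unitary_adj].
have taE : ta = w *m adjm th *m adjm w by [].
clearbody ta.
exists (ta *m y *m adjm ta), (adjm th *m l *m adjm (adjm th)), (adjm th *m m *m adjm (adjm th)).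
exists (ta *m adjm k0), (adjm th *m r).
have us : supp (bup_rel be) (ta *m y *m adjm ta).
  by rewrite taE; apply: supp_conj_diag (@bup_trans n be) (@bup_refl n be) tawd ys.
have ls' : supp (blow_rel be) (adjm th *m l *m adjm (adjm th)).
  exact: supp_conj_diag (@blow_trans n be) (@blow_refl n be) tad ls.
have ms' : supp (mid_rel be) (adjm th *m m *m adjm (adjm th)).
  exact: supp_conj_diag mid_trans (@mid_refl n be) tad ms.
have l1' : unidiag (adjm th *m l *m adjm (adjm th)) by apply: unidiag_conj_diag.
have m1' : unidiag (adjm th *m m *m adjm (adjm th)) by apply: unidiag_conj_diag.
have uG : G (ta *m y *m adjm ta) by apply: Gs_mul; [apply: Gs_mul|apply: Gs_adj].
have lG' : G (adjm th *m l *m adjm (adjm th)).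
  by apply: Gs_mul; [apply: Gs_mul => //; apply: Gs_adj|do 2 apply: Gs_adj].
have ll' := blow_low bmono ls'; have ml' := mid_low ms'.
split; first by split; [exact: uG|exact: lG'|exact: us|exact: ls'].
split; [exact: l1'|exact: ms'|exact: m1'|].
have gk : ta *m y *m adjm ta *m (ta *m adjm k0) = ta *m g1.
  by rewrite mulmxUK // g1E mulmxA.
split; split.
- exact: (bup_up bmono us).
- by apply: unidiag_conj_diag => //; rewrite taE.
- exact: (supp_mul (@low_trans n) ll' ml').
- exact: (unidiag_mul (@low_anti n) ll' ml' l1' m1').
- by apply: unitary_mul => //; apply: unitary_adj.
- split; first by apply: (supp_mul (@up_trans n) (supp_diag_up tad) ru).
  move=> i; rewrite supp_diag_mulE // adjmE.
  have E1 : th i i * d i i = c i i * r i i by rewrite -zd -thz supp_diag_mulE.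
  have E2 : (th i i)^* * th i i = 1.
    have := congr1 (fun q : 'M[C]_n => q i i) thU.
    by rewrite /= supp_diag_mulE ?adjmE ?mxE ?eqxx //.
  have -> : (th i i)^* * r i i = d i i / c i i.
    apply: (mulfI (lt0r_neq0 (cp i))).
    by rewrite mulrCA -E1 mulrA E2 mul1r mulrCA divff ?mulr1 // lt0r_neq0.
  by rewrite divr_gt0.
- have E : adjm w *m g1 = l *m m *m r by rewrite -lfE -lrE.
  rewrite gk -[RHS]mulmxA.
  have -> : adjm th *m l *m adjm (adjm th) *m (adjm th *m m *m adjm (adjm th)) *m (adjm th *m r)
      = adjm th *m (adjm w *m g1).
    rewrite E adjmK -!mulmxA (mulmxA th) (mulmx1C thU) mul1mx (mulmxA th) (mulmx1C thU).
    by rewrite mul1mx.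
  by rewrite taE -!mulmxA.
by rewrite gk -mulmxA g1X [LHS]mulmxA diag_commute ?taE // -mulmxA.
Qed.

End RealForm.

(** * Charts *)

Section EigenRows.
Variables (R : realType) (n : nat) (L : 'M[R[i]]_n).
Hypotheses (Ld : is_diag L) (Ls : simple_spectrum L).
Local Notation C := R[i].

Definition shiftprod (X : 'M[C]_n) (s : seq 'I_n) : 'M[C]_n :=
  foldr (fun j M => (X - (L j j)%:M) *m M) 1%:M s.

(* A multiple of the spectral projection of X on the i-th eigenvalue of L. *)
Definition eigproj (X : 'M[C]_n) (i : 'I_n) : 'M[C]_n :=
  shiftprod X [seq j <- enum 'I_n | j != i].

Lemma shiftprod_conj g X s : g *m X = L *m g ->
  g *m shiftprod X s = shiftprod L s *m g.
Proof.
move=> gX; elim: s => [|j s IH] /=; first by rewrite mulmx1 mul1mx.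
by rewrite mulmxA mulmxBr gX scalar_mxC -mulmxBl -[LHS]mulmxA IH mulmxA.
Qed.

Lemma shiftprod_diag s : supp diag_rel (shiftprod L s) /\
  forall k, shiftprod L s k k = \prod_(j <- s) (L k k - L j j).
Proof.
have Lsh j : supp diag_rel (L - (L j j)%:M).
  by apply: supp_sub2; [apply: is_diag_supp|apply: supp_scalar (@diag_refl n)].
elim: s => [|j s [IHd IH]] /=.
  split; first exact: supp_scalar (@diag_refl n).
  by move=> k; rewrite big_nil mxE eqxx.
split; first exact: (supp_mul (@diag_trans n) (Lsh j) IHd).
by move=> k; rewrite supp_diag_mulE // IH big_cons !mxE eqxx.
Qed.

Definition eigc (i : 'I_n) : C := \prod_(j <- [seq j <- enum 'I_n | j != i]) (L i i - L j j).

Lemma eigc_neq0 i : eigc i != 0.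
Proof.
rewrite /eigc prodf_seq_neq0; apply/allP => j; rewrite mem_filter => /andP [ji _] /=.
rewrite subr_eq0; apply: contra ji => /eqP /Ls -> //.
Qed.

(** In an eigenbasis the product has a single nonzero diagonal entry, in position i, so it has rank
    one and its rows are multiples of row i of g. *)
Lemma eigprojE g X i a b : g \in unitmx -> g *m X = L *m g ->
  eigproj X i a b = invmx g a i * eigc i * g i b.
Proof.
move=> gU gX; have [Dd DE] := shiftprod_diag [seq j <- enum 'I_n | j != i].
have -> : eigproj X i = invmx g *m (shiftprod L [seq j <- enum 'I_n | j != i] *m g).
  by rewrite -(shiftprod_conj _ gX) mulKmx.
rewrite mxE (bigD1 i) //= big1 => [|k ki].
  by rewrite addr0 supp_diag_mulE // DE mulrA.
rewrite supp_diag_mulE // DE (_ : \prod_(j <- _) _ = 0) ?mul0r ?mulr0 //.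
apply/eqP; rewrite prodf_seq_eq0; apply/hasP; exists k; last by rewrite /= subrr.
by rewrite mem_filter ki mem_enum.
Qed.

(** Row a_i of the i-th projection is polynomial in X and a left eigenvector where it does not
    vanish. As no fixed row is nonzero for every X, the choice a must vary. *)
Definition eigrows (a : {ffun 'I_n -> 'I_n}) (X : 'M[C]_n) : 'M[C]_n :=
  \matrix_(i, j) eigproj X i (a i) j.

Lemma eigrows_diag a g X : g \in unitmx -> g *m X = L *m g ->
  exists D, supp diag_rel D /\ eigrows a X = D *m g /\
    (D \in unitmx <-> forall i, invmx g (a i) i != 0).
Proof.
move=> gU gX; pose D : 'M[C]_n := \matrix_(i, j) if i == j then invmx g (a i) i * eigc i else 0.
have Dd : supp diag_rel D by move=> i j /negPf; rewrite /diag_rel mxE => ->.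
exists D; split=> //; split.
  apply/matrixP => i j; rewrite supp_diag_mulE // mxE (eigprojE _ _ _ gU gX).
  by rewrite mxE eqxx.
rewrite unitmxE det_low; last exact: supp_diag_low.
rewrite unitfE; split=> [/prodf_neq0 H i|H].
  by have := H i isT; rewrite mxE eqxx mulf_eq0 negb_or => /andP [].
by apply/prodf_neq0 => i _; rewrite mxE eqxx mulf_neq0 ?eigc_neq0.
Qed.

Lemma eigrows_exists (g : 'M[C]_n) : g \in unitmx ->
  exists a : {ffun 'I_n -> 'I_n}, forall i, invmx g (a i) i != 0.
Proof.
move=> gU; have H i : exists k, invmx g k i != 0.
  apply/existsP; apply: contraT; rewrite negb_exists => /forallP z.
  have := congr1 (fun m : 'M[C]_n => m i i) (mulmxV gU).
  rewrite /= !mxE big1 ?eqxx => [/eqP|k _]; first by rewrite eq_sym oner_eq0.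
  by have /negPn /eqP -> := z k; rewrite mulr0.
have [f fP] := boolp.choice H.
by exists [ffun i => f i] => i; rewrite ffunE.
Qed.

Lemma eigrows_X a g X : g \in unitmx -> g *m X = L *m g ->
  eigrows a X *m X = L *m eigrows a X.
Proof.
move=> gU gX; have [D [Dd [-> _]]] := eigrows_diag a gU gX.
by rewrite -[LHS]mulmxA gX [LHS]mulmxA (diag_commute Ld Dd) -mulmxA.
Qed.

Lemma mcl_eigrows (T : Type) (A : set T) (K : fclass R A) a (X : T -> 'M[C]_n) :
  mcl K X -> mcl K (fun x => eigrows a (X x)).
Proof.
move=> Xc i j; apply: (@ccl_ext _ _ _ _ (fun x => eigproj (X x) i (a i) j)).
  by move=> x _; rewrite mxE.
suff H s : mcl K (fun x => shiftprod (X x) s) by apply: H.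
elim: s => [|k s IH] /=; first exact: mcl_cst.
by apply: mcl_mul => //; apply: mcl_add => //; apply: mcl_cst.
Qed.

Variable w : 'M[C]_n.

Definition chart_dom_at (a : {ffun 'I_n -> 'I_n}) : set ('M[R]_n * 'M[R]_n) :=
  [set Y | lead_ok (adjm w *m eigrows a (unrealify Y))].

(** The union over all choices of rows makes the domain depend only on the eigenlines of X, as
    [chart_domP] shows. *)
Definition chart_dom : set ('M[R]_n * 'M[R]_n) := \bigcup_a chart_dom_at a.

Lemma chart_dom_at_open a : open (chart_dom_at a).
Proof.
pose T := ('M[R]_n * 'M[R]_n)%type.
have oT : open ([set: T]) := openT.
pose K := continuous_class R oT.
(* The product runs over all sizes from 0 to n; openness follows from the continuity of its squared
   modulus. *)
pose f (Y : T) := \prod_(k < n.+1) \det (lead k (adjm w *m eigrows a (unrealify Y))).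
have fc : ccl K f.
  apply: ccl_prod => k; apply: ccl_det => i j.
  have Mc : mcl K (fun Y : T => adjm w *m eigrows a (unrealify Y)).
    apply: mcl_mul; first exact: mcl_cst.
    by apply: mcl_eigrows; apply: unrealify_continuous.
  case E : ((i < k)%N && (j < k)%N).
    by apply: ccl_ext (Mc i j) => x _; rewrite [RHS]mxE E.
  apply: (@ccl_ext _ _ _ _ (fun=> (i == j)%:R)); last exact: ccl_cst.
  by move=> x _; rewrite mxE E.
have nc : ccl K (fun Y => f Y * (f Y)^*) by apply: ccl_mul => //; apply: ccl_conj.
have -> : chart_dom_at a = (fun Y => complex.Re (f Y * (f Y)^*)) @^-1` [set x | x != 0].
  apply/seteqP; split => Y /=.
    move=> H; have f0 : f Y != 0.
      by apply/prodf_neq0 => k _; have := H k; rewrite -ltnS ltn_ord unitmxE unitfE; apply.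
    apply: contra f0; rewrite -mul_conjC_eq0.
    case: (f Y) => p q /= /eqP E; apply/eqP; apply/eqP; rewrite eq_complex /= E eqxx /=.
    by apply/eqP; ring.
  move=> H k kn; have : f Y != 0 by apply: contra H => /eqP ->; rewrite mul0r.
  by move=> /prodf_neq0 /(_ (Ordinal (kn : (k < n.+1)%N)) isT); rewrite unitmxE unitfE.
apply: open_comp; last exact: open_neq.
by move=> Y _; have [/(_ Y I)] := nc.
Qed.

Lemma chart_dom_open : open chart_dom.
Proof. by apply: bigcup_open => a _; apply: chart_dom_at_open. Qed.

Hypothesis wP : sperm w.

Lemma lead_ok_diag_conj (D x : 'M[C]_n) : supp diag_rel D -> D \in unitmx ->
  lead_ok (adjm w *m x) -> lead_ok (adjm w *m (D *m x)).
Proof.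
move=> Dd DU xok; have wU := sperm_unitary wP; have wU' := mulmx1C wU.
have [p /(_ D Dd) [dwd _]] := sperm_adj_conj_diag wP.
have -> : adjm w *m (D *m x) = (adjm w *m D *m w) *m (adjm w *m x).
  by rewrite -(mulmxA (adjm w *m D)) (mulmxA w) wU' mul1mx mulmxA.
apply: lead_ok_diag; [exact: dwd| |exact: xok].
by rewrite !unitmx_mul adjm_unit DU (unitary_unit wU).
Qed.

(** Rescaling the rows of g multiplies w^* g by the diagonal matrix w^* D w, which does not affect
    the vanishing of leading minors. *)
Lemma chart_domP g X : g \in unitmx -> g *m X = L *m g ->
  (chart_dom (realify X) <-> lead_ok (adjm w *m g)).
Proof.
move=> gU gX; rewrite /chart_dom; split=> [[a _]|ok]; rewrite /chart_dom_at /= ?realifyK.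
  have [D [Dd [-> DU]]] := eigrows_diag a gU gX => ok.
  have Du : D \in unitmx.
    by have := lead_ok_unit ok; rewrite !unitmx_mul => /and3P [].
  have -> : g = invmx D *m (D *m g) by rewrite mulKmx.
  apply: lead_ok_diag_conj ok; last by rewrite unitmx_inv.
  exact: supp_inv (@diag_refl n) (@diag_trans n) Dd.
have [a aP] := eigrows_exists gU; exists a; first exact: I.
rewrite /= realifyK.
have [D [Dd [-> DU]]] := eigrows_diag a gU gX.
by apply: lead_ok_diag_conj => //; apply/DU.
Qed.

End EigenRows.

Section Parts.
Variables (R : realType) (n : nat) (be : 'I_n -> nat).
Local Notation C := R[i].
Implicit Types Z : 'M[C]_n.

(* A chart is parametrised by one matrix Z vanishing on the diagonal and above
   it inside the blocks: its block upper, block lower and in-block parts are the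
   coordinates of the three unipotent factors. *)
Definition upp Z : 'M[C]_n := \matrix_(i, j) if (be i < be j)%N then Z i j else 0.
Definition lwp Z : 'M[C]_n := \matrix_(i, j) if (be j < be i)%N then Z i j else 0.
Definition mdp Z : 'M[C]_n := \matrix_(i, j) if be i == be j then Z i j else 0.

Lemma upp_lin (a : C) x y : upp (a *: x + y) = a *: upp x + upp y.
Proof. by apply/matrixP => i j; rewrite !mxE; case: ifP => // _; rewrite mulr0 addr0. Qed.
Lemma lwp_lin (a : C) x y : lwp (a *: x + y) = a *: lwp x + lwp y.
Proof. by apply/matrixP => i j; rewrite !mxE; case: ifP => // _; rewrite mulr0 addr0. Qed.

Lemma parts_sum Z : upp Z + lwp Z + mdp Z = Z.
Proof.
by apply/matrixP => i j; rewrite !mxE; case: (ltngtP (be i) (be j)) => _; rewrite ?add0r ?addr0.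
Qed.

Lemma upp_supp Z : supp (bup_rel be) (upp Z).
Proof. by move=> i j; rewrite negb_or => /andP [_ /negPf E]; rewrite mxE E. Qed.
Lemma lwp_supp Z : supp (blow_rel be) (lwp Z).
Proof. by move=> i j; rewrite negb_or => /andP [_ /negPf E]; rewrite mxE E. Qed.
Lemma upp_diag Z i : upp Z i i = 0. Proof. by rewrite mxE ltnn. Qed.
Lemma lwp_diag Z i : lwp Z i i = 0. Proof. by rewrite mxE ltnn. Qed.

Lemma parts_unique x y z :
  supp (bup_rel be) x -> (forall i, x i i = 0) ->
  supp (blow_rel be) y -> (forall i, y i i = 0) -> supp (blk_rel be) z ->
  [/\ upp (x + y + z) = x, lwp (x + y + z) = y & mdp (x + y + z) = z].
Proof.
move=> xs xd ys yd zs.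
have xz i j : (be j <= be i)%N -> x i j = 0.
  move=> H; case: (eqVneq i j) => [->//|ij]; apply: xs.
  by rewrite /bup_rel (negPf ij) -leqNgt.
have yz i j : (be i <= be j)%N -> y i j = 0.
  move=> H; case: (eqVneq i j) => [->//|ij]; apply: ys.
  by rewrite /blow_rel (negPf ij) -leqNgt.
have zz i j : be i != be j -> z i j = 0 by move=> H; apply: zs.
split; apply/matrixP => i j; rewrite !mxE; case: (ltngtP (be i) (be j)) => H.
- by rewrite yz ?(ltnW H) // zz ?ltn_eqF // !addr0.
- by rewrite xz ?(ltnW H).
- by rewrite xz ?H.
- by rewrite yz ?(ltnW H).
- by rewrite xz ?(ltnW H) // zz ?gtn_eqF // addr0 add0r.
- by rewrite yz ?H.
- by rewrite zz // ltn_eqF.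
- by rewrite zz // gtn_eqF.
- by rewrite xz ?H // yz ?H // !add0r.
Qed.

Section Class.
Variables (T : Type) (A : set T) (K : fclass R A).

Lemma mcl_if (p : 'I_n -> 'I_n -> bool) (F : T -> 'M[C]_n) : mcl K F ->
  mcl K (fun x => \matrix_(i, j) if p i j then F x i j else 0).
Proof.
move=> Fc i j; case E : (p i j).
  by apply: ccl_ext (Fc i j) => x _; rewrite mxE E.
by apply: (@ccl_ext _ _ _ _ (fun=> 0)); [move=> x _; rewrite mxE E|apply: ccl_cst].
Qed.

Lemma mcl_cay (F : T -> 'M[C]_n) : mcl K F -> (forall x, A x -> 1%:M + F x \in unitmx) ->
  mcl K (fun x => cay (F x)).
Proof.
move=> Fc Fu; have c1 := mcl_cst K (1%:M : 'M[C]_n).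
apply: mcl_mul; first by apply: mcl_add => //; apply: mcl_opp.
by apply: mcl_inv => //; apply: mcl_add.
Qed.

End Class.

Lemma cay_supp (r : rel 'I_n) (x : 'M[C]_n) : reflexive r -> transitive r -> supp r x -> supp r (cay x).
Proof.
move=> rr rt xr; have r1 := supp_scalar (1 : C) rr.
apply: (supp_mul rt); first exact: supp_sub2.
by apply: supp_inv => //; apply: supp_add.
Qed.

Lemma cay_diag (r : rel 'I_n) (x : 'M[C]_n) (a : C) i : reflexive r -> transitive r -> antisymmetric r ->
  supp r x -> 1%:M + x \in unitmx -> x i i = a ->
  cay x i i = (1 - a) / (1 + a).
Proof.
move=> rr rt ra xr xu xa; have r1 := supp_scalar (1 : C) rr.
have r2 := supp_add r1 xr; have r3 := supp_sub2 r1 xr.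
rewrite /cay (supp_mul_diag i ra r3 (supp_inv rr rt r2)).
by rewrite (supp_inv_diag i rr rt ra r2 xu) !mxE eqxx xa.
Qed.

(** Since [cay] commutes with conjugation, x' = [x, Q] implies the same equation for u = cay x. The
    hypotheses are u (1 + x) = 1 - x and its derivative. *)
Lemma cay_comm (x u d Q : 'M[C]_n) : 1%:M + x \in unitmx -> u *m (1%:M + x) = 1%:M - x ->
  d *m (1%:M + x) + u *m (x *m Q - Q *m x) = - (x *m Q - Q *m x) ->
  d = u *m Q - Q *m u.
Proof.
move=> xu E H.
have F : d *m (1%:M + x) = - (x *m Q - Q *m x) - u *m (x *m Q - Q *m x).
  by rewrite -H addrK.
have E2 : u *m x = 1%:M - x - u by rewrite -E mulmxDr mulmx1 addrC addKr.
apply: (can_inj (mulmxK xu)); rewrite /= F mulmxBl -[Q *m u *m _]mulmxA E.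
rewrite [u *m Q *m _]mulmxDr mulmx1 !mulmxBr [u *m (x *m Q)]mulmxA E2 !mulmxBl mul1mx mulmx1.
rewrite ![u *m (Q *m x)]mulmxA.
move: (u *m Q *m x) (u *m Q) (x *m Q) (Q *m x) => p q s t.
by apply/matrixP => i j; rewrite !mxE; ring.
Qed.

End Parts.

Section Chart.
Variables (R : realType) (n : nat) (L : 'M[R[i]]_n).
Hypotheses (Ld : is_diag L) (Ls : simple_spectrum L).
Variable rf : realform L.
Local Notation C := R[i].
Local Notation G := (Gs rf).
Local Notation be := (blk rf).
Local Notation bmono := (@blk_mono _ _ _ rf).
Local Notation upp := (upp be).
Local Notation lwp := (lwp be).
Local Notation mdp := (mdp be).
Implicit Types Z X u l m k b : 'M[C]_n.

Definition coordspace : set 'M[C]_n := [set Z | [/\ gs rf (upp Z), gs rf (lwp Z) &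
  forall i j : 'I_n, be i = be j -> (i <= j)%N -> Z i j = 0]].

Lemma coordspace0 : coordspace 0.
Proof.
split; last by move=> i j _ _; rewrite mxE.
- rewrite (_ : upp 0 = 0); first exact: gs0.
  by apply/matrixP => i j; rewrite !mxE if_same.
- rewrite (_ : lwp 0 = 0); first exact: gs0.
  by apply/matrixP => i j; rewrite !mxE if_same.
Qed.

Lemma coordspace_lin (a : R) x y : coordspace x -> coordspace y -> coordspace (a%:C%C *: x + y).
Proof.
move=> [ux lx zx] [uy ly zy]; split.
- by rewrite upp_lin; apply: gs_lin.
- by rewrite lwp_lin; apply: gs_lin.
- by move=> i j E ij; rewrite !mxE zx // zy // mulr0 addr0.
Qed.

Definition ufac Z := cay (upp Z).
Definition lfac Z := cay (lwp Z).
(** No Cayley transform is needed here: the factor is not constrained by the real form, and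
    [1 + z, Q] = [z, Q]. *)
Definition mfac Z := 1%:M + mdp Z.

Lemma upp_add_unit Z : 1%:M + upp Z \in unitmx.
Proof.
apply: (@one_add_unit _ _ _ 0); first exact: upp_diag.
  by rewrite addr0 oner_eq0.
by left; apply: (bup_up bmono); apply: upp_supp.
Qed.

Lemma lwp_add_unit Z : 1%:M + lwp Z \in unitmx.
Proof.
apply: (@one_add_unit _ _ _ 0); first exact: lwp_diag.
  by rewrite addr0 oner_eq0.
by right; apply: (blow_low bmono); apply: lwp_supp.
Qed.

Lemma upp_sub_unit Z : 1%:M - upp Z \in unitmx.
Proof.
apply: (@one_add_unit _ _ _ 0); first by move=> i; rewrite mxE upp_diag oppr0.
  by rewrite addr0 oner_eq0.
by left; apply: supp_opp; apply: (bup_up bmono); apply: upp_supp.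
Qed.

Lemma lwp_sub_unit Z : 1%:M - lwp Z \in unitmx.
Proof.
apply: (@one_add_unit _ _ _ 0); first by move=> i; rewrite mxE lwp_diag oppr0.
  by rewrite addr0 oner_eq0.
by right; apply: supp_opp; apply: (blow_low bmono); apply: lwp_supp.
Qed.

Lemma ufac_supp Z : supp (bup_rel be) (ufac Z).
Proof. by apply: cay_supp; [apply: bup_refl|apply: bup_trans|apply: upp_supp]. Qed.

Lemma lfac_supp Z : supp (blow_rel be) (lfac Z).
Proof. by apply: cay_supp; [apply: blow_refl|apply: blow_trans|apply: lwp_supp]. Qed.

Lemma ufac_unidiag Z : unidiag (ufac Z).
Proof.
move=> i; rewrite /ufac (cay_diag (@up_refl n) (@up_trans n) (@up_anti n) _ (upp_add_unit Z)
  (upp_diag _ Z i)).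
  by rewrite subr0 addr0 divr1.
by apply: (bup_up bmono); apply: upp_supp.
Qed.

Lemma lfac_unidiag Z : unidiag (lfac Z).
Proof.
move=> i; rewrite /lfac (cay_diag (@low_refl n) (@low_trans n) (@low_anti n) _ (lwp_add_unit Z)
  (lwp_diag _ Z i)).
  by rewrite subr0 addr0 divr1.
by apply: (blow_low bmono); apply: lwp_supp.
Qed.

Lemma ufac_Gs Z : coordspace Z -> G (ufac Z).
Proof. by case=> gu _ _; apply: Gs_cay => //; [apply: upp_add_unit|apply: upp_sub_unit]. Qed.

Lemma lfac_Gs Z : coordspace Z -> G (lfac Z).
Proof. by case=> _ gl _; apply: Gs_cay => //; [apply: lwp_add_unit|apply: lwp_sub_unit]. Qed.

Lemma mdp_mid Z : coordspace Z -> supp (mid_rel be) (mdp Z).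
Proof.
case=> _ _ z i j; rewrite /mid_rel negb_or => /andP [ij H]; rewrite mxE.
case: eqVneq H => //= E; rewrite -leqNgt; exact: z.
Qed.

Lemma mfac_supp Z : coordspace Z -> supp (mid_rel be) (mfac Z).
Proof.
move=> ZE; apply: supp_add; first exact: supp_scalar (@mid_refl _ be).
exact: mdp_mid.
Qed.

Lemma mfac_unidiag Z : coordspace Z -> unidiag (mfac Z).
Proof. by case=> _ _ z i; rewrite !mxE !eqxx z ?addr0. Qed.

Lemma coordspace_surj u l m : G u -> G l -> supp (bup_rel be) u -> unidiag u ->
  supp (blow_rel be) l -> unidiag l -> supp (mid_rel be) m -> unidiag m ->
  exists Z, [/\ coordspace Z, ufac Z = u, lfac Z = l, mfac Z = m &
    Z = cay u + cay l + (m - 1%:M)].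
Proof.
move=> uG lG us u1 ls l1 ms m1.
have c2 : (1 + 1 : C) != 0 by rewrite -mulr2n pnatr_eq0.
have uu : 1%:M + u \in unitmx.
  by apply: one_add_unit u1 c2 _; left; apply: (bup_up bmono).
have lu : 1%:M + l \in unitmx.
  by apply: one_add_unit l1 c2 _; right; apply: (blow_low bmono).
have cus : supp (bup_rel be) (cay u).
  by apply: cay_supp; [apply: bup_refl|apply: bup_trans|].
have cls : supp (blow_rel be) (cay l).
  by apply: cay_supp; [apply: blow_refl|apply: blow_trans|].
have cud i : cay u i i = 0.
  rewrite (cay_diag (@up_refl n) (@up_trans n) (@up_anti n) (bup_up bmono us) uu (u1 i)).
  by rewrite subrr mul0r.
have cld i : cay l i i = 0.
  rewrite (cay_diag (@low_refl n) (@low_trans n) (@low_anti n) (blow_low bmono ls) lu (l1 i)).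
  by rewrite subrr mul0r.
have mm : supp (mid_rel be) (m - 1%:M).
  by apply: supp_sub2 => //; apply: supp_scalar (@mid_refl _ be).
have [E1 E2 E3] := parts_unique cus cud cls cld (mid_blk mm).
exists (cay u + cay l + (m - 1%:M)); split=> //.
- split; first by rewrite E1; apply: gs_cay.
    by rewrite E2; apply: gs_cay.
  move=> i j E ij; have -> : (cay u + cay l + (m - 1%:M)) i j = (m - 1%:M) i j.
    by rewrite -[in RHS]E3 [RHS]mxE E eqxx.
  case: (eqVneq i j) => [->|nij]; first by rewrite !mxE eqxx m1 subrr.
  by apply: mm; rewrite /mid_rel (negPf nij) E eqxx /= -leqNgt.
- by rewrite /ufac E1; have [] := cayK uu.
- by rewrite /lfac E2; have [] := cayK lu.
- by rewrite /mfac E3 addrC subrK.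
Qed.

Lemma fac_recover Z : Z = cay (ufac Z) + cay (lfac Z) + (mfac Z - 1%:M).
Proof.
have [_ ->] := cayK (upp_add_unit Z); have [_ ->] := cayK (lwp_add_unit Z).
by rewrite /mfac [1%:M + _]addrC addrK parts_sum.
Qed.

(** The in-block factor is the block diagonal part of the product, so the product determines both
    factors, and Cayley transforms are invertible. *)
Lemma fac_eq Z Z' : coordspace Z -> coordspace Z' -> ufac Z = ufac Z' ->
  lfac Z *m mfac Z = lfac Z' *m mfac Z' -> Z = Z'.
Proof.
move=> ZE ZE' Eu El.
have Em : mfac Z = mfac Z'.
  have B Y : coordspace Y -> bd be (lfac Y *m mfac Y) = mfac Y.
    move=> YE; apply: (bd_low_mul bmono (lfac_supp Y) (lfac_unidiag Y)).
    by apply: mid_blk; apply: mfac_supp.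
  by rewrite -(B _ ZE) El B.
have mu : mfac Z' \in unitmx.
  apply: unip_low_unit; last exact: mfac_unidiag.
  by apply: mid_low; apply: mfac_supp.
have El' : lfac Z = lfac Z' by apply: (can_inj (mulmxK mu)); rewrite -El Em.
by rewrite (fac_recover Z) Eu Em El' -fac_recover.
Qed.

(** The conjugacy class described by left eigenvectors, g being the inverse of the conjugating
    matrix; [conj_class_eq] relates it to the group with determinant one. *)
Definition Gclass : set 'M[C]_n := [set X | exists g, G g /\ g *m X = L *m g].

Lemma ul_ok Z : coordspace Z -> [/\ supp up_rel (ufac Z), unidiag (ufac Z),
  supp low_rel (lfac Z *m mfac Z) & unidiag (lfac Z *m mfac Z)].
Proof.
move=> ZE; have s1 := blow_low bmono (@lfac_supp Z); have s2 := mid_low (mfac_supp ZE).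
split; first by apply: (bup_up bmono); apply: ufac_supp.
- exact: ufac_unidiag.
- exact: (supp_mul (@low_trans n) s1 s2).
- exact: (unidiag_mul (@low_anti n) s1 s2 (lfac_unidiag Z) (mfac_unidiag ZE)).
Qed.

Section Class.
Variables (T : Type) (A : set T) (K : fclass R A) (Z : T -> 'M[C]_n).
Hypothesis Zc : mcl K Z.

Lemma mcl_ufac : mcl K (fun x => ufac (Z x)).
Proof. by apply: mcl_cay => [|x _]; [apply: mcl_if|apply: upp_add_unit]. Qed.
Lemma mcl_lfac : mcl K (fun x => lfac (Z x)).
Proof. by apply: mcl_cay => [|x _]; [apply: mcl_if|apply: lwp_add_unit]. Qed.
Lemma mcl_mfac : mcl K (fun x => mfac (Z x)).
Proof. by apply: mcl_add; [apply: mcl_cst|apply: mcl_if]. Qed.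

End Class.

Variable w : 'M[C]_n.
Hypotheses (wP : sperm w) (wG : G w).

Lemma rep_in_class Z X k b : coordspace Z ->
  rep L w X (ufac Z) (lfac Z *m mfac Z) k b ->
  Gclass X /\ chart_dom L w (realify X).
Proof.
move=> ZE r; have gG := rep_Gs wP wG (ufac_Gs ZE) (lfac_Gs ZE) (mfac_supp ZE) (mfac_unidiag ZE) r.
have [[_ _ ll l1] [kU bP E EX]] := r; have gU := Gs_unit gG.
split; first by exists (ufac Z *m k).
apply/(chart_domP Ld Ls wP gU EX); rewrite E -[w *m _ *m b]mulmxA.
rewrite mulmxA (sperm_unitary wP) mul1mx.
by apply: lead_ok_LU => //; [case: bP|apply: posup_unit].
Qed.

Lemma class_in_rep X : Gclass X -> chart_dom L w (realify X) ->
  exists Z k b, coordspace Z /\ rep L w X (ufac Z) (lfac Z *m mfac Z) k b.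
Proof.
move=> [g [gG gX]] /(chart_domP Ld Ls wP (Gs_unit gG) gX) ok.
have [u [l [m [k [b [[uG lG us ls] [l1 ms m1 r]]]]]]] := rep_of_Gs Ld wP wG gG gX ok.
have [[_ u1 _ _] _] := r.
have [Z [ZE Eu El Em _]] := coordspace_surj uG lG us u1 ls l1 ms m1.
by exists Z, k, b; split=> //; rewrite Eu El Em.
Qed.

End Chart.

Section LinearMaps.
Variable R : realType.

Lemma linear_matrix d1 d2 (f : 'rV[R]_d1 -> 'rV[R]_d2) : linear f ->
  exists A : 'M[R]_(d1, d2), forall v, v *m A = f v.
Proof.
move=> fl; pose fM := GRing.isLinear.Build _ _ _ _ f fl.
pose fL : {linear 'rV[R]_d1 -> 'rV[R]_d2} := HB.pack f fM.
by exists (lin1_mx fL) => v; rewrite mul_rV_lin1.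
Qed.

Lemma rV_continuous_at (T : topologicalType) d (f : T -> 'rV[R]_d) x :
  (forall k, {for x, continuous (fun y => f y 0 k : R)}) -> {for x, continuous f}.
Proof.
move=> fc; have -> : f = (fun y => \sum_k f y 0 k *: delta_mx 0 k).
  by apply/funext => y; rewrite [LHS]row_sum_delta.
elim: (index_enum _) => [|k s IH].
  rewrite (_ : (fun y => _) = cst 0); first exact: cst_continuous.
  by apply/funext => y; rewrite big_nil.
rewrite (_ : (fun y => _) = (fun y => f y 0 k *: delta_mx 0 k + \sum_(j <- s) f y 0 j *: delta_mx 0 j)).
  apply: continuousD; last exact: IH.
  by apply: (@continuous_comp _ _ _ (fun y => f y 0 k) ( *:%R ^~ (delta_mx 0 k)));
    [apply: fc|apply: scalel_continuous].
by apply/funext => y; rewrite big_cons.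
Qed.

End LinearMaps.

(** * Derivatives of the factors *)

Section DerivativeFacts.
Variables (R : realType) (U : normedModType R) (n : nat).
Local Notation C := R[i].
Implicit Types F : U -> 'M[C]_n.

Lemma dm_entry F x v i j c : (forall y, F y i j = c) -> dm F x v i j = 0.
Proof.
move=> E; rewrite mxE (_ : (fun y => F y i j) = (fun=> c)) ?dc_cst //.
by apply/funext.
Qed.

Lemma dm_supp (r : rel 'I_n) F x v : (forall y, supp r (F y)) -> supp r (dm F x v).
Proof. by move=> Fr i j nij; apply: (@dm_entry _ _ _ _ _ 0) => y; apply: Fr. Qed.

Lemma dm_unidiag F x v i : (forall y, unidiag (F y)) -> dm F x v i i = 0.
Proof. by move=> Fd; apply: (@dm_entry _ _ _ _ _ 1) => y; apply: Fd. Qed.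

Lemma dm_real_diag F x v i : mcl (smooth_class U) F -> (forall y, 0 <= F y i i) ->
  (dm F x v i i)^* = dm F x v i i.
Proof.
move=> Fc Fp; rewrite mxE -dc_conj; last exact: Fc.
by congr dc; apply/funext => y; rewrite geC0_conj.
Qed.

Lemma dm_cay F x v Q : mcl (smooth_class U) F -> (forall y, 1%:M + F y \in unitmx) ->
  dm F x v = F x *m Q - Q *m F x ->
  dm (fun y => cay (F y)) x v = cay (F x) *m Q - Q *m cay (F x).
Proof.
move=> Fc Fu dE.
have cc : mcl (smooth_class U) (fun y => cay (F y)) by apply: mcl_cay.
have c1 := mcl_cst (smooth_class U) (1%:M : 'M[C]_n).
have pc := mcl_add c1 Fc.
have H y : cay (F y) *m (1%:M + F y) = 1%:M - F y by rewrite mulmxKV.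
apply: (cay_comm (Fu x) (H x)).
have -> : F x *m Q - Q *m F x = dm F x v by [].
have := dm_mul x v cc pc; rewrite (_ : (fun y => cay (F y) *m _) = (fun y => 1%:M + - F y)); last first.
  by apply/funext => y; rewrite H.
rewrite (dm_add x v c1 (mcl_opp Fc)) (dm_add x v c1 Fc) dm_cst !add0r => <-.
apply/matrixP => i j; rewrite !mxE.
have E : (fun y => (- F y) i j) = (fun y => -1 * F y i j).
  by apply/funext => y; rewrite mxE mulN1r.
by rewrite E (dc_mul x v (ccl_cst _ _) (Fc i j)) dc_cst mul0r add0r mulN1r.
Qed.

(** F is the Cayley transform of [cay] of F, so [dm_cay] with Q = 0 applies to the transformed
    function. *)
Lemma dm_cay0 F x v : mcl (smooth_class U) F -> (forall y, 1%:M + F y \in unitmx) ->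
  dm (fun y => cay (F y)) x v = 0 -> dm F x v = 0.
Proof.
move=> Fc Fu d0.
have cc : mcl (smooth_class U) (fun y => cay (F y)) by apply: mcl_cay.
have -> : F = (fun y => cay (cay (F y))).
  by apply/funext => y; have [_ ->] := cayK (Fu y).
have cu' y : 1%:M + cay (F y) \in unitmx.
  have [-> _] := cayK (Fu y).
  by rewrite unitmxZ ?unitfE ?pnatr_eq0 // unitmx_inv.
by rewrite (dm_cay (Q := 0) cc cu') ?d0 mulmx0 mul0mx subr0.
Qed.

End DerivativeFacts.

(** Differentiating the relations of [rep] supplies the hypotheses of [rep_tangent_inj] and
    [rep_tangent_toda]. *)
Lemma rep_diff (R : realType) (U : normedModType R) n (L w : 'M[R[i]]_n)
    (u l k b X : U -> 'M[R[i]]_n) (x v : U) :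
  mcl (smooth_class U) u -> mcl (smooth_class U) l -> mcl (smooth_class U) k ->
  mcl (smooth_class U) b -> mcl (smooth_class U) X ->
  (forall y, rep L w (X y) (u y) (l y) (k y) (b y)) ->
  let du := dm u x v in let dl := dm l x v in let dk := dm k x v in
  let db := dm b x v in
  [/\ supp up_rel du, forall i, du i i = 0, supp low_rel dl & forall i, dl i i = 0] /\
  [/\ adjm dk *m k x + adjm (k x) *m dk = 0, supp up_rel db,
      forall i, (db i i)^* = db i i,
      du *m k x + u x *m dk = w *m (dl *m b x + l x *m db) &
      (du *m k x + u x *m dk) *m X x + u x *m k x *m dm X x v =
        L *m (du *m k x + u x *m dk)].
Proof.
move=> uc lc kc bc Xc r /=; split; split.
- by apply: dm_supp => y; have [[]] := r y.
- by move=> i; apply: dm_unidiag => y; have [[]] := r y.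
- by apply: dm_supp => y; have [[]] := r y.
- by move=> i; apply: dm_unidiag => y; have [[]] := r y.
- rewrite -(dm_adj x v kc) -(dm_mul x v (mcl_adj kc) kc).
  rewrite (_ : (fun y => _) = (fun=> 1%:M)) ?dm_cst //.
  by apply/funext => y; have [_ []] := r y.
- by apply: dm_supp => y; have [_ [_ []]] := r y.
- by move=> i; apply: dm_real_diag => // y; have [_ [_ [_ bp] _ _]] := r y; apply: ltW.
- rewrite -(dm_mul x v uc kc) -(dm_mul x v lc bc).
  have -> : (fun y => u y *m k y) = (fun y => w *m (l y *m b y)).
    by apply/funext => y; have [_ [_ _ -> _]] := r y; rewrite mulmxA.
  rewrite (dm_mul x v (mcl_cst _ w) (mcl_mul lc bc)) dm_cst mul0mx add0r //.
rewrite -(dm_mul x v uc kc) -(dm_mul x v (mcl_mul uc kc) Xc).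
have -> : (fun y => u y *m k y *m X y) = (fun y => L *m (u y *m k y)).
  by apply/funext => y; have [_ [_ _ _ ->]] := r y.
by rewrite (dm_mul x v (mcl_cst _ L) (mcl_mul uc kc)) dm_cst mul0mx add0r.
Qed.

Section Atlas.
Variables (R : realType) (n : nat) (L : 'M[R[i]]_n).
Hypotheses (Ld : is_diag L) (Ls : simple_spectrum L).
Variable rf : realform L.
Local Notation C := R[i].
Local Notation G := (Gs rf).
Local Notation be := (blk rf).
Local Notation bmono := (@blk_mono _ _ _ rf).
Local Notation upp := (upp be).
Local Notation lwp := (lwp be).
Local Notation mdp := (mdp be).
Local Notation A0 := (rediag L).
Local Notation P0 := (L - rediag L).
Implicit Types Z X u l m k b : 'M[C]_n.

Lemma rediag_diag : supp diag_rel A0.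
Proof. by move=> i j /negPf; rewrite /diag_rel mxE => ->. Qed.

Lemma rediag_real i : (A0 i i)^* = A0 i i.
Proof. by rewrite mxE eqxx; apply/eqP; rewrite eq_complex /= oppr0 !eqxx. Qed.

Lemma imdiag_diag : supp diag_rel P0.
Proof. by apply: supp_sub2 rediag_diag; apply: is_diag_supp. Qed.

Lemma imdiag_skew : adjm P0 = - P0.
Proof.
have Pd := imdiag_diag.
apply: supp_diag_eq; [exact: diag_adj|exact: supp_opp|].
move=> i; rewrite adjmE !mxE eqxx; case: (L i i) => a b /=.
by apply/eqP; rewrite eq_complex /=; apply/andP; split; apply/eqP; ring.
Qed.

Lemma diag_br (r : rel 'I_n) (x d : 'M[C]_n) : reflexive r -> transitive r -> supp r x -> supp diag_rel d ->
  supp r (x *m d - d *m x).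
Proof.
move=> rr rt xr dd; have dr : supp r d by apply: supp_sub dd => i j /eqP ->.
by apply: supp_sub2; apply: supp_mul.
Qed.

Lemma diag_brE (x d : 'M[C]_n) i j : supp diag_rel d ->
  (x *m d - d *m x) i j = x i j * d j j - d i i * x i j.
Proof. by move=> dd; rewrite [LHS]mxE [X in _ + X]mxE supp_mul_diagE // supp_diag_mulE. Qed.

Section Chart.
Variable w : 'M[C]_n.
Hypotheses (wP : sperm w) (wG : G w).
(** The sign writes the equation l' = [w^* A w, l] as l' = [l, Q], the form in which u' = [u, P] is
    written. *)
Local Notation Q := (- (adjm w *m A0 *m w)).

Lemma Q_diag : supp diag_rel Q.
Proof.
have [s /(_ _ rediag_diag) [H _]] := sperm_adj_conj_diag wP.
exact: supp_opp.
Qed.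

Lemma gs_brQ (y : 'M[C]_n) : gs rf y -> gs rf (y *m Q - Q *m y).
Proof.
move=> yg; rewrite mulmxN mulNmx opprK addrC; apply: gs_br => //.
have wU := sperm_unitary wP.
have -> : adjm w *m A0 *m w = adjm w *m A0 *m invmx (adjm w).
  by rewrite -(unitary_inv wU) invmxK.
by apply: gs_Ad; [apply: Gs_adj|apply: gs_re].
Qed.

(* The Toda field in the coordinates Z. *)
Definition lin_field Z := (upp Z *m P0 - P0 *m upp Z) + (lwp Z *m Q - Q *m lwp Z) +
  (mdp Z *m Q - Q *m mdp Z).

Lemma lin_field_parts Z : [/\ upp (lin_field Z) = upp Z *m P0 - P0 *m upp Z,
  lwp (lin_field Z) = lwp Z *m Q - Q *m lwp Z & mdp (lin_field Z) = mdp Z *m Q - Q *m mdp Z].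
Proof.
have Pd := imdiag_diag; have Qd := Q_diag.
apply: parts_unique.
- exact: (diag_br (@bup_refl _ be) (@bup_trans _ be) (upp_supp Z) Pd).
- by move=> i; rewrite diag_brE // upp_diag mul0r mulr0 subrr.
- exact: (diag_br (@blow_refl _ be) (@blow_trans _ be) (lwp_supp Z) Qd).
- by move=> i; rewrite diag_brE // lwp_diag mul0r mulr0 subrr.
exact: (diag_br (@blk_refl _ be) (@blk_trans _ be) (@bd_blk _ _ be Z) Qd).
Qed.

Lemma lin_field_coord Z : coordspace rf Z -> coordspace rf (lin_field Z).
Proof.
move=> ZE; have [gu gl z] := ZE; have [E1 E2 E3] := lin_field_parts Z; split.
- by rewrite E1; apply: gs_br => //; apply: gs_im.
- by rewrite E2; apply: gs_brQ.
move=> i j E ij; have -> : lin_field Z i j = mdp (lin_field Z) i j by rewrite [RHS]mxE E eqxx.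
rewrite E3 diag_brE; last exact: Q_diag.
have -> : mdp Z i j = 0 by rewrite mxE E eqxx z.
by rewrite mul0r mulr0 subrr.
Qed.

Lemma lin_field_lin (a : C) (x y : 'M[C]_n) : lin_field (a *: x + y) = a *: lin_field x + lin_field y.
Proof.
have Hm : mdp (a *: x + y) = a *: mdp x + mdp y.
  by apply/matrixP => i j; rewrite !mxE; case: ifP => // _; rewrite mulr0 addr0.
have H (p q d : 'M[C]_n) : (a *: p + q) *m d - d *m (a *: p + q) =
    a *: (p *m d - d *m p) + (q *m d - d *m q).
  rewrite mulmxDl mulmxDr -scalemxAl -scalemxAr scalerBr opprD.
  by rewrite addrACA.
rewrite /lin_field upp_lin lwp_lin Hm (H _ _ P0) !(H _ _ Q).
move: (upp x *m P0 - P0 *m upp x) (upp y *m P0 - P0 *m upp y)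
  (lwp x *m Q - Q *m lwp x) (lwp y *m Q - Q *m lwp y)
  (mdp x *m Q - Q *m mdp x) (mdp y *m Q - Q *m mdp y) => p1 p2 p3 p4 p5 p6.
by apply/matrixP => i j; rewrite !mxE; ring.
Qed.

End Chart.
End Atlas.

Section ChartExists.
Variables (R : realType) (n : nat) (L : 'M[R[i]]_n).
Hypotheses (Ld : is_diag L) (Ls : simple_spectrum L).
Variable rf : realform L.
Local Notation C := R[i].
Local Notation G := (Gs rf).
Local Notation be := (blk rf).
Local Notation bmono := (@blk_mono _ _ _ rf).
Local Notation MR := ('M[R]_n * 'M[R]_n)%type.
Variables (d : nat) (e : 'I_d -> 'M[C]_n) (phi : 'M[C]_n -> 'rV[R]_d).
Hypothesis eE : forall v, coordspace rf (lincomb e v).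
Hypothesis phiK : forall v, phi (lincomb e v) = v.
Hypothesis eK : forall Z, coordspace rf Z -> lincomb e (phi Z) = Z.
Hypothesis phic : forall (T : Type) (A : set T) (K : fclass R A) (F : T -> 'M[C]_n),
  mcl K F -> forall k, K (fun x => phi (F x) 0 k).
Variable w : 'M[C]_n.
Hypotheses (wP : sperm w) (wG : G w).
Local Notation K := (smooth_class 'rV[R]_d).
Local Notation uz v := (ufac rf (lincomb e v)).
Local Notation lz v := (lfac rf (lincomb e v)).
Local Notation mz v := (mfac rf (lincomb e v)).
Local Notation Q := (- (adjm w *m rediag L *m w)).

Lemma chart_coordinates : exists A : 'M[R]_d, forall v,
  lincomb e (v *m A) = lin_field rf w (lincomb e v).
Proof.
have lE v : coordspace rf (lin_field rf w (lincomb e v)).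
  exact: (lin_field_coord Ld wP wG (eE v)).
have [|A AE] := @linear_matrix R d d (fun v => phi (lin_field rf w (lincomb e v))).
  move=> a x y; have -> : lincomb e (a *: x + y) = a%:C%C *: lincomb e x + lincomb e y.
    by rewrite lincombD lincombZ.
  rewrite lin_field_lin -[RHS]phiK; congr phi.
  apply: esym; rewrite lincombD; congr (_ + _); last exact: eK.
  by rewrite lincombZ; congr (_ *: _); apply: eK.
by exists A => v; rewrite AE eK.
Qed.

Lemma lincomb_inj0 v : lincomb e v = 0 -> v = 0.
Proof.
move=> H; rewrite -(phiK v) H -(phiK 0); congr phi.
by rewrite /lincomb big1 // => k _; rewrite mxE scale0r.
Qed.

Lemma dm_if (U : normedModType R) (p : 'I_n -> 'I_n -> bool) (F : U -> 'M[C]_n) x v :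
  dm (fun y => \matrix_(i, j) if p i j then F y i j else 0) x v =
  \matrix_(i, j) if p i j then dm F x v i j else 0.
Proof.
apply/matrixP => i j; rewrite !mxE; case E : (p i j).
  by congr dc; apply/funext => y; rewrite mxE E.
rewrite (_ : (fun y => _) = (fun=> 0)) ?dc_cst //.
by apply/funext => y; rewrite mxE E.
Qed.

Lemma dm_upp x v : dm (fun y => upp be (lincomb e y)) x v = upp be (lincomb e v).
Proof. by rewrite (dm_if (fun i j => be i < be j)%N) dm_lincomb. Qed.

Lemma dm_lwp x v : dm (fun y => lwp be (lincomb e y)) x v = lwp be (lincomb e v).
Proof. by rewrite (dm_if (fun i j => be j < be i)%N) dm_lincomb. Qed.

Lemma dm_mdp x v : dm (fun y => mdp be (lincomb e y)) x v = mdp be (lincomb e v).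
Proof. by rewrite (dm_if (fun i j => be i == be j)) dm_lincomb. Qed.

Let Zc := lincomb_smooth e.
Let uc := mcl_if (fun i j => be i < be j)%N Zc.
Let lc := mcl_if (fun i j => be j < be i)%N Zc.
Let mc := mcl_if (fun i j => be i == be j) Zc.

Lemma dm_mfac x v : dm (fun y => mz y) x v = mdp be (lincomb e v).
Proof. by rewrite (dm_add x v (mcl_cst _ _) mc) dm_cst add0r dm_mdp. Qed.

Lemma one_add_comm (z q : 'M[C]_n) :
  (1%:M + z) *m q - q *m (1%:M + z) = z *m q - q *m z.
Proof. by rewrite mulmxDr mulmxDl mul1mx mulmx1 opprD addrACA subrr add0r. Qed.

Lemma dm_fac_field x v : lincomb e v = lin_field rf w (lincomb e x) ->
  dm (fun y => uz y) x v = uz x *m (L - rediag L) - (L - rediag L) *m uz x /\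
  dm (fun y => lz y *m mz y) x v =
    (adjm w *m rediag L *m w) *m (lz x *m mz x) - (lz x *m mz x) *m (adjm w *m rediag L *m w).
Proof.
move=> vE; have [E1 E2 E3] := lin_field_parts Ld rf wP (lincomb e x).
split.
  apply: (dm_cay uc) => [y|]; first exact: upp_add_unit.
  exact: etrans (dm_upp x v) (etrans (congr1 _ vE) E1).
have dl : dm (fun y => lz y) x v = lz x *m Q - Q *m lz x.
  apply: (dm_cay lc) => [y|]; first exact: lwp_add_unit.
  exact: etrans (dm_lwp x v) (etrans (congr1 _ vE) E2).
have dz : dm (fun y => mz y) x v = mz x *m Q - Q *m mz x.
  rewrite one_add_comm; exact: etrans (dm_mfac x v) (etrans (congr1 _ vE) E3).
rewrite (dm_mul x v (mcl_lfac rf Zc) (mcl_mfac rf Zc)) dl dz.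
move: (lz x) (mz x) (adjm w *m rediag L *m w) => l m q.
rewrite !mulmxN !mulNmx !opprK mulmxDl mulmxDr !mulmxN !mulNmx !mulmxA.
move: (l *m q *m m) (q *m l *m m) (l *m m *m q) => p r s.
by apply/matrixP => i j; rewrite !mxE; ring.
Qed.

(** The derivative of the block unipotent factor has no block diagonal part, so [bd] of the
    derivative of the product isolates the in-block coordinate; then the other factor is left. *)
Lemma dm_fac_inj x v : dm (fun y => uz y) x v = 0 ->
  dm (fun y => lz y *m mz y) x v = 0 -> v = 0.
Proof.
move=> du dlm.
have du0 : upp be (lincomb e v) = 0.
  rewrite -(dm_upp x); apply: (dm_cay0 uc) => // y; exact: upp_add_unit.
move: dlm; rewrite (dm_mul x v (mcl_lfac rf Zc) (mcl_mfac rf Zc)) dm_mfac.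
set dl := dm _ x v => dlm.
have dls : supp (blow_rel be) dl by apply: dm_supp => y; apply: lfac_supp.
have dld i : dl i i = 0 by apply: dm_unidiag => y; apply: lfac_unidiag.
have bl0 : bd be dl = 0.
  apply/matrixP => i j; rewrite [LHS]mxE [RHS]mxE; case: eqVneq => // ij.
  case: (eqVneq i j) => [->//|nij]; apply: dls.
  by rewrite /blow_rel (negPf nij) ij ltnn.
have dm0 : mdp be (lincomb e v) = 0.
  have := congr1 (bd be) dlm.
  rewrite (_ : bd be 0 = 0); last by apply/matrixP => i j; rewrite !mxE if_same.
  have bdD (x1 x2 : 'M[C]_n) : bd be (x1 + x2) = bd be x1 + bd be x2.
    by apply/matrixP => i j; rewrite !mxE; case: ifP; rewrite ?addr0.
  have ms := mid_blk (mfac_supp (eE x)).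
  rewrite bdD (bd_mul_ge (low_bge bmono (blow_low bmono dls)) (blk_bge ms)) bl0 mul0mx add0r.
  by rewrite (bd_low_mul bmono (@lfac_supp _ _ _ rf _) (@lfac_unidiag _ _ _ rf _)) //; apply: bd_blk.
move: dlm; rewrite dm0 mulmx0 addr0 => dlm.
have mu : mz x \in unitmx.
  by apply: unip_low_unit; [apply: mid_low; apply: mfac_supp|apply: mfac_unidiag].
have dl0 : dl = 0 by rewrite -[dl](mulmxK mu) dlm mul0mx.
have dw0 : lwp be (lincomb e v) = 0.
  rewrite -(dm_lwp x); apply: (dm_cay0 lc) => // y; exact: lwp_add_unit.
apply: lincomb_inj0.
by rewrite -(parts_sum be (lincomb e v)) du0 dw0 dm0 !addr0.
Qed.

(** The parametrisation is global, but its inverse has no single formula: it is chosen as a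
    set-theoretic inverse, and continuity is checked on each [chart_dom_at], where eigenvector rows
    give a formula. *)
Lemma chart_exists : exists (psi : 'rV[R]_d -> MR) (phi0 : MR -> 'rV[R]_d) (A : 'M[R]_d),
  let SR := (fun X => realify X) @` Gclass rf in
  let W := chart_dom L w in
  [/\ psi @` setT = W `&` SR, (forall v, phi0 (psi v) = v) &
      {within W `&` SR, continuous phi0}] /\
  [/\ smooth_on psi setT, (forall v, injective ('d psi v)) &
      (forall v, 'd psi v (v *m A) = realify (toda (unrealify (psi v))))].
Proof.
have lmc : mcl K (fun v => lz v *m mz v).
  by apply: mcl_mul; [apply: mcl_lfac|apply: mcl_mfac].
have uzc : mcl K (fun v => uz v) by apply: mcl_ufac.
have [k [b [X [kc bc Xc rP]]]] := rep_class L wP uzc lmc (fun v _ => ul_ok (eE v)).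
have {}rP v := rP v I.
have [A AE] := chart_coordinates.
have wU := unitary_unit (sperm_unitary wP).
pose psi v := realify (X v).
have psi_inj v v' : psi v = psi v' -> v = v'.
  move=> H; have XE : X v = X v' by rewrite -[X v]realifyK -/(psi v) H realifyK.
  have r' := rP v'; rewrite -XE in r'.
  have [Eu El] := rep_unique Ld Ls wP (rP v) r'.
  by rewrite -(phiK v) -(phiK v') (fac_eq (eE v) (eE v') Eu El).
(* The inverse of [psi], with value 0 off its image. *)
pose phi0 Y : 'rV[R]_d := xget 0 [set v | psi v = Y].
have phi0K v : phi0 (psi v) = v.
  apply: psi_inj; rewrite /phi0.
  exact: (@xgetPex _ 0 [set v0 | psi v0 = psi v] (ex_intro _ v erefl)).
have psiS v : Gclass rf (X v) /\ chart_dom L w (psi v).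
  exact: (rep_in_class Ld Ls wP wG (eE v) (rP v)).
have dX v t : 'd psi v t = realify (dm X v t) by apply: realify_diff.
exists psi, phi0, A => SR W; split; split.
- apply/seteqP; split => [Y [v _ <-]|Y [WY [X0 X0S XY]]].
    by have [XS Xd] := psiS v; split=> //; exists (X v).
  rewrite -XY in WY *; have [Z [k0 [b0 [ZE r]]]] := class_in_rep Ld Ls wP wG X0S WY.
  exists (phi Z) => //; congr realify.
  have := rP (phi Z); rewrite (eK ZE) => r'.
  exact: (rep_X_unique wU r' r).
- exact: phi0K.
- apply/subspace_continuousP => Y [[a _ WY] [X0 X0S XY]].
  have Oo := @chart_dom_at_open R n L w a.
  pose Kc := continuous_class R Oo.
  pose EG Y := eigrows L a (unrealify Y) : 'M[C]_n.
  have EGc : mcl Kc EG by apply: mcl_eigrows; apply: unrealify_continuous.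
  have [u [l [uc' lc' ulP]]] := rep_of_eigvecs Ld wP EGc (fun Y H => H).
  have EGu Y1 : chart_dom_at L w a Y1 -> EG Y1 \in unitmx.
    by move=> /lead_ok_unit; rewrite unitmx_mul => /andP [].
  have ulU Y1 : chart_dom_at L w a Y1 -> [/\ supp up_rel (u Y1), unidiag (u Y1),
      supp low_rel (l Y1) & unidiag (l Y1)].
    (* The triangular shape is needed on the whole open set and not just on the class, so it is
       obtained from the matrix that has the rows of [EG Y1] as eigenvectors. *)
    move=> H; have [|k1 [b1 [r1 _]]] := ulP Y1 H (invmx (EG Y1) *m L *m EG Y1).
      by rewrite -mulmxA mulKVmx // EGu.
    exact: r1.
  pose m Y := bd be (l Y).
  have c2 : (1 + 1 : C) != 0 by rewrite -mulr2n pnatr_eq0.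
  pose lb Y := l Y *m invmx (m Y).
  have mc' : mcl Kc m by apply: mcl_if.
  have lbc : mcl Kc lb.
    apply: mcl_mul => //; apply: mcl_inv => // Y1 /ulU [_ _ ll l1].
    have [ms m1 _ _] := low_split bmono ll l1.
    exact: (unip_low_unit (mid_low ms) m1).
  (* The formula of [fac_recover], continuous on the open set and equal to the coordinate matrix on
     the class. *)
  pose Zt Y := cay (u Y) + cay (lb Y) + (m Y - 1%:M).
  have Ztc : mcl Kc Zt.
    apply: mcl_add.
      apply: mcl_add; apply: mcl_cay => // Y1 /ulU [uu u1 ll l1].
        by apply: one_add_unit u1 c2 _; left.
      have [_ _ ls l1'] := low_split bmono ll l1.
      by apply: one_add_unit l1' c2 _; right; apply: (blow_low bmono).
    by apply: mcl_add => //; apply: mcl_cst.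
  have phE Y1 : chart_dom_at L w a Y1 -> SR Y1 -> phi0 Y1 = phi (Zt Y1).
    move=> H [X1 X1S XY1]; have W1 : chart_dom L w Y1 by exists a.
    have [v vY] : exists v, psi v = Y1.
      rewrite -XY1 in W1 *; have [Z [k0 [b0 [ZE r]]]] := class_in_rep Ld Ls wP wG X1S W1.
      exists (phi Z); congr realify.
      have := rP (phi Z); rewrite (eK ZE) => r'.
      exact: (rep_X_unique wU r' r).
    have [g [gG gX]] := X1S.
    have EX : EG Y1 *m X1 = L *m EG Y1.
      rewrite /EG -XY1 realifyK; exact: (eigrows_X Ld Ls a (Gs_unit gG) gX).
    have [k1 [b1 r1]] := ulP Y1 H X1 EX.
    have XvE : X v = X1 by rewrite -[X v]realifyK -/(psi v) vY -XY1 realifyK.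
    have rv := rP v; rewrite XvE in rv.
    have [Eu El] := rep_unique Ld Ls wP rv r1.
    rewrite -{1}vY phi0K -[LHS]phiK; congr phi.
    have mE : m Y1 = mz v.
      rewrite /m -El (bd_low_mul bmono (@lfac_supp _ _ _ rf _) (@lfac_unidiag _ _ _ rf _)) //.
      by apply: mid_blk; apply: mfac_supp.
    have mu : mz v \in unitmx.
      by apply: unip_low_unit; [apply: mid_low; apply: mfac_supp|apply: mfac_unidiag].
    have lbE : l Y1 *m invmx (m Y1) = lz v by rewrite mE -El mulmxK.
    rewrite [LHS](fac_recover rf); apply: esym.
    have H3 (p q s p' q' s' : 'M[C]_n) : p = p' -> q = q' -> s = s' ->
        cay p + cay q + (s - 1%:M) = cay p' + cay q' + (s' - 1%:M).
      by move=> -> -> ->.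
    exact: (H3 _ _ _ _ _ _ (esym Eu) lbE mE).
  have pc : {for Y, continuous (fun Y => phi (Zt Y))}.
    apply: rV_continuous_at => j.
    have H := phic Ztc j; apply: (H Y WY).
  change (phi0 @ (within (W `&` SR) (nbhs Y)) --> phi0 Y).
  rewrite (phE Y WY); last by exists X0.
  move=> B nB; have nA := open_nbhs_nbhs (conj Oo WY).
  have nB' : nbhs Y (fun y => B (phi (Zt y))) := pc B nB.
  change (nbhs Y (fun y => (W `&` SR) y -> B (phi0 y))).
  apply: filterS (filterI nB' nA) => Y1 [BY1 H1] [_ S1].
  by rewrite (phE Y1 H1 S1).
- exact: realify_smooth.
- move=> v t1 t2 tE; apply/eqP; rewrite -subr_eq0; apply/eqP.
  have dX0 : dm X v (t1 - t2) = 0.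
    apply: (can_inj (@realifyK R n)); rewrite -dX linearB tE subrr.
    by congr pair; apply/matrixP => i j; rewrite !mxE.
  have [[q1 q2 q3 q4] [q5 q6 q7 q8 q9]] := rep_diff v (t1 - t2) uzc lmc kc bc Xc rP.
  rewrite dX0 mulmx0 addr0 in q9.
  have [du dl] := rep_tangent_inj Ld Ls wP (rP v) q1 q2 q3 q4 q5 q6 q7 q8 q9.
  exact: dm_fac_inj du dl.
move=> v; rewrite dX realifyK; congr realify.
have [_ [q5 q6 q7 q8 q9]] := rep_diff v (v *m A) uzc lmc kc bc Xc rP.
have [du dl] := dm_fac_field (AE v).
apply: (rep_tangent_toda Ld wP (rP v) _ (rediag_diag L) (rediag_real L) (imdiag_skew Ld)
  du dl q5 q6 q7 q8 q9).
by rewrite subrK.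
Qed.

End ChartExists.

(** * Assembly of the atlas *)

Section RealFormAtlas.
Variables (R : realType) (n : nat) (L : 'M[R[i]]_n).
Hypotheses (Ld : is_diag L) (Ls : simple_spectrum L).
Variable rf : realform L.
Local Notation C := R[i].
Local Notation G := (Gs rf).
Local Notation MR := ('M[R]_n * 'M[R]_n)%type.

Lemma realform_charts : exists (N d : nat) (psi : 'I_N -> 'rV[R]_d -> MR)
    (phi : 'I_N -> MR -> 'rV[R]_d) (W : 'I_N -> set MR) (A : 'I_N -> 'M[R]_d),
  let SR := (fun X => realify X) @` Gclass rf in
  (forall X, Gclass rf X -> exists k, W k (realify X)) /\
  forall k, open (W k) /\
    ([/\ psi k @` setT = W k `&` SR, (forall v, phi k (psi k v) = v) &
      {within W k `&` SR, continuous phi k}] /\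
     [/\ smooth_on (psi k) setT, (forall v, injective ('d (psi k) v)) &
      (forall v, 'd (psi k) v (v *m A k) = realify (toda (unrealify (psi k v))))]).
Proof.
have [d [e [phi [eE phiK eK phic]]]] := real_basis (coordspace0 rf) (@coordspace_lin _ _ _ rf).
(* Finiteness of the atlas: one chart for each signed permutation matrix in the real form. *)
pose ws := [seq wmx R p.1 p.2 | p <- enum {: {perm 'I_n} * {ffun 'I_n -> bool}} &
  `[< G (wmx R p.1 p.2) >]].
have wsP w : w \in ws -> sperm w /\ G w.
  move=> /mapP [p]; rewrite mem_filter => /andP [/asboolP pG _] ->.
  by split=> //; exists p.1, p.2.
have H (k : 'I_(size ws)) : exists t : ('rV[R]_d -> MR) * (MR -> 'rV[R]_d) * 'M[R]_d,
    let SR := (fun X => realify X) @` Gclass rf in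
    let W := chart_dom L (nth 0 ws k) in
    [/\ t.1.1 @` setT = W `&` SR, (forall v, t.1.2 (t.1.1 v) = v) &
      {within W `&` SR, continuous t.1.2}] /\
    [/\ smooth_on t.1.1 setT, (forall v, injective ('d (t.1.1) v)) &
      (forall v, 'd (t.1.1) v (v *m t.2) = realify (toda (unrealify (t.1.1 v))))].
  have [wP wG] := wsP _ (mem_nth 0 (ltn_ord k)).
  have [psi [phi0 [A HA]]] := chart_exists Ld Ls eE phiK eK phic wP wG.
  by exists (psi, phi0, A).
have [t tP] := boolp.choice H.
exists (size ws), d, (fun k => (t k).1.1), (fun k => (t k).1.2),
  (fun k => chart_dom L (nth 0 ws k)), (fun k => (t k).2) => SR; split; last first.
  by move=> k; split; [apply: chart_dom_open|apply: tP].
move=> X [g [gG gX]]; have [w [wP wG ok]] := Gs_cover gG.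
have wws : w \in ws.
  have [s [f wE]] := wP; apply/mapP; exists (s, f) => //.
  by rewrite mem_filter mem_enum andbT; apply/asboolP; rewrite /= -wE.
have kP : (index w ws < size ws)%N by rewrite index_mem.
exists (Ordinal kP); rewrite /= nth_index //.
exact/(chart_domP Ld Ls wP (Gs_unit gG) gX).
Qed.

Theorem realform_toda :
  (forall X, Gclass rf X -> tangent_to (Gclass rf) X (toda X)) /\
  linearizing_atlas (Gclass rf) (@toda R n).
Proof.
have [N [d [psi [phi [W [A [cov charts]]]]]]] := realform_charts; split; last first.
  exists N, d, psi, phi, (fun=> setT), W, A; split=> // k.
  have [Wo [[h1 h2 h3] [h4 h5 h6]]] := charts k.
  split; split; [exact: openT|exact: Wo|exact: h1| | |exact: h4| |].
  - by move=> v _; apply: h2.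
  - exact: h3.
  - by move=> v _; apply: h5.
  - by move=> v _; apply: h6.
move=> X XS; have [k Wk] := cov X XS.
have [Wo [[h1 h2 h3] [h4 h5 h6]]] := charts k.
have [v _ vX] : (psi k @` setT) (realify X) by rewrite h1; split=> //; exists X.
(* A straight line in coordinates with the velocity of the field at v; its image stays in the class
   for all t because the chart is parametrised by the whole space. *)
pose u := v *m A k; pose a (t : R) : 'rV[R]_d := v + t *: u.
have aD t : is_diff t a (fun s => s *: u).
  have H := is_diffD (is_diff_cst v t) (is_diff_scalel t u).
  have E : (0 : R -> 'rV[R]_d) + ( *:%R ^~ u) = (fun s => s *: u).
    by apply/funext => s; exact: add0r.
  rewrite -E; exact: H.
have ad t : differentiable a t by case: (aD t).
have aE t s : 'd a t s = s *: u.
  by have [_ H] := aD t; exact: (congr1 (fun h => h s) H).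
have a0 : a 0 = v by rewrite /a scale0r addr0.
exists (psi k \o a); split; [|split; [|split]].
- by move=> j; apply: (Ck_comp_affine ad aE); apply: h4.
- by rewrite /= a0.
- apply: (@filterE _ (nbhs (0 : R^o))) => t /=.
  have [_ [Y YS <-]] : (W k `&` ((fun X => realify X) @` Gclass rf)) (psi k (a t)).
    by rewrite -h1; exists (a t).
  by rewrite realifyK.
have pd : differentiable (psi k) (a 0) by have [pd _] := h4 1%N; apply: pd.
transitivity ('d (psi k) (a 0) ('d a 0 1)).
  exact: (congr1 (fun h => h 1) (diff_comp (ad 0) pd)).
by rewrite aE scale1r a0 h6 vX realifyK.
Qed.

End RealFormAtlas.

(** * Pivoting *)

Section BlockLDU.
Variables (F : fieldType) (n : nat) (be : 'I_n -> nat).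
Hypothesis bmono : forall i j : 'I_n, (i <= j)%N -> (be i <= be j)%N.
Implicit Types l m u : 'M[F]_n.

Lemma ble_bge_blk (x : 'M[F]_n) : supp (ble_rel be) x -> supp (bge_rel be) x -> supp (blk_rel be) x.
Proof.
move=> xl xg; apply: supp_sub (supp_and xl xg) => i j /= /andP [ij ji].
by rewrite /blk_rel eqn_leq; apply/andP.
Qed.

Lemma blow_inv l : supp (blow_rel be) l -> unidiag l ->
  supp (blow_rel be) (invmx l) /\ unidiag (invmx l).
Proof.
move=> ls l1; split; first by apply: supp_inv ls; [apply: blow_refl|apply: blow_trans].
exact: unidiag_low_inv (blow_low bmono ls) l1.
Qed.

Lemma bup_inv u : supp (bup_rel be) u -> unidiag u ->
  supp (bup_rel be) (invmx u) /\ unidiag (invmx u).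
Proof.
move=> ls l1; split; first by apply: supp_inv ls; [apply: bup_refl|apply: bup_trans].
exact: unidiag_up_inv (bup_up bmono ls) l1.
Qed.

(** Moving factors across gives a block lower matrix equal to a block upper one, hence block
    diagonal; [bd] then identifies m and m1. *)
Lemma bLDU_unique l m u l1 m1 u1 :
  supp (blow_rel be) l -> unidiag l -> supp (blk_rel be) m -> m \in unitmx ->
  supp (bup_rel be) u -> unidiag u ->
  supp (blow_rel be) l1 -> unidiag l1 -> supp (blk_rel be) m1 -> m1 \in unitmx ->
  supp (bup_rel be) u1 -> unidiag u1 ->
  l *m m *m u = l1 *m m1 *m u1 -> [/\ l = l1, m = m1 & u = u1].
Proof.
move=> ls ld mb mU us ud ls1 ld1 mb1 mU1 us1 ud1 E.
have lU := unip_low_unit (blow_low bmono ls) ld.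
have lU1 := unip_low_unit (blow_low bmono ls1) ld1.
have uU := unip_up_unit (bup_up bmono us) ud.
have uU1 := unip_up_unit (bup_up bmono us1) ud1.
have [lis lid] := blow_inv ls1 ld1; have [uis uid] := bup_inv us ud.
pose a := invmx l1 *m l; pose c := u1 *m invmx u.
have as_ : supp (blow_rel be) a by apply: (supp_mul (@blow_trans _ be) lis ls).
have ad : unidiag a.
  by apply: (unidiag_mul (@low_anti n)) => //; apply: (blow_low bmono).
have cs : supp (bup_rel be) c by apply: (supp_mul (@bup_trans _ be) us1 uis).
have cd : unidiag c.
  by apply: (unidiag_mul (@up_anti n)) => //; apply: (bup_up bmono).
have E2 : a *m m = m1 *m c.
  apply: (can_inj (mulKmx lU1)); apply: (can_inj (mulmxK uU)).
  by rewrite /= /a /c !mulmxA mulmxV // mul1mx E -!mulmxA mulVmx // mulmx1.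
have X1 : bd be (a *m m) = m := bd_low_mul bmono as_ ad mb.
have X2 : bd be (m1 *m c) = m1.
  rewrite bd_mul_le; [|exact: blk_ble|exact: (up_ble bmono (bup_up bmono cs))].
  by rewrite (bd_id mb1) (bd_unip (or_intror cs) cd) mulmx1.
have mm : m = m1 by rewrite -X1 E2 X2.
have Xb : supp (blk_rel be) (a *m m).
  apply: ble_bge_blk; last first.
    by apply: (supp_mul (@bge_trans _ be) _ (blk_bge mb)); apply: (low_bge bmono (blow_low bmono as_)).
  rewrite E2; apply: (supp_mul (@ble_trans _ be) (blk_ble mb1)).
  exact: (up_ble bmono (bup_up bmono cs)).
have E3 : a *m m = m by rewrite -[RHS]X1 bd_id.
have a1 : a = 1%:M by rewrite -[a](mulmxK mU) E3 mulmxV.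
have c1 : c = 1%:M by rewrite -[c](mulKmx mU1) -E2 E3 mm mulVmx.
split=> //; first by rewrite -[l](mulKVmx lU1) -/a a1 mulmx1.
by rewrite -[u1](mulmxKV uU) -/c c1 mul1mx.
Qed.

End BlockLDU.

Section Pivot.
Variables (F : fieldType) (n : nat).
Implicit Types (g : 'M[F]_n) (x y : 'cV[F]_n).

Lemma ker_unitP g : (forall y, g *m y = 0 -> y = 0) -> g \in unitmx.
Proof.
move=> H; rewrite -unitmx_tr unitmxE unitfE; apply/negP => /det0P [v v0 vE].
move/negP: v0; apply; apply/eqP; apply: trmx_inj; rewrite trmx0; apply: H.
by apply: trmx_inj; rewrite trmx_mul trmxK vE trmx0.
Qed.

Lemma unit_ker g y : g \in unitmx -> g *m y = 0 -> y = 0.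
Proof. by move=> gU E; rewrite -[y](mulKmx gU) E mulmx0. Qed.

Lemma lead_mulE k g y i : (forall j : 'I_n, (k <= j)%N -> y j 0 = 0) ->
  (lead k g *m y) i 0 = if (i < k)%N then (g *m y) i 0 else 0.
Proof.
move=> yz; case: (ltnP i k) => ik.
  rewrite !mxE; apply: eq_bigr => j _; rewrite mxE ik /=; case: (ltnP j k) => // jk.
  by rewrite yz // !mulr0.
rewrite mxE big1 // => j _; rewrite mxE ltnNge ik /=.
by case: eqVneq => [<-|_]; [rewrite yz // mulr0|rewrite mul0r].
Qed.

(** Pivoting can thus be argued with vectors instead of determinants. *)
Lemma lead_kerP k g : reflect
  (forall y, (forall j : 'I_n, (k <= j)%N -> y j 0 = 0) ->
    (forall i : 'I_n, (i < k)%N -> (g *m y) i 0 = 0) -> y = 0)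
  (lead k g \in unitmx).
Proof.
apply: (iffP idP) => [gU y yz gy|H].
  apply: (unit_ker gU); apply/matrixP => i j; rewrite ord1 lead_mulE // [RHS]mxE.
  by case: ifP => // ik; apply: gy.
apply: ker_unitP => y E.
have yz (j : 'I_n) : (k <= j)%N -> y j 0 = 0.
  move=> kj; have := congr1 (fun m : 'cV[F]_n => m j 0) E; rewrite /= !mxE (bigD1 j) //=.
  rewrite mxE ltnNge kj /= eqxx mul1r big1 ?addr0 // => a aj.
  by rewrite mxE [(j < k)%N]ltnNge kj /= eq_sym (negPf aj) mul0r.
apply: H => // i ik; have := congr1 (fun m : 'cV[F]_n => m i 0) E.
by rewrite /= lead_mulE // ik => ->; rewrite mxE.
Qed.

(** The product g x is the column of index k after elimination of the preceding ones; its nonzero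
    entries are the possible pivots. *)
Lemma pivot_vec k g (o : 'I_n) : o = k :> nat -> lead k g \in unitmx ->
  exists x, [/\ x o 0 = 1, forall j : 'I_n, (k < j)%N -> x j 0 = 0 &
    forall i : 'I_n, (i < k)%N -> (g *m x) i 0 = 0].
Proof.
move=> ok gU; pose c : 'cV[F]_n := \col_i (if (i < k)%N then g i o else 0).
pose x' := - (invmx (lead k g) *m c).
have lx : lead k g *m x' = - c by rewrite /x' mulmxN mulKVmx.
clearbody x'.
have xz (j : 'I_n) : (k <= j)%N -> x' j 0 = 0.
  move=> kj; have := congr1 (fun m : 'cV[F]_n => m j 0) lx; rewrite /= !mxE (bigD1 j) //=.
  rewrite !mxE ltnNge kj /= eqxx mul1r big1 ?addr0 => [->|a aj]; first by rewrite oppr0.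
  by rewrite mxE [(j < k)%N]ltnNge kj /= eq_sym (negPf aj) mul0r.
exists (x' + delta_mx o 0); split.
- by rewrite mxE xz ?ok // add0r mxE !eqxx.
- move=> j kj; rewrite mxE xz ?(ltnW kj) // add0r mxE -val_eqE /= ok.
  by rewrite gtn_eqF.
move=> i ik; rewrite mulmxDr mxE.
have -> : (g *m x') i 0 = - g i o.
  have := congr1 (fun m : 'cV[F]_n => m i 0) lx.
  by rewrite /= lead_mulE // ik => ->; rewrite !mxE ik.
rewrite mxE (bigD1 o) //= big1 => [|j jo]; last by rewrite mxE (negPf jo) mulr0.
by rewrite mxE !eqxx mulr1 addr0 addNr.
Qed.

(** A kernel vector y of the larger leading block is a multiple of x, since y - y_o x is killed by
    the old one; the new row, being nonzero on x, makes it vanish. *)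
Lemma pivot_step k g g2 (o i0 : 'I_n) (c : F) x : o = k :> nat ->
  lead k g \in unitmx -> x o 0 = 1 -> (forall j : 'I_n, (k < j)%N -> x j 0 = 0) ->
  (forall i : 'I_n, (i < k)%N -> (g *m x) i 0 = 0) ->
  (forall i j : 'I_n, (i < k)%N -> g2 i j = g i j) ->
  (forall j, g2 o j = c * g i0 j) -> c != 0 -> (g *m x) i0 0 != 0 ->
  lead k.+1 g2 \in unitmx.
Proof.
move=> ok gU xo xz gx g2E g2o c0 v0; apply/lead_kerP => y yz gy.
have g2r (z : 'cV[F]_n) (i : 'I_n) : (i < k)%N -> (g2 *m z) i 0 = (g *m z) i 0.
  by move=> ik; rewrite !mxE; apply: eq_bigr => j _; rewrite g2E.
have g2o' (z : 'cV[F]_n) : (g2 *m z) o 0 = c * (g *m z) i0 0.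
  by rewrite !mxE mulr_sumr; apply: eq_bigr => j _; rewrite g2o mulrA.
have yx : y = y o 0 *: x.
  apply/eqP; rewrite -subr_eq0; apply/eqP; apply: (elimT (lead_kerP k g) gU).
    move=> j; rewrite leq_eqVlt => /orP [/eqP kj|kj].
      have -> : j = o by apply/val_inj; rewrite /= ok.
      by rewrite !mxE xo mulr1 subrr.
    by rewrite !mxE (yz j kj) (xz j kj) mulr0 subr0.
  move=> i ik; rewrite mulmxBr -scalemxAr !mxE.
  have : (g *m y) i 0 = 0 by rewrite -g2r // gy // ltnS ltnW.
  have := gx i ik; rewrite !mxE => -> ->; rewrite mulr0 subr0 //.
have := gy o; rewrite ok ltnSn g2o' => /(_ isT) /eqP.
rewrite mulf_eq0 (negPf c0) /= yx -scalemxAr mxE mulf_eq0 (negPf v0) orbF => /eqP H.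
by rewrite H scale0r.
Qed.

Lemma lead_eq j k g g2 : (j <= k)%N ->
  (forall i l : 'I_n, (i < k)%N -> g2 i l = g i l) -> lead j g2 = lead j g.
Proof.
move=> jk E; apply/matrixP => i l; rewrite !mxE; case: ifP => // /andP [ij _].
by rewrite E // (leq_trans ij).
Qed.

End Pivot.

Section SwapPerm.
Variables (n : nat) (ka : 'I_n -> 'I_n).
Hypothesis kaK : involutive ka.
Variables k i0 : 'I_n.
Hypothesis ik : ka k = k <-> ka i0 = i0.

(** The exchange of k and i0 together with that of their images under [ka], so that it commutes with
    [ka]. By [ik], fixed points are exchanged with fixed points only. *)
Definition swap_fun (i : 'I_n) : 'I_n :=
  if i == k then i0 else if i == i0 then k
  else if i == ka k then ka i0 else if i == ka i0 then ka k else i.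

Lemma swap_funK : involutive swap_fun.
Proof.
move=> i; rewrite /swap_fun; have H1 := kaK k; have H2 := kaK i0.
case: (i =P k) => ?; [|case: (i =P i0) => ?; [|case: (i =P ka k) => ?; [|case: (i =P ka i0) => ?]]];
  by repeat (case: eqP => ?); intuition congruence.
Qed.

Definition swap_perm : {perm 'I_n} := perm (can_inj swap_funK).

Lemma swap_perm_k : swap_perm k = i0.
Proof. by rewrite permE /swap_fun eqxx. Qed.

Lemma swap_perm_id i : i != k -> i != i0 -> i != ka k -> i != ka i0 -> swap_perm i = i.
Proof. by rewrite permE /swap_fun => /negPf -> /negPf -> /negPf -> /negPf ->. Qed.

Lemma swap_perm_comm i : swap_perm (ka i) = ka (swap_perm i).
Proof.
rewrite !permE /swap_fun; have H1 := kaK k; have H2 := kaK i0; have H3 := kaK i.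
case: (i =P k) H3 => [->|?] H3; [|case: (i =P i0) H3 => [->|?] H3;
  [|case: (i =P ka k) => ?; [|case: (i =P ka i0) => ?]]];
  by repeat (case: eqP => ?); intuition congruence.
Qed.

Lemma swap_perm_inv (p : 'I_n -> bool) : (forall i, p (ka i) = p i) -> p k = p i0 ->
  forall i, p (swap_perm i) = p i.
Proof.
move=> pk E i; rewrite permE /swap_fun; have H1 := pk k; have H2 := pk i0.
by repeat (case: eqP => [->|?]); congruence.
Qed.

End SwapPerm.

(** * Real forms defined by an involution *)

Section Conj.
Variables (R : realType) (n : nat).
Local Notation C := R[i].
Implicit Types x y : 'M[C]_n.

Lemma conjmE x i j : conjm x i j = (x i j)^*.
Proof. by rewrite mxE. Qed.

Lemma conjmM x y : conjm (x *m y) = conjm x *m conjm y.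
Proof. exact: (map_mxM Num.conj). Qed.

Lemma conjmD x y : conjm (x + y) = conjm x + conjm y.
Proof. exact: (map_mxD Num.conj). Qed.

Lemma conjmN x : conjm (- x) = - conjm x.
Proof. exact: (map_mxN Num.conj). Qed.

Lemma conjm1 : conjm (1%:M : 'M[C]_n) = 1%:M.
Proof. exact: (map_mx1 Num.conj). Qed.

Lemma conjC_real (a : R) : (a%:C%C : C)^* = a%:C%C.
Proof. by apply/eqP; rewrite eq_complex /= oppr0 !eqxx. Qed.

End Conj.

(** * Fixed points of an antilinear automorphism *)

Section LinearType.
Variables (R : realType) (n : nat) (be : 'I_n -> nat) (L : 'M[R[i]]_n).
Local Notation C := R[i].
Hypothesis bmono : forall i j : 'I_n, (i <= j)%N -> (be i <= be j)%N.
Variables (s : {perm 'I_n}) (e : {ffun 'I_n -> bool}).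
Hypothesis sbe : forall i, be (s i) = be i.
Local Notation J := (wmx R s e).
Implicit Types x y l m u : 'M[C]_n.

Definition sig x : 'M[C]_n := J *m conjm x *m adjm J.

Lemma sigE x i j : sig x i j = (-1) ^+ e i * (x (s i) (s j))^* * (-1) ^+ e j.
Proof. by rewrite mul_adj_wmxE wmx_mulE conjmE. Qed.

Lemma sigM x y : sig (x *m y) = sig x *m sig y.
Proof.
have JU : adjm J *m J = 1%:M := wmx_unitary _ _ _.
by rewrite /sig conjmM !mulmxA -[in RHS](mulmxA _ (adjm J)) JU mulmx1.
Qed.

Lemma sigD x y : sig (x + y) = sig x + sig y.
Proof. by rewrite /sig conjmD mulmxDr mulmxDl. Qed.

Lemma sigN x : sig (- x) = - sig x.
Proof. by rewrite /sig conjmN mulmxN mulNmx. Qed.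

Lemma sig1 : sig 1%:M = 1%:M.
Proof. by rewrite /sig conjm1 mulmx1; apply: mulmx1C; apply: wmx_unitary. Qed.

Lemma sigZ (a : R) x : sig (a%:C%C *: x) = a%:C%C *: sig x.
Proof.
apply/matrixP => i j; rewrite [RHS]mxE !sigE [(_ *: x) _ _]mxE rmorphM /= conjC_real.
by rewrite [X in X * _ = _]mulrCA -[LHS]mulrA.
Qed.

Lemma sig_inv x : x \in unitmx -> sig (invmx x) = invmx (sig x).
Proof.
move=> xu; have E : sig (invmx x) *m sig x = 1%:M by rewrite -sigM mulVmx // sig1.
have [_ su] := mulmx1_unit E.
by apply: (can_inj (mulmxK su)); rewrite /= E mulVmx.
Qed.

Lemma sig_adj x : sig (adjm x) = adjm (sig x).
Proof.
apply/matrixP => i j; rewrite sigE !adjmE sigE !rmorphM !rmorphXn !rmorphN !rmorph1 /=.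
by rewrite [LHS]mulrAC [RHS]mulrAC; congr (_ * _); apply: mulrC.
Qed.

Definition GsA : set 'M[C]_n := [set x | x \in unitmx /\ sig x = x].
Definition gsA : set 'M[C]_n := [set y | sig y = y].

Lemma sig_supp (r : rel 'I_n) x : (forall i j, r (s i) (s j) = r i j) ->
  supp r x -> supp r (sig x).
Proof. by move=> rs xr i j nij; rewrite sigE xr ?rs // rmorph0 mulr0 mul0r. Qed.

Lemma sig_unidiag x : unidiag x -> unidiag (sig x).
Proof. by move=> x1 i; rewrite sigE x1 rmorph1 mulr1 -signr_addb addbb. Qed.

Lemma GsA_LDU l m u : supp (blow_rel be) l -> unidiag l ->
  supp (blk_rel be) m -> m \in unitmx -> supp (bup_rel be) u -> unidiag u ->
  GsA (l *m m *m u) -> [/\ GsA l, GsA m & GsA u].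
Proof.
move=> ls l1 mb mU us u1 [xU xE].
have lU := unip_low_unit (blow_low bmono ls) l1.
have uU := unip_up_unit (bup_up bmono us) u1.
have smU : sig m \in unitmx.
  have E : sig m *m sig (invmx m) = 1%:M by rewrite -sigM mulmxV // sig1.
  exact: (mulmx1_unit E).1.
have sls : supp (blow_rel be) (sig l).
  by apply: sig_supp ls => i j; rewrite /blow_rel (inj_eq perm_inj) !sbe.
have smb : supp (blk_rel be) (sig m) by apply: sig_supp mb => i j; rewrite /blk_rel !sbe.
have sus : supp (bup_rel be) (sig u).
  by apply: sig_supp us => i j; rewrite /bup_rel (inj_eq perm_inj) !sbe.
have H : sig l *m sig m *m sig u = l *m m *m u by rewrite -!sigM.
have [El Em Eu] := bLDU_unique bmono sls (sig_unidiag l1) smb smU sus (sig_unidiag u1)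
  ls l1 mb mU us u1 H.
by split; split.
Qed.

(** The two conditions say that the signed permutation matrix commutes with J. *)
Lemma GsA_wmx (p : {perm 'I_n}) (f : {ffun 'I_n -> bool}) :
  (forall i, p (s i) = s (p i)) -> (forall i, f (s i) = f i (+) e i (+) e (p i)) ->
  GsA (wmx R p f).
Proof.
move=> ps fs; split; first exact: unitary_unit (wmx_unitary _ _ _).
apply/matrixP => i j; rewrite sigE !mxE ps (inj_eq perm_inj).
rewrite rmorphM rmorphXn rmorphN rmorph1 /= conjC_nat fs.
case: eqVneq => [<-|_]; last by rewrite !(mulr0, mul0r).
by rewrite !mulr1 -!signr_addb; congr (_ ^+ _); case: (f i) (e i) (e (p i)) => [] [] [].
Qed.

Variables
  (pos_diag : forall m, m \in unitmx -> supp (blk_rel be) m -> GsA (adjm m *m m) ->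
    supp diag_rel (adjm m *m m))
  (mid : forall l k b, supp (mid_rel be) l -> unidiag l -> unitary k -> posup b ->
    l = k *m b -> GsA k)
  (cover : forall g, GsA g -> exists w, [/\ sperm w, GsA w & lead_ok (adjm w *m g)])
  (re : gsA (rediag L)) (im : gsA (L - rediag L)).

Lemma GsA_sqrt d : supp diag_rel d -> (forall i, 0 < d i i) -> GsA (d *m d) -> GsA d.
Proof.
move=> dd dp [_ dE]; split; first by apply: up_unit; [apply: supp_diag_up|move=> i; rewrite gt_eqF].
apply: supp_diag_eq => //.
  by apply: sig_supp dd => i j; rewrite /diag_rel (inj_eq perm_inj).
move=> i; have := congr1 (fun x : 'M[C]_n => x i i) dE.
have sgn2 (b : bool) (z : C) : (-1) ^+ b * z * (-1) ^+ b = z.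
  by rewrite mulrAC -signr_addb addbb mul1r.
rewrite /= !sigE !sgn2 !supp_diag_mulE // rmorphM /= !(geC0_conj (ltW (dp _))).
rewrite -!expr2 => /eqP; rewrite eqf_sqr => /orP [/eqP //|/eqP H].
by have := dp (s i); rewrite H oppr_gt0 => /lt_trans /(_ (dp i)); rewrite ltxx.
Qed.

Definition realformA : realform L.
Proof.
apply: (@RealForm R n L be GsA gsA bmono) => //.
- by rewrite /gsA /= -[0 in LHS](subrr (0 : 'M[C]_n)) sigD sigN subrr.
- by move=> a x y xE yE; rewrite /gsA /= sigD sigZ xE yE.
- by move=> x y xE yE; rewrite /gsA /= sigD sigN !sigM xE yE.
- by move=> x [].
- by move=> x y [xU xE] [yU yE]; split; rewrite ?unitmx_mul ?xU // sigM xE yE.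
- by move=> x [xU xE]; split; rewrite ?unitmx_inv // sig_inv // xE.
- by move=> x [xU xE]; split; rewrite ?adjm_unit // sig_adj xE.
- move=> y yE u1 u2; split; first by rewrite unitmx_mul u2 unitmx_inv.
  by rewrite /cay sigM sig_inv // !sigD sigN sig1 yE.
- by move=> x [xU xE] u1; rewrite /gsA /= /cay sigM sig_inv // !sigD sigN sig1 xE.
- by move=> x y [xU xE] yE; rewrite /gsA /= !sigM sig_inv // xE yE.
- exact: GsA_LDU.
- exact: GsA_sqrt.
Defined.

End LinearType.

(** * Isometries of a Hermitian form *)

Section UnitaryType.
Variables (R : realType) (n : nat) (be : 'I_n -> nat) (L : 'M[R[i]]_n).
Local Notation C := R[i].
Hypothesis bmono : forall i j : 'I_n, (i <= j)%N -> (be i <= be j)%N.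
Variables (s : {perm 'I_n}) (e : {ffun 'I_n -> bool}) (c : nat).
Hypothesis sbe : forall i, (be (s i) + be i = c)%N.
Hypothesis sK : involutive s.
Hypothesis es : forall i, e (s i) = e i.
Local Notation K := (wmx R s e).
Implicit Types x y l m u : 'M[C]_n.

Lemma herm_adj : adjm K = K.
Proof.
apply/matrixP => i j; rewrite adjmE !mxE rmorphM rmorphXn rmorphN rmorph1 /= conjC_nat.
rewrite (can2_eq sK sK) eq_sym.
by case: eqVneq => [<-|_]; rewrite ?mulr0 // es.
Qed.

Lemma herm_sq : K *m K = 1%:M.
Proof. by rewrite -{1}herm_adj; apply: wmx_unitary. Qed.

Definition tau x : 'M[C]_n := K *m adjm x *m K.

Lemma tauE x i j : tau x i j = (-1) ^+ e i * (x (s j) (s i))^* * (-1) ^+ e j.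
Proof. by rewrite /tau -{2}herm_adj mul_adj_wmxE wmx_mulE adjmE. Qed.

Lemma tauM x y : tau (x *m y) = tau y *m tau x.
Proof. by rewrite /tau adjmM !mulmxA -[in RHS](mulmxA _ K K) herm_sq mulmx1. Qed.

Lemma tauD x y : tau (x + y) = tau x + tau y.
Proof. by rewrite /tau adjmD mulmxDr mulmxDl. Qed.

Lemma tauN x : tau (- x) = - tau x.
Proof. by rewrite /tau adjmN mulmxN mulNmx. Qed.

Lemma tau1 : tau 1%:M = 1%:M.
Proof. by rewrite /tau adjm1 mulmx1 herm_sq. Qed.

Lemma tauZ (a : R) x : tau (a%:C%C *: x) = a%:C%C *: tau x.
Proof.
apply/matrixP => i j; rewrite [RHS]mxE !tauE [(_ *: x) _ _]mxE rmorphM /= conjC_real.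
by rewrite [X in X * _ = _]mulrCA -[LHS]mulrA.
Qed.

Lemma tau_inv x : x \in unitmx -> tau (invmx x) = invmx (tau x).
Proof.
move=> xu; have E : tau (invmx x) *m tau x = 1%:M by rewrite -tauM mulmxV // tau1.
have [_ su] := mulmx1_unit E.
by apply: (can_inj (mulmxK su)); rewrite /= E mulVmx.
Qed.

Lemma tau_adj x : tau (adjm x) = adjm (tau x).
Proof. by rewrite /tau !adjmM adjmK herm_adj mulmxA. Qed.

Definition GsB : set 'M[C]_n := [set x | tau x *m x = 1%:M].
Definition gsB : set 'M[C]_n := [set y | tau y = - y].

Lemma GsB_unit x : GsB x -> x \in unitmx.
Proof. by move=> /mulmx1_unit []. Qed.

Lemma GsB_tau x : GsB x -> tau x = invmx x.
Proof.
move=> xG; have xU := GsB_unit xG.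
by apply: (can_inj (mulmxK xU)); rewrite /= mulVmx // xG.
Qed.

Lemma tau_supp (r : rel 'I_n) x : (forall i j, r (s j) (s i) = r i j) ->
  supp r x -> supp r (tau x).
Proof. by move=> rs xr i j nij; rewrite tauE xr ?rs // rmorph0 mulr0 mul0r. Qed.

Lemma tau_unidiag x : unidiag x -> unidiag (tau x).
Proof. by move=> x1 i; rewrite tauE x1 rmorph1 mulr1 -signr_addb addbb. Qed.

Lemma be_s_lt i j : (be (s j) < be (s i))%N = (be i < be j)%N.
Proof. by have := sbe i; have := sbe j; lia. Qed.

Lemma be_s_eq i j : (be (s j) == be (s i)) = (be i == be j).
Proof. by have := sbe i; have := sbe j; lia. Qed.

(** On the group, g is the inverse of [tau g]. As the permutation reverses the order of the blocks,
    [tau] keeps l block lower and u block upper, and inversion restores the order that [tau]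
    reverses; uniqueness concludes. *)
Lemma GsB_LDU l m u : supp (blow_rel be) l -> unidiag l ->
  supp (blk_rel be) m -> m \in unitmx -> supp (bup_rel be) u -> unidiag u ->
  GsB (l *m m *m u) -> [/\ GsB l, GsB m & GsB u].
Proof.
move=> ls l1 mb mU us u1 xG.
have lU := unip_low_unit (blow_low bmono ls) l1.
have uU := unip_up_unit (bup_up bmono us) u1.
have tls : supp (blow_rel be) (tau l).
  by apply: tau_supp ls => i j; rewrite /blow_rel (inj_eq perm_inj) be_s_lt eq_sym.
have tus : supp (bup_rel be) (tau u).
  by apply: tau_supp us => i j; rewrite /bup_rel (inj_eq perm_inj) be_s_lt eq_sym.
have tmb : supp (blk_rel be) (tau m).
  by apply: tau_supp mb => i j; rewrite /blk_rel be_s_eq.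
have tmU : tau m \in unitmx.
  have E : tau m *m tau (invmx m) = 1%:M by rewrite -tauM mulVmx // tau1.
  exact: (mulmx1_unit E).1.
have tl1 := tau_unidiag l1; have tu1 := tau_unidiag u1.
have tlU := unip_low_unit (blow_low bmono tls) tl1.
have tuU := unip_up_unit (bup_up bmono tus) tu1.
have [tlis tli1] := blow_inv bmono tls tl1; have [tuis tui1] := bup_inv bmono tus tu1.
have tmiU : invmx (tau m) \in unitmx.
  by move: (tau m) tmU => q qU; rewrite unitmx_inv.
have H : l *m m *m u = invmx (tau l) *m invmx (tau m) *m invmx (tau u).
  have xU : tau (l *m m *m u) \in unitmx := (mulmx1_unit xG).1.
  apply: (can_inj (mulKmx xU)); rewrite /= xG !tauM.
  move: (tau l) (tau m) (tau u) tlU tmU tuU => p q r pU qU rU.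
  rewrite -!mulmxA (mulmxA p (invmx p)) mulmxV // mul1mx.
  by rewrite (mulmxA q (invmx q)) mulmxV // mul1mx mulmxV.
have [El Em Eu] := bLDU_unique bmono ls l1 mb mU us u1 tlis tli1 (blk_inv tmb) tmiU tuis tui1 H.
split; rewrite /GsB /=.
- by rewrite {2}El (mulmxV tlU).
- by rewrite {2}Em (mulmxV tmU).
- by rewrite {2}Eu (mulmxV tuU).
Qed.

Lemma GsB_wmx (p : {perm 'I_n}) (f : {ffun 'I_n -> bool}) :
  (forall i, p (s i) = s (p i)) -> (forall i, f (s i) = f i (+) e i (+) e (p i)) ->
  GsB (wmx R p f).
Proof.
move=> ps fs; have wU : unitary (wmx R p f) := wmx_unitary _ _ _.
have E : wmx R p f *m K = K *m wmx R p f.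
  apply/matrixP => i j; rewrite !wmx_mulE !mxE ps fs.
  case: eqVneq => [_|_]; last by rewrite !mulr0.
  by rewrite !mulr1 -!signr_addb; congr (_ ^+ _); case: (f i) (e i) (e (p i)) => [] [] [].
rewrite /GsB /= /tau -mulmxA -E mulmxA -(mulmxA K) wU mulmx1.
exact: herm_sq.
Qed.

Variables
  (pos_diag : forall m, m \in unitmx -> supp (blk_rel be) m -> GsB (adjm m *m m) ->
    supp diag_rel (adjm m *m m))
  (mid : forall l k b, supp (mid_rel be) l -> unidiag l -> unitary k -> posup b ->
    l = k *m b -> GsB k)
  (cover : forall g, GsB g -> exists w, [/\ sperm w, GsB w & lead_ok (adjm w *m g)])
  (re : gsB (rediag L)) (im : gsB (L - rediag L)).

Lemma GsB_sqrt d : supp diag_rel d -> (forall i, 0 < d i i) -> GsB (d *m d) -> GsB d.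
Proof.
move=> dd dp dE.
have td : supp diag_rel (tau d).
  by apply: tau_supp dd => i j; rewrite /diag_rel (inj_eq perm_inj) eq_sym.
apply: supp_diag_eq.
- exact: (supp_mul (@diag_trans n) td dd).
- exact: supp_scalar (@diag_refl n).
move=> i; have := congr1 (fun x : 'M[C]_n => x i i) dE.
have sgn2 (b : bool) (z : C) : (-1) ^+ b * z * (-1) ^+ b = z.
  by rewrite mulrAC -signr_addb addbb mul1r.
have t2d : supp diag_rel (tau (d *m d)).
  by rewrite tauM; apply: (supp_mul (@diag_trans n) td td).
rewrite /= (supp_diag_mulE _ _ _ t2d) (supp_diag_mulE _ _ _ td) !tauE !sgn2.
rewrite !(supp_diag_mulE _ _ _ dd) rmorphM /= (geC0_conj (ltW (dp (s i)))) [RHS]mxE eqxx.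
rewrite mxE eqxx mulrACA -expr2 => /eqP; rewrite sqrf_eq1 => /orP [/eqP //|/eqP H].
by have := mulr_gt0 (dp (s i)) (dp i); rewrite H oppr_gt0 ltr10.
Qed.

Lemma cay_factor_comm y : (1%:M - y) *m (1%:M + y) = (1%:M + y) *m (1%:M - y).
Proof.
rewrite !mulmxBr !mulmxDr !mulmxBl !mulmxDl !mulmx1 !mul1mx.
by move: (y *m y) => z; apply/matrixP => i j; rewrite !mxE; ring.
Qed.

Lemma GsB_adj x : GsB x -> GsB (adjm x).
Proof.
move=> xG; have xU := GsB_unit xG; rewrite /GsB /= tau_adj (GsB_tau xG) adjm_inv.
by rewrite mulVmx // adjm_unit.
Qed.

Definition realformB : realform L.
Proof.
apply: (@RealForm R n L be GsB gsB bmono) => //.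
- by rewrite /gsB /= oppr0 -[0 in LHS](subrr (0 : 'M[C]_n)) tauD tauN subrr.
- by move=> a x y xE yE; rewrite /gsB /= tauD tauZ xE yE scalerN opprD.
- move=> x y xE yE; rewrite /gsB /= tauD tauN !tauM xE yE !mulmxN !mulNmx !opprK opprB //.
- exact: GsB_unit.
- by move=> x y xG yG; rewrite /GsB /= tauM -mulmxA (mulmxA (tau x)) xG mul1mx.
- move=> x xG; have xU := GsB_unit xG.
  by rewrite /GsB /= tau_inv // (GsB_tau xG) invmxK mulmxV.
- exact: GsB_adj.
- move=> y yE u1 u2; rewrite /GsB /= /cay tauM tau_inv //.
  have -> : tau (1%:M + y) = 1%:M - y by rewrite tauD tau1 yE.
  have -> : tau (1%:M - y) = 1%:M + y by rewrite tauD tauN tau1 yE opprK.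
  by rewrite -mulmxA (mulmxA (1%:M + y)) -cay_factor_comm mulmxK // mulVmx.
- move=> x xG u1; have xU := GsB_unit xG; rewrite /gsB /= /cay tauM tau_inv //.
  have -> : tau (1%:M + x) = invmx x *m (1%:M + x).
    by rewrite tauD tau1 (GsB_tau xG) mulmxDr mulmx1 mulVmx // addrC.
  have -> : tau (1%:M - x) = - (invmx x *m (1%:M - x)).
    by rewrite tauD tauN tau1 (GsB_tau xG) mulmxBr mulmx1 mulVmx // opprB.
  have xiU : invmx x *m (1%:M + x) \in unitmx by rewrite unitmx_mul unitmx_inv xU.
  apply: (can_inj (mulKmx xiU)); rewrite /= mulKVmx // mulmxN; congr (- _).
  by rewrite -mulmxA (mulmxA (1%:M + x)) -cay_factor_comm mulmxK.
- move=> x y xG yE; rewrite /gsB /= !tauM tau_inv ?GsB_unit // (GsB_tau xG) invmxK yE.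
  by rewrite mulNmx mulmxN mulmxA.
- exact: GsB_LDU.
- exact: GsB_sqrt.
Defined.

End UnitaryType.

(** * Gauss elimination inside a real form *)

Section Cover.
Variables (R : realType) (n : nat).
Local Notation C := R[i].
Implicit Types g w : 'M[C]_n.

(** The pivoting matrices may be confined to a smaller set H. In the quaternionic case they have
    determinant one, which makes the sign of the determinant of g readable from the factors. *)
Lemma cover_of_steps (H G : set 'M[C]_n) : H 1%:M ->
  (forall w v, H w -> H v -> H (w *m v)) ->
  (forall w g, H w -> G g -> G (w *m g)) ->
  (forall (o : 'I_n) g, G g -> (forall j, (j <= o)%N -> lead j g \in unitmx) ->
    exists w, [/\ sperm w, H w & forall j, (j <= o.+1)%N -> lead j (w *m g) \in unitmx]) ->
  forall g, G g -> exists w, [/\ sperm w, H w & lead_ok (w *m g)].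
Proof.
move=> H1 HM HG step g gG.
suff P k : (k <= n)%N -> exists w, [/\ sperm w, H w & forall j, (j <= k)%N -> lead j (w *m g) \in unitmx].
  exact: (P n (leqnn n)).
elim: k => [_|k IH kn].
  exists 1%:M; split=> //; first exact: sperm1.
  move=> j; rewrite leqn0 => /eqP ->; rewrite mul1mx (_ : lead 0 g = 1%:M) ?unitmx1 //.
  by apply/matrixP => i l; rewrite !mxE.
have [w [wP wH wok]] := IH (ltnW kn).
have [v [vP vH vok]] := step (Ordinal kn) _ (HG _ _ wH gG) wok.
exists (v *m w); split; [exact: sperm_mul|exact: HM|].
by move=> j jk; rewrite -mulmxA; apply: vok.
Qed.

Lemma cover_adj (G : set 'M[C]_n) : (forall x, G x -> G (adjm x)) ->
  forall g, (exists w, [/\ sperm w, G w & lead_ok (w *m g)]) ->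
  exists w, [/\ sperm w, G w & lead_ok (adjm w *m g)].
Proof.
move=> Ga g [w [wP wG ok]]; exists (adjm w); split; [exact: sperm_adj|exact: Ga|].
by rewrite adjmK.
Qed.

Lemma row_step (o i0 : 'I_n) g g2 (c : C) (x : 'cV[C]_n) :
  (forall j, (j <= o)%N -> lead j g \in unitmx) ->
  x o 0 = 1 -> (forall j : 'I_n, (o < j)%N -> x j 0 = 0) ->
  (forall i : 'I_n, (i < o)%N -> (g *m x) i 0 = 0) -> (g *m x) i0 0 != 0 ->
  (forall i j : 'I_n, (i < o)%N -> g2 i j = g i j) ->
  (forall j, g2 o j = c * g i0 j) -> c != 0 ->
  forall j, (j <= o.+1)%N -> lead j g2 \in unitmx.
Proof.
move=> gok xo xz gx v0 E Eo c0 j; rewrite leq_eqVlt => /orP [/eqP ->|].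
  exact: (pivot_step (erefl (o : nat)) (gok o (leqnn o)) xo xz gx E Eo c0 v0).
rewrite ltnS => jo; have -> : lead j g2 = lead j g by apply: (lead_eq jo) => i l; apply: E.
exact: gok.
Qed.

Lemma swap_row_step (o i0 : 'I_n) g (p : {perm 'I_n}) (f : {ffun 'I_n -> bool}) (x : 'cV[C]_n) :
  (forall j, (j <= o)%N -> lead j g \in unitmx) ->
  x o 0 = 1 -> (forall j : 'I_n, (o < j)%N -> x j 0 = 0) ->
  (forall i : 'I_n, (i < o)%N -> (g *m x) i 0 = 0) -> (g *m x) i0 0 != 0 ->
  p o = i0 -> (forall i : 'I_n, (i < o)%N -> p i = i /\ f i = false) ->
  forall j, (j <= o.+1)%N -> lead j (wmx R p f *m g) \in unitmx.
Proof.
move=> gok xo xz gx v0 po pf; apply: (row_step (i0 := i0) (c := (-1) ^+ f o) gok xo xz gx v0).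
- by move=> i j io; rewrite wmx_mulE; have [-> ->] := pf i io; rewrite expr0 mul1r.
- by move=> j; rewrite wmx_mulE po.
- by rewrite signr_eq0.
Qed.

Lemma vec_neq0 g (x : 'cV[C]_n) (o : 'I_n) : g \in unitmx -> x o 0 = 1 -> g *m x != 0.
Proof.
move=> gU xo; apply/eqP => /(unit_ker gU) x0; move: xo; rewrite x0 mxE => /eqP.
by rewrite eq_sym oner_eq0.
Qed.

Lemma vec_exists (v : 'cV[C]_n) : v != 0 -> exists i, v i 0 != 0.
Proof.
move=> v0; apply/existsP; apply: contraT; rewrite negb_exists => /forallP H.
by move: v0; apply: contraNT => _; apply/eqP/matrixP => i j; rewrite ord1 mxE; apply/eqP;
  have := H i; rewrite negbK.
Qed.

End Cover.

Section ClassEq.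
Variables (R : realType) (n : nat) (L : 'M[R[i]]_n).
Hypothesis Ld : is_diag L.
Local Notation C := R[i].

(** A diagonal matrix commutes with L, so g^{-1} t conjugates L to the same matrix as g^{-1}, and t
    can be used to correct the determinant. *)
Lemma conj_class_eq (rf : realform L) (G0 : set 'M[C]_n) :
  (forall h, G0 h -> Gs rf h) ->
  (forall g, Gs rf g -> exists t, [/\ supp diag_rel t, t \in unitmx & G0 (invmx g *m t)]) ->
  conj_class G0 L = Gclass rf.
Proof.
move=> H1 H2; apply/seteqP; split => X.
  move=> [h [hG ->]]; exists (invmx h); have hG' := H1 _ hG; have hU := Gs_unit hG'.
  by split; [apply: Gs_inv|rewrite !mulmxA mulVmx // mul1mx].
move=> [g [gG gX]]; have [t [td tU tG]] := H2 _ gG; have gU := Gs_unit gG.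
exists (invmx g *m t); split=> //.
have giU : invmx g \in unitmx by rewrite unitmx_inv.
have hU : invmx g *m t \in unitmx by rewrite unitmx_mul giU.
apply: (can_inj (mulmxK hU)); rewrite /= mulmxKV // -mulmxA (diag_commute Ld td).
apply: (can_inj (mulKmx gU)); rewrite mulmxA gX -mulmxA mulKVmx //.
by rewrite mulKVmx.
Qed.

Lemma case_toda (rf : realform L) (G0 : set 'M[C]_n) : simple_spectrum L ->
  conj_class G0 L = Gclass rf ->
  (forall X, conj_class G0 L X -> tangent_to (conj_class G0 L) X (toda X)) /\
  linearizing_atlas (conj_class G0 L) (@toda R n).
Proof. by move=> Ls ->; apply: realform_toda. Qed.

End ClassEq.

(** * Real matrices *)

Section CaseReal.
Variables (R : realType) (n : nat) (L : 'M[R[i]]_n).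
Hypotheses (Ld : is_diag L) (Ls : simple_spectrum L) (Lr : real_mx L).
Local Notation C := R[i].
Local Notation s := (1%g : {perm 'I_n}).
Local Notation e := ([ffun=> false] : {ffun 'I_n -> bool}).
Local Notation be := (fun i : 'I_n => i : nat).

Lemma sig_real (x : 'M[C]_n) i j : sig s e x i j = (x i j)^*.
Proof. by rewrite sigE !ffunE !perm1 expr0 mul1r mulr1. Qed.

Lemma GsA_realP (x : 'M[C]_n) : GsA s e x <-> x \in unitmx /\ real_mx x.
Proof.
split=> -[xU xr]; split=> //; first by move=> i j; rewrite -sig_real xr.
by apply/matrixP => i j; rewrite sig_real.
Qed.

Lemma blk_id_diag (x : 'M[C]_n) : supp (blk_rel be) x -> supp diag_rel x.
Proof. by apply: supp_sub => i j /eqP ij; apply/eqP/val_inj. Qed.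

Lemma sig_of_real (x : 'M[C]_n) : real_mx x -> sig s e x = x.
Proof. by move=> xr; apply/matrixP => i j; rewrite sig_real. Qed.

Lemma real_cover (g : 'M[C]_n) : GsA s e g -> exists w, [/\ sperm w, GsA s e w & lead_ok (adjm w *m g)].
Proof.
move=> gG; apply: (@cover_adj _ _ (GsA s e)).
  by move=> x [xU xE]; split; rewrite ?adjm_unit // sig_adj xE.
apply: (@cover_of_steps _ _ (GsA s e) (GsA s e)) gG.
- by split; rewrite ?unitmx1 // sig1.
- by move=> x y [xU xE] [yU yE]; split; rewrite ?unitmx_mul ?xU // sigM xE yE.
- by move=> x y [xU xE] [yU yE]; split; rewrite ?unitmx_mul ?xU // sigM xE yE.
move=> o {}g gG gok; have [x [xo xz gx]] := pivot_vec (erefl (o : nat)) (gok o (leqnn o)).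
have [i0 v0] := vec_exists (vec_neq0 gG.1 xo).
have oi : (o <= i0)%N by rewrite leqNgt; apply: contra v0 => /gx ->.
(* For the identity as involution, [swap_perm] is an ordinary transposition. *)
have idK : involutive (id : 'I_n -> 'I_n) by [].
have ii : id o = o <-> id i0 = i0 by [].
exists (wmx R (swap_perm idK ii) [ffun=> false]); split.
- by exists (swap_perm idK ii), [ffun=> false].
- by apply: GsA_wmx => i; rewrite ?perm1 // !ffunE.
apply: (swap_row_step gok xo xz gx v0); first exact: swap_perm_k.
move=> i io; rewrite ffunE; split=> //; apply: swap_perm_id; rewrite -val_eqE /= ltn_eqF //.
- exact: leq_trans io oi.
- exact: leq_trans io oi.
Qed.

Lemma rediag_real_mx : real_mx (rediag L).
Proof.
move=> i j; rewrite mxE; case: ifP => _; [exact: conjC_real|exact: rmorph0].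
Qed.

Definition realform_real : realform L.
Proof.
apply: (@realformA R n be L _ s e).
- by [].
- by move=> i; rewrite perm1.
- move=> m mU mb _; have md := blk_id_diag mb.
  by apply: (supp_mul (@diag_trans n) (diag_adj md) md).
(* With blocks of size 1, l = 1, so k is the inverse of b and both are 1. *)
- move=> l k b ls l1 kU bP lE.
  have l_1 : l = 1%:M by apply: supp_diag_1 => //; apply: blk_id_diag; apply: mid_blk ls.
  have kE : k = invmx b by rewrite -[k](mulmxK (posup_unit bP)) -lE l_1 mul1mx.
  rewrite (_ : k = 1%:M); first by split; rewrite ?unitmx1 // sig1.
  by apply: unitary_posup1 => //; rewrite kE; apply: posup_inv.
- exact: real_cover.
- by apply: sig_of_real; apply: rediag_real_mx.
- by rewrite /gsA /= sigD sigN !sig_of_real //; apply: rediag_real_mx.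
Defined.

Lemma real_normalize (g : 'M[C]_n) : GsA s e g ->
  exists t, [/\ supp diag_rel t, t \in unitmx & SLnR n (invmx g *m t)].
Proof.
move=> /GsA_realP [gU gr].
have hr : real_mx (invmx g).
  suff /GsA_realP [] : GsA s e (invmx g) by [].
  by split; rewrite ?unitmx_inv // sig_inv // sig_of_real.
have gc : (\det g)^* = \det g.
  rewrite -(det_map_mx Num.conj); congr (\det _).
  by apply/matrixP => i j; rewrite mxE; apply: gr.
have g0 : \det g != 0 by rewrite -unitfE -unitmxE.
(* The determinant of g is placed in a single diagonal entry; real scalar matrices would not do, as
   a real number may have no real n-th root. *)
pose r : 'rV[C]_n := \row_i (if i == 0 :> nat then \det g else 1).
have [n0|n0] := posnP n.
  exists 1%:M; split; [exact: supp_scalar (@diag_refl n)|exact: unitmx1|].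
  rewrite mulmx1; split=> //; rewrite det_inv.
  move: g gU gr hr gc g0 r; rewrite n0 => g *; by rewrite det_mx00 invr1.
have dr : \det (diag_mx r) = \det g.
  rewrite det_diag (bigD1 (Ordinal n0)) //= mxE /= big1 ?mulr1 // => i i0.
  by rewrite mxE ifN //; apply: contra i0 => /eqP i0; apply/eqP/val_inj.
exists (diag_mx r); split.
- by move=> i j /negPf; rewrite /diag_rel mxE => ->.
- by rewrite unitmxE dr unitfE.
split; first by rewrite det_mulmx det_inv dr mulVf.
move=> i j; rewrite mul_mx_diag !mxE rmorphM /= hr.
by congr (_ * _); case: ifP => _ //; apply: rmorph1.
Qed.

Lemma case_i_toda :
  (forall X, conj_class (SLnR n) L X -> tangent_to (conj_class (SLnR n) L) X (toda X)) /\
  linearizing_atlas (conj_class (SLnR n) L) (@toda R n).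
Proof.
apply: (case_toda Ld Ls (conj_class_eq Ld (rf := realform_real) _ _)).
  by move=> h [h1 hr]; apply/GsA_realP; rewrite unitmxE h1 unitr1.
exact: real_normalize.
Qed.

End CaseReal.

(** * Quaternionic matrices *)

Section MidFactor.
Variables (R : realType) (n : nat) (be : 'I_n -> nat).
Local Notation C := R[i].
Hypothesis bmono : forall i j : 'I_n, (i <= j)%N -> (be i <= be j)%N.

Lemma supp_adj_sym (r : rel 'I_n) (x : 'M[C]_n) : symmetric r -> supp r x -> supp r (adjm x).
Proof. by move=> rs xr i j nij; rewrite adjmE xr ?rmorph0 // rs. Qed.

Lemma blk_sym : symmetric (blk_rel be).
Proof. by move=> i j; apply: eq_sym. Qed.

(** Since l^* l = b^* b, a block diagonal matrix, uniqueness of the block LDU factorisation makes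
    the unipotent factor of b trivial. *)
Lemma mid_factor_blk (l k b : 'M[C]_n) : supp (mid_rel be) l -> unidiag l -> unitary k ->
  posup b -> l = k *m b -> supp (blk_rel be) k /\ supp (blk_rel be) b.
Proof.
move=> ls l1 kU [bu bp] lE; have bU := posup_unit (conj bu bp).
have lb := mid_blk ls; have lU := unip_low_unit (mid_low ls) l1.
suff bb : supp (blk_rel be) b.
  split=> //; rewrite -[k](mulmxK bU) -lE.
  exact: (supp_mul (@blk_trans n be) lb (blk_inv bb)).
have [mu mU ns n1] := up_split bmono bu bU.
set m := bd be b in mu mU ns n1; set y := invmx m *m b in ns n1.
have bE : b = m *m y by rewrite /y mulKVmx.
have mb : supp (blk_rel be) m := @bd_blk _ _ be b.
clearbody y m.
have [_ _ y1] := @bLDU_unique _ n be bmono (adjm y) (adjm m *m m) y 1%:M (adjm l *m l) 1%:M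
  (ltac:(by move=> i j nij; rewrite adjmE ns ?rmorph0 //; move: nij; rewrite /blow_rel /bup_rel eq_sym))
  (unidiag_adj n1) (supp_mul (@blk_trans n be) (supp_adj_sym blk_sym mb) mb)
  (ltac:(by rewrite unitmx_mul adjm_unit mU)) ns n1
  (supp_scalar 1 (@blow_refl n be)) (ltac:(by move=> i; rewrite mxE eqxx))
  (supp_mul (@blk_trans n be) (supp_adj_sym blk_sym lb) lb)
  (ltac:(by rewrite unitmx_mul adjm_unit lU))
  (supp_scalar 1 (@bup_refl n be)) (ltac:(by move=> i; rewrite mxE eqxx))
  (ltac:(by rewrite mul1mx mulmx1 lE adjmM mulmxA -(mulmxA (adjm b)) kU mulmx1 bE adjmM !mulmxA)).
by rewrite bE y1 mulmx1.
Qed.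

Lemma det_wmx (p : {perm 'I_n}) (f : {ffun 'I_n -> bool}) :
  \det (wmx R p f) = (-1) ^+ p * \prod_i (-1) ^+ f i.
Proof.
have -> : wmx R p f = diag_mx (\row_i (-1) ^+ f i) *m perm_mx p.
  by apply/matrixP => i j; rewrite mul_diag_mx !mxE.
rewrite det_mulmx det_perm det_diag mulrC; congr (_ * _).
by apply: eq_bigr => i _; rewrite mxE.
Qed.

Lemma det_wmx_nosign (p : {perm 'I_n}) : \det (wmx R p [ffun=> false]) = (-1) ^+ p.
Proof. by rewrite det_wmx big1 ?mulr1 // => i _; rewrite ffunE. Qed.

End MidFactor.

Section Quaternion.
Variables (R : realType) (m : nat).
Local Notation C := R[i].
Local Notation n := (2 * m)%N.

Definition partner_nat (i : nat) := if odd i then i.-1 else i.+1.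

Lemma partner_lt (i : 'I_n) : (partner_nat i < n)%N.
Proof. by rewrite /partner_nat; have := ltn_ord i; case: ifP => oi; move: oi; lia. Qed.

Definition partner (i : 'I_n) : 'I_n := Ordinal (partner_lt i).

Lemma partnerE (i : 'I_n) : partner i = (if odd i then i.-1 else i.+1) :> nat.
Proof. by []. Qed.

Lemma partnerK : involutive partner.
Proof.
move=> i; apply/val_inj; rewrite /= /partner_nat.
by case: (boolP (odd i)) => oi; case: ifP; move: oi; lia.
Qed.

Definition qs : {perm 'I_n} := perm (can_inj partnerK).
(** With these signs J consists of diagonal blocks (0 1; -1 0), and x = J conj(x) J^* is the
    quaternionic condition. *)
Definition qe : {ffun 'I_n -> bool} := [ffun i : 'I_n => odd i].
Definition qbe (i : 'I_n) : nat := i./2.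

Lemma qsE i : qs i = partner i. Proof. exact: permE. Qed.

Lemma qsK : involutive qs.
Proof. by move=> i; rewrite !qsE partnerK. Qed.

Lemma odd_qs i : odd (qs i) = ~~ odd i.
Proof. by rewrite qsE partnerE; case: ifP; lia. Qed.

Lemma qs_neq i : qs i != i.
Proof. by apply/eqP => E; have := odd_qs i; rewrite E; case: (odd i). Qed.

Lemma qbe_mono (i j : 'I_n) : (i <= j)%N -> (qbe i <= qbe j)%N.
Proof. exact: half_leq. Qed.

Lemma qbe_qs i : qbe (qs i) = qbe i.
Proof. by rewrite /qbe qsE partnerE; case: ifP; lia. Qed.

Lemma qbe_eq (i j : 'I_n) : qbe i = qbe j -> j = i \/ j = qs i.
Proof.
rewrite /qbe => H; have [E|E] := boolP (odd i == odd j).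
  by left; apply/val_inj; move: H E => /=; lia.
by right; apply/val_inj; rewrite qsE /= /partner_nat; move: H E; case: ifP; lia.
Qed.

Local Notation GsQ := (GsA (R := R) qs qe).
Local Notation sq := (sig (R := R) qs qe).

Lemma sqE (x : 'M[C]_n) i j : sq x i j = (-1) ^+ odd i * (x (qs i) (qs j))^* * (-1) ^+ odd j.
Proof. by rewrite sigE !ffunE. Qed.

Lemma mxnE (x : 'M[C]_n) (i j : 'I_n) : mxn x i j = x i j.
Proof. by rewrite /mxn !valK. Qed.

Lemma quatP (x : 'M[C]_n) : quat_mx m x <-> sq x = x.
Proof.
split=> [xq|xE].
  apply/matrixP => i j; rewrite sqE.
  have ilt : (i./2 < m)%N by have := ltn_ord i; lia.
  have jlt : (j./2 < m)%N by have := ltn_ord j; lia.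
  have [E1 E2] := xq _ _ ilt jlt.
  rewrite -(mxnE x i j) -(mxnE x (qs i) (qs j)) !qsE !partnerE.
  move: E1 E2; move: (odd_double_half i) (odd_double_half j); rewrite -!mul2n.
  move: (i./2) (j./2) => k l.
  case: (odd i) => /=; case: (odd j) => /= <- <- E1 E2; rewrite /= ?add0n ?add1n /=;
    rewrite ?expr1 ?expr0 ?mul1r ?mulr1 ?mulN1r ?mulrN1 ?opprK ?E1 ?E2 ?rmorphN /= ?conjCK ?opprK //.
move=> k l km lm.
have k1 : ((2 * k).+1 < n)%N by lia.
have l1 : ((2 * l).+1 < n)%N by lia.
pose k0 := Ordinal (ltnW k1); pose l0 := Ordinal (ltnW l1).
have sk : qs (Ordinal k1) = k0 by apply/val_inj; rewrite qsE /= /partner_nat /= mul2n odd_double.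
have sl : qs (Ordinal l1) = l0 by apply/val_inj; rewrite qsE /= /partner_nat /= mul2n odd_double.
have sl0 : qs l0 = Ordinal l1 by rewrite -sl qsK.
have ol : odd l0 = false by rewrite /= mul2n odd_double.
have ok : odd k0 = false by rewrite /= mul2n odd_double.
split.
- rewrite (mxnE x (Ordinal k1) (Ordinal l1)) (mxnE x k0 l0) -{1}xE sqE sk sl /= -/(odd k0) -/(odd l0).
  by rewrite ok ol /= !expr1 mulN1r mulrN1 opprK.
- rewrite (mxnE x (Ordinal k1) l0) (mxnE x k0 (Ordinal l1)) -{1}xE sqE sk sl0 ol.
  by rewrite /= -/(odd k0) ok /= expr1 expr0 mulr1 mulN1r.
Qed.

(** A self-adjoint quaternion is real: the off-diagonal entry of a block equals both the conjugate
    of the opposite one and minus that conjugate. *)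
Lemma quat_pos_diag (M : 'M[C]_n) : M \in unitmx -> supp (blk_rel qbe) M -> GsQ (adjm M *m M) ->
  supp diag_rel (adjm M *m M).
Proof.
move=> MU Mb [_ DE].
have Db : supp (blk_rel qbe) (adjm M *m M).
  exact: (supp_mul (@blk_trans _ qbe) (supp_adj_sym (blk_sym qbe) Mb) Mb).
have Dh : adjm (adjm M *m M) = adjm M *m M by rewrite adjmM adjmK.
move: (adjm M *m M) DE Db Dh => D DE Db Dh i j.
have [/eqP/qbe_eq [->|->]|nij _] := boolP (blk_rel qbe i j); last exact: Db.
  by rewrite /diag_rel eqxx.
move=> _.
have H : D i (qs i) = - (D (qs i) i)^*.
  rewrite -{1}DE sqE qsK odd_qs; case: (odd i) => /=.
    by rewrite expr0 expr1 mulr1 mulN1r.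
  by rewrite expr0 expr1 mul1r mulrN1.
have H2 : D i (qs i) = (D (qs i) i)^* by rewrite -{1}Dh adjmE.
have : D i (qs i) = - D i (qs i) by rewrite {1}H -H2.
by move/eqP; rewrite -addr_eq0 -mulr2n mulrn_eq0 /= => /eqP.
Qed.

Lemma qblk_mulE (x y : 'M[C]_n) i j : supp (blk_rel qbe) x ->
  (x *m y) i j = x i i * y i j + x i (qs i) * y (qs i) j.
Proof.
move=> xb; rewrite mxE (bigD1 i) //= (bigD1 (qs i)) ?qs_neq //= big1 ?addr0 // => a.
move=> /andP [ai aq]; rewrite xb ?mul0r //; apply: contra_neqN ai => /eqP/qbe_eq [//|E].
by rewrite E eqxx in aq.
Qed.

Lemma qs_even (i : 'I_n) : ~~ odd i -> (i < qs i)%N.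
Proof. by rewrite qsE partnerE => /negPf ->. Qed.

Lemma qmid_factor (l c : 'M[C]_n) (i : 'I_n) : supp (mid_rel qbe) l -> unidiag l ->
  supp up_rel c -> ~~ odd i ->
  [/\ (l *m c) i i = c i i, (l *m c) i (qs i) = c i (qs i),
      (l *m c) (qs i) i = l (qs i) i * c i i &
      (l *m c) (qs i) (qs i) = l (qs i) i * c i (qs i) + c (qs i) (qs i)].
Proof.
move=> ls l1 cu /qs_even iq; have lb := mid_blk ls.
have l0 : l i (qs i) = 0 by apply: (mid_low ls); rewrite /low_rel -ltnNge.
have c0 : c (qs i) i = 0 by apply: cu; rewrite /up_rel -ltnNge.
by split; rewrite qblk_mulE // ?qsK l1 ?l0 ?c0 ?mul0r ?mulr0 ?mul1r ?add0r ?addr0 // addrC.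
Qed.

Lemma quat_blk (k : 'M[C]_n) : supp (blk_rel qbe) k ->
  (forall i : 'I_n, ~~ odd i -> k (qs i) (qs i) = (k i i)^* /\ k i (qs i) = - (k (qs i) i)^*) ->
  sq k = k.
Proof.
move=> kb H; apply/matrixP => i j; rewrite sqE.
have [/eqP/qbe_eq [->|->]|nij] := boolP (blk_rel qbe i j); last first.
- by rewrite [RHS]kb // kb ?rmorph0 ?mulr0 ?mul0r // /blk_rel !qbe_qs.
- rewrite qsK odd_qs; have [oi|oi] := boolP (odd i).
    have [_] := H (qs i) (ltac:(by rewrite odd_qs oi)); rewrite qsK => ->.
    by rewrite expr1 expr0 mulr1 mulN1r rmorphN /= conjCK opprK.
  by have [_ ->] := H i oi; rewrite expr1 expr0 mul1r mulrN1.
- have [oi|oi] := boolP (odd i).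
    have [E _] := H (qs i) (ltac:(by rewrite odd_qs oi)); rewrite qsK in E.
    by rewrite E expr1 mulN1r mulrN1 opprK.
  by have [-> _] := H i oi; rewrite expr0 mulr1 mul1r conjCK.
Qed.

(** A unitary 2 by 2 matrix of positive determinant has determinant 1, so it lies in SU(2) and is a
    unit quaternion. *)
Lemma su2_entries (a x y z d : C) : a^* = a -> 0 < d -> d = a * z - y * x ->
  a^* * a + x^* * x = 1 -> a^* * y + x^* * z = 0 -> y^* * y + z^* * z = 1 ->
  z = a^* /\ y = - x^*.
Proof.
move=> ar d0 dE; rewrite ar => E1 E2 E3.
have zE : z = d * a.
  have -> : d * a = z * (a * a + x^* * x) - x * (a * y + x^* * z) by rewrite dE; ring.
  by rewrite E1 E2 mulr1 mulr0 subr0.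
have yE : y = - (d * x^*).
  have -> : - (d * x^*) = y * (a * a + x^* * x) - a * (a * y + x^* * z) by rewrite dE; ring.
  by rewrite E1 E2 mulr1 mulr0 subr0.
have dr : d^* = d by apply/geC0_conj/ltW.
have : d ^+ 2 = 1.
  rewrite -E3 zE yE rmorphN !rmorphM /= conjCK ar dr -[LHS]mulr1 -E1; ring.
move/eqP; rewrite sqrf_eq1 => /orP [/eqP d1|/eqP d1].
  by rewrite zE yE d1 !mul1r.
by move: d0; rewrite d1 oppr_gt0 ltr10.
Qed.

(** In k = l b^{-1} the factor l is unipotent, so each 2 by 2 block of k has a positive determinant
    and [su2_entries] applies. *)
Lemma quat_mid (l k b : 'M[C]_n) : supp (mid_rel qbe) l -> unidiag l -> unitary k -> posup b ->
  l = k *m b -> GsQ k.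
Proof.
move=> ls l1 kU bP lE; have [kb _] := mid_factor_blk qbe_mono ls l1 kU bP lE.
have [cu cp] := posup_inv bP; have bU := posup_unit bP.
have kE : k = l *m invmx b by rewrite lE mulmxK.
move: (invmx b) cu cp kE => c cu cp kE.
split; first exact: unitary_unit kU.
apply: (quat_blk kb) => i oi; have [E1 E2 E3 E4] := qmid_factor ls l1 cu oi; rewrite -kE in E1 E2 E3 E4.
have ka : supp (blk_rel qbe) (adjm k) by apply: supp_adj_sym kb; apply: blk_sym.
have U (j j' : 'I_n) : (adjm k *m k) j j' = (j == j')%:R by rewrite kU mxE.
apply: (@su2_entries _ _ _ _ (c i i * c (qs i) (qs i))).
- by rewrite E1 geC0_conj // ltW.
- exact: mulr_gt0.
- by rewrite E1 E2 E3 E4; ring.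
- by have := U i i; rewrite qblk_mulE // !adjmE eqxx.
- by have := U i (qs i); rewrite qblk_mulE // !adjmE eq_sym (negPf (qs_neq i)).
- by have := U (qs i) (qs i); rewrite qblk_mulE // qsK !adjmE eqxx addrC.
Qed.

(** The antilinear map y -> J conj(y) that makes the column space a quaternionic vector space; it
    commutes with quaternionic matrices. *)
Definition jvec (y : 'cV[C]_n) : 'cV[C]_n := \col_i ((-1) ^+ odd i * (y (qs i) 0)^*).

Lemma jvec_mul (g : 'M[C]_n) y : sq g = g -> g *m jvec y = jvec (g *m y).
Proof.
move=> gE; apply/matrixP => i j; rewrite ord1 [RHS]mxE [LHS]mxE [(g *m y) _ _]mxE rmorph_sum mulr_sumr.
rewrite (reindex_inj (@perm_inj _ qs)); apply: eq_bigr => a _.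
rewrite -{1}gE sqE qsK mxE qsK rmorphM /= mulrA -[X in X * _ = _]mulrA -signr_addb addbb mulr1.
by rewrite mulrA.
Qed.

Lemma quat_odd_step (o : 'I_n) (g : 'M[C]_n) : odd o -> sq g = g ->
  (forall j, (j <= o)%N -> lead j g \in unitmx) -> lead o.+1 g \in unitmx.
Proof.
move=> oo gE gok; apply/lead_kerP => y yz gy.
have qo : qs o = o.-1 :> nat by rewrite qsE partnerE oo.
have qlt (i : 'I_n) : (i < o.+1)%N -> (qs i < o.+1)%N.
  by rewrite qsE partnerE; case: ifP; move: oo; lia.
have jz (j : 'I_n) : (o < j)%N -> jvec y j 0 = 0.
  move=> oj; rewrite mxE yz ?rmorph0 ?mulr0 //.
  by rewrite ltnNge; apply/negP; rewrite -ltnS => /qlt; rewrite qsK ltnS leqNgt oj.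
have gj (i : 'I_n) : (i < o.+1)%N -> (g *m jvec y) i 0 = 0.
  by move=> io; rewrite jvec_mul // mxE gy ?rmorph0 ?mulr0 //; apply: qlt.
(* The combination whose coordinate o vanishes, so that the smaller minor forces z = 0; its
   coordinate [qs o] is the sum of the squared moduli of both coordinates of y. *)
pose z := (y (qs o) 0)^* *: y + y o 0 *: jvec y.
have jo : jvec y o 0 = - (y (qs o) 0)^* by rewrite mxE oo mulN1r.
have jq : jvec y (qs o) 0 = (y o 0)^* by rewrite mxE odd_qs oo qsK mul1r.
have z0 : z = 0.
  apply: (elimT (lead_kerP o g) (gok o (leqnn o))).
    move=> j; rewrite leq_eqVlt => /orP [/eqP/val_inj <-|oj].
      by rewrite !mxE -/(jvec y o 0) oo mulN1r mulrN [X in X - _]mulrC subrr.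
    by rewrite mxE [(_ *: y) _ _]mxE [(_ *: jvec y) _ _]mxE (jz j oj) (yz j oj) !mulr0 addr0.
  move=> i io; rewrite mulmxDr -!scalemxAr mxE [(_ *: (g *m y)) _ _]mxE [(_ *: (g *m jvec y)) _ _]mxE.
  by rewrite (gj i (ltnW io)) (gy i (ltnW io)) !mulr0 addr0.
have yo : y o 0 = 0.
  have := congr1 (fun v : 'cV[C]_n => v (qs o) 0) z0.
  rewrite /= mxE [(_ *: y) _ _]mxE [(_ *: jvec y) _ _]mxE [RHS]mxE jq => /eqP.
  rewrite [X in X + _]mulrC -!normCK paddr_eq0 ?exprn_ge0 // => /andP [_].
  by rewrite expf_eq0 normr_eq0 => /andP [_ /eqP].
apply: (elimT (lead_kerP o g) (gok o (leqnn o))).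
  by move=> j; rewrite leq_eqVlt => /orP [/eqP/val_inj <-|oj] //; apply: yz.
by move=> i io; apply: gy; apply: ltnW.
Qed.

Lemma qs_fix (i j : 'I_n) : qs i = i <-> qs j = j.
Proof. by split=> /eqP; rewrite (negPf (qs_neq _)). Qed.

Definition qswap (o i : 'I_n) : {perm 'I_n} := swap_perm qsK (qs_fix o i).

Lemma odd_neq (i j : 'I_n) : odd i != odd j -> i != j.
Proof. by apply: contra => /eqP ->. Qed.

(** Exchanging two blocks is an even permutation, so no signs are needed for determinant one. *)
Lemma qswapE (o i : 'I_n) : odd o = odd i ->
  qswap o i = (tperm o i * tperm (qs o) (qs i))%g.
Proof.
move=> oi; apply/permP => j; rewrite permM permE /swap_fun.
have H1 : qs o != i by apply: odd_neq; rewrite odd_qs oi; case: (odd i).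
have H2 : qs i != i := qs_neq i.
have H3 : qs o != o := qs_neq o.
have H4 : qs i != o by apply: odd_neq; rewrite odd_qs oi; case: (odd i).
case: (eqVneq j o) => [->|jo]; first by rewrite tpermL tpermD.
case: (eqVneq j i) => [->|ji]; first by rewrite tpermR tpermD.
rewrite (tpermD (z := j)) 1?eq_sym //.
case: (eqVneq j (qs o)) => [->|jqo]; first by rewrite tpermL.
case: (eqVneq j (qs i)) => [->|jqi]; first by rewrite tpermR.
by rewrite tpermD 1?eq_sym.
Qed.

Lemma det_qswap (o i : 'I_n) : odd o = odd i -> \det (wmx R (qswap o i) [ffun=> false]) = 1.
Proof.
move=> oi; rewrite det_wmx_nosign qswapE // odd_permM !odd_tperm (inj_eq perm_inj).
by case: (o != i).
Qed.

Lemma GsQ_qswap (o i : 'I_n) : odd o = odd i -> GsQ (wmx R (qswap o i) [ffun=> false]).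
Proof.
move=> oi; apply: GsA_wmx => j; first exact: swap_perm_comm.
rewrite !ffunE; suff -> : odd (qswap o i j) = odd j by case: (odd j).
rewrite permE /swap_fun; have H := odd_qs.
by repeat (case: eqP => [->|?]); rewrite ?odd_qs ?oi.
Qed.

(** This is multiplication by a unit quaternion, with block (0 1; -1 0) for even o, which brings the
    second row of a block to the first place. *)
Lemma det_qflip (o : 'I_n) :
  \det (wmx R (tperm o (qs o)) [ffun i => i == qs o]) = 1.
Proof.
rewrite det_wmx odd_tperm eq_sym qs_neq expr1 (bigD1 (qs o)) //= ffunE eqxx expr1.
rewrite big1 ?mulr1 ?mulrNN ?mulr1 // => i /negPf io; by rewrite ffunE io.
Qed.

Lemma GsQ_qflip (o : 'I_n) : ~~ odd o ->
  GsQ (wmx R (tperm o (qs o)) [ffun i => i == qs o]).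
Proof.
move=> oo; have qo := qs_neq o; apply: GsA_wmx => i; last first.
  rewrite !ffunE (inj_eq perm_inj).
  case: tpermP => [->|->|/eqP io /eqP iq].
  - by rewrite eqxx eq_sym (negPf qo) odd_qs oo (negPf oo).
  - by rewrite eqxx (negPf qo) odd_qs oo (negPf oo).
  - by rewrite (negPf io) (negPf iq); case: (odd i).
case: (tpermP o (qs o) i) => [->|->|/eqP io /eqP iq]; rewrite ?qsK ?tpermL ?tpermR //.
by rewrite tpermD // eq_sym; [rewrite (can2_eq qsK qsK)|rewrite (inj_eq perm_inj)].
Qed.

Definition GsQ1 : set 'M[C]_n := [set w | GsQ w /\ \det w = 1].

Lemma quat_step (o : 'I_n) (g : 'M[C]_n) : GsQ g ->
  (forall j, (j <= o)%N -> lead j g \in unitmx) ->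
  exists w, [/\ sperm w, GsQ1 w & forall j, (j <= o.+1)%N -> lead j (w *m g) \in unitmx].
Proof.
move=> gG gok; have [oo|oo] := boolP (odd o).
  exists 1%:M; split; first exact: sperm1.
    by split; [split; rewrite ?unitmx1 ?sig1|rewrite det1].
  move=> j; rewrite mul1mx leq_eqVlt => /orP [/eqP ->|/gok //].
  by apply: quat_odd_step => //; case: gG.
have [x [xo xz gx]] := pivot_vec (erefl (o : nat)) (gok o (leqnn o)).
have [i0 v0] := vec_exists (vec_neq0 gG.1 xo).
have oi : (o <= i0)%N by rewrite leqNgt; apply: contra v0 => /gx ->.
have oq (i : 'I_n) : (o <= i)%N -> (o <= qs i)%N.
  by rewrite qsE partnerE; case: ifP; move: oo; lia.
have lt_neq (i j : 'I_n) : (i < o)%N -> (o <= j)%N -> i != j.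
  by move=> io oj; rewrite -val_eqE /= ltn_eqF // (leq_trans io oj).
have swid (i1 i : 'I_n) : (o <= i1)%N -> (i < o)%N -> qswap o i1 i = i.
  by move=> oi1 io; apply: swap_perm_id; apply: lt_neq => //; apply: oq.
have [oi0|oi0] := boolP (odd i0); last first.
  have E : odd o = odd i0 by rewrite (negPf oo) (negPf oi0).
  exists (wmx R (qswap o i0) [ffun=> false]); split; first by exists (qswap o i0), [ffun=> false].
    by split; [apply: GsQ_qswap|apply: det_qswap].
  apply: (swap_row_step gok xo xz gx v0); first exact: swap_perm_k.
  by move=> i io; rewrite ffunE swid.
(* The pivot lies in the second row of its block: exchange the blocks, then flip the rows inside the
   block of o. *)
have E : odd o = odd (qs i0) by rewrite odd_qs (negPf oo) oi0.
exists (wmx R (tperm o (qs o)) [ffun i => i == qs o] *m wmx R (qswap o (qs i0)) [ffun=> false]).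
split.
- apply: sperm_mul; first by exists (tperm o (qs o)), [ffun i => i == qs o].
  by exists (qswap o (qs i0)), [ffun=> false].
- have [h1 h2] := GsQ_qflip oo; have [h3 h4] := GsQ_qswap E.
  split; last by rewrite det_mulmx det_qflip det_qswap // mulr1.
  by split; [rewrite unitmx_mul h1 h3|rewrite sigM h2 h4].
rewrite -mulmxA; apply: (row_step (i0 := i0) (c := 1) gok xo xz gx v0).
- move=> i j io; rewrite !wmx_mulE !ffunE (negPf (lt_neq _ _ io (oq _ (leqnn o)))) expr0 !mul1r.
  have -> : tperm o (qs o) i = i.
    by rewrite tpermD // eq_sym; apply: lt_neq => //; apply: oq.
  by rewrite swid // oq.
- move=> j; rewrite !wmx_mulE !ffunE tpermL eq_sym (negPf (qs_neq o)) expr0 !mul1r.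
  by rewrite -[qswap o (qs i0) (qs o)]/(swap_perm qsK (qs_fix o (qs i0)) (qs o)) swap_perm_comm
    swap_perm_k qsK.
- exact: oner_neq0.
Qed.

Lemma quat_cover1 (g : 'M[C]_n) : GsQ g -> exists w, [/\ sperm w, GsQ1 w & lead_ok (w *m g)].
Proof.
move=> gG; apply: (@cover_of_steps _ _ GsQ1 GsQ) gG.
- by split; [split; rewrite ?unitmx1 ?sig1|rewrite det1].
- move=> x y [[xU xE] x1] [[yU yE] y1].
  by split; [split; rewrite ?unitmx_mul ?xU // sigM xE yE|rewrite det_mulmx x1 y1 mulr1].
- by move=> x y [[xU xE] x1] [yU yE]; split; rewrite ?unitmx_mul ?xU // sigM xE yE.
- exact: quat_step.
Qed.

(** Up to w of determinant one, g has a block LDU factorisation whose block part is quaternionic,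
    and a 2 by 2 quaternion block has determinant |a|^2 + |b|^2. *)
Lemma quat_det_gt0 (g : 'M[C]_n) : GsQ g -> 0 < \det g.
Proof.
move=> gG; have [w [_ [[wU wE] w1] ok]] := quat_cover1 gG.
have [l [r [ll l1 ru rU E]]] := LU_exists ok.
have [a1 a2 a3 a4] := low_split qbe_mono ll l1.
have [b1 b2 b3 b4] := up_split qbe_mono ru rU.
have lb := mid_blk a1; have lU := unip_low_unit (mid_low a1) a2.
have rb : supp (blk_rel qbe) (bd qbe r) := @bd_blk _ _ qbe r.
have gG' : GsQ (w *m g) by case: gG => gU gE; split; rewrite ?unitmx_mul ?wU // sigM wE gE.
have EE : l *m invmx (bd qbe l) *m (bd qbe l *m bd qbe r) *m (invmx (bd qbe r) *m r) = w *m g.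
  by rewrite -[LHS]mulmxA -(mulmxA (bd qbe l)) (mulKVmx b2) mulmxA mulmxKV.
rewrite -EE in gG'.
have mU : bd qbe l *m bd qbe r \in unitmx by rewrite unitmx_mul lU.
have [_ [MU ME] _] := GsA_LDU qbe_mono qbe_qs a3 a4 (supp_mul (@blk_trans _ qbe) lb rb) mU b3 b4 gG'.
have -> : \det g = \det (w *m g) by rewrite det_mulmx w1 mul1r.
rewrite E det_mulmx (det_low ll) (det_up ru) [X in X * _]big1 ?mul1r //.
(* The diagonal product is grouped into pairs, one for each 2 by 2 block. *)
rewrite (bigID (fun i : 'I_n => odd i)) /= (reindex_inj (@perm_inj _ qs)) /=.
rewrite (eq_bigl (fun i : 'I_n => ~~ odd i)); last by move=> i; rewrite /= odd_qs.
rewrite -big_split /=; apply: prodr_gt0 => i oi.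
have [E1 E2 E3 E4] := qmid_factor a1 a2 b1 oi.
move: (bd qbe l *m bd qbe r) E1 E2 E3 E4 MU ME => M E1 E2 E3 E4 MU ME.
have D : r (qs i) (qs i) * r i i = M i i * M (qs i) (qs i) - M i (qs i) * M (qs i) i.
  by rewrite E1 E2 E3 E4 !bd_diag; ring.
have D0 : r (qs i) (qs i) * r i i != 0.
  move: rU; rewrite unitmxE (det_up ru) unitfE => /prodf_neq0 H.
  by rewrite mulf_neq0 ?H.
move: D D0 => ->.
have -> : M (qs i) (qs i) = (M i i)^*.
  by rewrite -{1}ME sqE qsK odd_qs oi expr1 mulN1r mulrN1 opprK.
have -> : M i (qs i) = - (M (qs i) i)^*.
  by rewrite -{1}ME sqE qsK odd_qs oi (negPf oi) expr1 expr0 mul1r mulrN1.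
rewrite mulNr opprK [X in _ + X]mulrC -!normCK lt_def => -> /=.
by apply: addr_ge0; apply: exprn_ge0.
Qed.

End Quaternion.

Section CaseQuat.
Variables (R : realType) (m : nat) (L : 'M[R[i]]_(2 * m)).
Local Notation C := R[i].
Local Notation n := (2 * m)%N.
Hypotheses (Ld : is_diag L) (Ls : simple_spectrum L) (Lq : quat_mx m L).
Local Notation GsQ := (GsA (R := R) (qs m) (qe m)).

Lemma rediag_quat : sig (qs m) (qe m) (rediag L) = rediag L.
Proof.
have /quatP LE := Lq; apply/matrixP => i j; rewrite sqE !mxE (inj_eq perm_inj).
case: (eqVneq i j) => [<-|_]; last by rewrite rmorph0 mulr0 mul0r.
rewrite conjC_real mulrAC -signr_addb addbb mul1r; congr (_%:C%C).
by rewrite -{2}LE sqE mulrAC -signr_addb addbb mul1r; case: (L _ _).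
Qed.

Lemma quat_cover (g : 'M[C]_n) : GsQ g -> exists w, [/\ sperm w, GsQ w & lead_ok (adjm w *m g)].
Proof.
move=> gG; apply: (@cover_adj _ _ GsQ).
  by move=> x [xU xE]; split; rewrite ?adjm_unit // sig_adj xE.
by have [w [wP [wG _] ok]] := quat_cover1 gG; exists w.
Qed.

Definition realform_quat : realform L.
Proof.
apply: (@realformA R n (@qbe m) L (@qbe_mono m) (qs m) (qe m) (@qbe_qs m)).
- exact: quat_pos_diag.
- exact: quat_mid.
- exact: quat_cover.
- exact: rediag_quat.
- by have /quatP LE := Lq; rewrite /gsA /= sigD sigN LE rediag_quat.
Defined.

(** The determinant is positive, so it has a positive n-th root, and real scalars are
    quaternionic. *)
Lemma quat_normalize (g : 'M[C]_n) : GsQ g ->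
  exists t, [/\ supp diag_rel t, t \in unitmx & SLH n m (invmx g *m t)].
Proof.
move=> gG; have d0 := quat_det_gt0 gG; have [gU gE] := gG.
pose c := n.-root (\det g); have [m0|m0] := posnP m.
  exists 1%:M; split; [exact: supp_scalar (@diag_refl n)|exact: unitmx1|].
  rewrite mulmx1; split; last by move=> k l km; exfalso; move: km; rewrite m0.
  by move: (invmx g) => h; move: h; rewrite m0 => h; apply: det_mx00.
have n0 : (0 < n)%N by lia.
have c0 : 0 < c by rewrite rootC_gt0.
have cn : c ^+ n = \det g by apply: rootCK.
exists c%:M; split; first exact: supp_scalar (@diag_refl n).
  by rewrite unitmxE det_scalar unitfE expf_neq0 // gt_eqF.
split; first by rewrite det_mulmx det_inv det_scalar cn mulVf // gt_eqF.
apply/quatP; rewrite sigM sig_inv // gE; congr (_ *m _).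
apply/matrixP => i j; rewrite sqE !mxE (inj_eq perm_inj).
case: (eqVneq i j) => [<-|_]; last by rewrite rmorph0 mulr0 mul0r.
by rewrite !mulr1n (geC0_conj (ltW c0)) mulrAC -signr_addb addbb mul1r.
Qed.

Lemma case_ii_toda :
  (forall X, conj_class (SLH n m) L X -> tangent_to (conj_class (SLH n m) L) X (toda X)) /\
  linearizing_atlas (conj_class (SLH n m) L) (@toda R n).
Proof.
apply: (case_toda Ld Ls (conj_class_eq Ld (rf := realform_quat) _ _)).
  by move=> h [h1 /quatP hq]; split=> //; rewrite unitmxE h1 unitr1.
exact: quat_normalize.
Qed.

End CaseQuat.

(** * Pseudo-unitary matrices *)

Section Isotropic.
Variables (R : realType) (n : nat).
Local Notation C := R[i].

Lemma adj_sum_eq0 (x y : 'M[C]_n) : adjm x *m x + adjm y *m y = 0 -> x = 0.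
Proof.
move=> E; apply/matrixP => i j.
have nn (z : 'M[C]_n) a : (z a j)^* * z a j >= 0 by rewrite mulrC -normCK exprn_ge0.
have := congr1 (fun m : 'M[C]_n => m j j) E; rewrite /= !mxE.
rewrite (eq_bigr (fun a => (x a j)^* * x a j)); last by move=> a _; rewrite adjmE.
rewrite [X in _ + X](eq_bigr (fun a => (y a j)^* * y a j)); last by move=> a _; rewrite adjmE.
move/eqP; rewrite paddr_eq0 ?sumr_ge0 // => /andP [+ _].
rewrite psumr_eq0 // => /allP /(_ i (mem_index_enum _)) /=.
by rewrite mulrC -normCK expf_eq0 normr_eq0 => /andP [_ /eqP].
Qed.

Lemma lead_adj k (g : 'M[C]_n) : lead k (adjm g) = adjm (lead k g).
Proof.
apply/matrixP => i j; rewrite adjmE !mxE andbC.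
by case: ifP => _; rewrite ?adjmE // rmorph_nat eq_sym.
Qed.

Lemma swap_funxx (ka : 'I_n -> 'I_n) (k i : 'I_n) : swap_fun ka k k i = i.
Proof. by rewrite /swap_fun; repeat (case: eqP => [->|?]). Qed.

Definition vherm (K : 'M[C]_n) (y z : 'cV[C]_n) : C := ((map_mx Num.conj y)^T *m (K *m z)) 0 0.

Lemma vherm_mul (K g : 'M[C]_n) y z : adjm g *m K *m g = K ->
  vherm K (g *m y) (g *m z) = vherm K y z.
Proof.
move=> E; rewrite /vherm map_mxM trmx_mul -[(map_mx _ g)^T]/(adjm g).
congr (fun_of_matrix _ 0 0); rewrite -[LHS]mulmxA; congr (_ *m _).
by rewrite (mulmxA K) (mulmxA (adjm g)) (mulmxA (adjm g)) E.
Qed.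

Lemma form_transport (d J K h : 'M[C]_n) : unitary d -> d *m J *m adjm d = K ->
  adjm h *m J *m h = J ->
  adjm (d *m h *m adjm d) *m K *m (d *m h *m adjm d) = K /\ adjm d *m K *m d = J.
Proof.
move=> du <- hJ; split; last by rewrite !mulmxA du mul1mx -mulmxA du mulmx1.
rewrite -{2}hJ !adjmM adjmK !mulmxA -(mulmxA _ (adjm d) d) du mulmx1.
by rewrite -(mulmxA _ (adjm d) d) du mulmx1.
Qed.

End Isotropic.

Section PseudoUnitary.
Variables (R : realType) (p q : nat).
Hypothesis qp : (q <= p)%N.
Local Notation C := R[i].
Local Notation n := (p + q)%N.

Definition mirror_nat (i : nat) := if (q <= i < p)%N then i else (n - 1 - i)%N.

Lemma mirror_lt (i : 'I_n) : (mirror_nat i < n)%N.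
Proof. by rewrite /mirror_nat; have := ltn_ord i; case: ifP; lia. Qed.

Definition mirror (i : 'I_n) : 'I_n := Ordinal (mirror_lt i).

Lemma mirrorK : involutive mirror.
Proof.
move=> i; apply/val_inj; have := ltn_ord i.
by rewrite /= /mirror_nat; case: (boolP (q <= i < p)%N) => H1; case: ifP; move: H1; lia.
Qed.

Definition us : {perm 'I_n} := perm (can_inj mirrorK).
(** K is -1 on the central block and has ones on the antidiagonal outside it, a part of signature
    (q, q); altogether p negative and q positive squares. *)
Definition ue : {ffun 'I_n -> bool} := [ffun i : 'I_n => (q <= i < p)%N].
(** The central block has number q, and the numbers of mirrored indices add up to 2q. *)
Definition ube (i : 'I_n) : nat :=
  if (i < q)%N then i : nat else if (i < p)%N then q else (i - p + q).+1.

Lemma usE i : us i = mirror i. Proof. exact: permE. Qed.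
Lemma us_val (i : 'I_n) : us i = (if (q <= i < p)%N then i : nat else n - 1 - i)%N :> nat.
Proof. by rewrite usE. Qed.

Lemma ueE (i : 'I_n) : ue i = (q <= i < p)%N. Proof. exact: ffunE. Qed.

Lemma usK : involutive us.
Proof. by move=> i; rewrite !usE mirrorK. Qed.

Lemma us_mid (i : 'I_n) : ue i -> us i = i.
Proof. by rewrite ueE => H; apply: ord_inj; rewrite us_val H. Qed.

Lemma ue_us (i : 'I_n) : ue (us i) = ue i.
Proof.
have := us_val i; have := ltn_ord i; rewrite !ueE; case: (boolP (q <= i < p)%N) => H1 H2 ->.
  exact: H1.
by move: H1; lia.
Qed.

Lemma ube_mono (i j : 'I_n) : (i <= j)%N -> (ube i <= ube j)%N.
Proof. by rewrite /ube; repeat case: ifP; lia. Qed.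

Lemma ube_us (i : 'I_n) : (ube (us i) + ube i = q + q)%N.
Proof.
have := ltn_ord i; rewrite /ube us_val; case: (boolP (q <= i < p)%N) => H;
  by repeat case: ifP; move: H; lia.
Qed.

Lemma ube_eq (i j : 'I_n) : ube i = ube j -> i = j \/ ue i /\ ue j.
Proof.
rewrite /ube !ueE => H; have [E|nE] := eqVneq (i : nat) j; first by left; apply/val_inj.
by right; move: H nE; repeat case: ifP; lia.
Qed.

Lemma ube_ue (i j : 'I_n) : ube i = ube j -> ue i = ue j.
Proof. by move/ube_eq => [->|[-> ->]]. Qed.

Local Notation GsU := (GsB (R := R) us ue).
Local Notation tu := (tau (R := R) us ue).
Local Notation K := (wmx R us ue).

Lemma tuE (x : 'M[C]_n) i j : tu x i j = (-1) ^+ ue i * (x (us j) (us i))^* * (-1) ^+ ue j.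
Proof. exact: (tauE usK ue_us). Qed.

Lemma KK : K *m K = 1%:M.
Proof. exact: (herm_sq R usK ue_us). Qed.

Lemma GsUP (g : 'M[C]_n) : GsU g <-> adjm g *m K *m g = K.
Proof.
rewrite /GsB /= /tau; split=> H.
  by rewrite -[RHS]mulmx1 -H !mulmxA KK mul1mx.
by rewrite -(mulmxA K) -(mulmxA K) H KK.
Qed.

(** On the central block the form is definite, so D = M^* M satisfies D^2 = 1 there; the eigenvalue
    -1 is excluded by positivity, hence D = 1 on that block. *)
Lemma pu_pos_diag (M : 'M[C]_n) : M \in unitmx -> supp (blk_rel ube) M -> GsU (adjm M *m M) ->
  supp diag_rel (adjm M *m M).
Proof.
move=> MU Mb DG.
have Db : supp (blk_rel ube) (adjm M *m M).
  exact: (supp_mul (@blk_trans _ ube) (supp_adj_sym (blk_sym ube) Mb) Mb).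
have Dh : adjm (adjm M *m M) = adjm M *m M by rewrite adjmM adjmK.
pose P : 'M[C]_n := \matrix_(i, j) (if (i == j) && ue i then 1 else 0).
have PE (x : 'M[C]_n) i j : (x *m P) i j = if ue j then x i j else 0.
  rewrite mxE (bigD1 j) //= big1 ?addr0 => [|k kj]; last by rewrite mxE (negPf kj) mulr0.
  by rewrite mxE eqxx /=; case: (ue j); rewrite ?mulr1 ?mulr0.
pose D := adjm M *m M; rewrite -/D in DG Db Dh.
have DE : adjm M *m M = D by []; have PP : P = \matrix_(i,
  j) (if (i == j) && ue i then 1 else 0) by []; clearbody D P.
have tD : tu D *m P = D *m P.
  apply/matrixP => i j; rewrite !PE tuE; case: ifP => // uj; rewrite (us_mid uj) uj.
  have [ui|ui] := boolP (ue i).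
    by rewrite (us_mid ui) expr1 mulN1r mulrN1 opprK -adjmE Dh.
  have nb k : ue k = ue i -> ~~ blk_rel ube k j.
    by move=> ki; apply/negP => /eqP/ube_ue; rewrite ki uj (negPf ui).
  rewrite [RHS]Db ?nb // [D j _]Db ?rmorph0 ?mulr0 ?mul0r //.
  by rewrite blk_sym nb // ue_us.
have DP : D *m (D *m P) = P by rewrite -tD mulmxA (mulmx1C DG) mul1mx.
(* Here D Y = -Y, so the sum of Y^* Y and Y^* D Y, both positive semidefinite, is zero. *)
have Y0 : D *m P - P = 0.
  pose Y := D *m P - P.
  have DY : D *m Y = - Y by rewrite /Y mulmxBr DP opprB.
  apply: (@adj_sum_eq0 _ _ _ (M *m Y)); rewrite -/Y.
  by rewrite adjmM mulmxA -(mulmxA _ (adjm M)) DE -mulmxA DY mulmxN subrr.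
rewrite DE => i j nij; have [/eqP/ube_eq [E|[ui uj]]|nb] := boolP (blk_rel ube i j).
- by rewrite E /diag_rel eqxx in nij.
- have := congr1 (fun m : 'M[C]_n => m i j) Y0;
  rewrite /= mxE PE uj [(- P) i j]mxE PP mxE ui andbT (negPf (nij : i != j)) subr0 => ->; exact: mxE.
- exact: Db.
Qed.

Lemma ublk_out (x : 'M[C]_n) i j : supp (blk_rel ube) x -> ~~ ue i -> j != i ->
  x i j = 0 /\ x j i = 0.
Proof.
move=> xb ui ji; have nb : ube i != ube j.
  by apply/eqP => /ube_eq [E|[E _]]; [rewrite E eqxx in ji|rewrite E in ui].
by split; apply: xb => //; rewrite blk_sym.
Qed.

(** Outside the central block k has diagonal entries 1; on it the form is -1. Hence [tau k] is the
    adjoint of k, and unitarity is all that is required. *)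
Lemma pu_mid (l k b : 'M[C]_n) : supp (mid_rel ube) l -> unidiag l -> unitary k -> posup b ->
  l = k *m b -> GsU k.
Proof.
move=> ls l1 kU bP lE; have [kb bb] := mid_factor_blk ube_mono ls l1 kU bP lE.
have k1 i : ~~ ue i -> k i i = 1.
  move=> ui; have E1 : k i i * b i i = 1.
    have := congr1 (fun m : 'M[C]_n => m i i) lE; rewrite /= l1 mxE (bigD1 i) //=.
    by rewrite big1 ?addr0 // => j ji; have [-> _] := ublk_out kb ui ji; rewrite mul0r.
  have E2 : (k i i)^* * k i i = 1.
    have := congr1 (fun m : 'M[C]_n => m i i) kU; rewrite /= !mxE eqxx (bigD1 i) //= adjmE.
    rewrite big1 ?addr0 // => j ji; have [_ E] := ublk_out kb ui ji.
    by rewrite E mulr0.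
  have bi := bP.2 i; have kE : k i i = (b i i)^-1.
    by apply: (mulIf (lt0r_neq0 bi)); rewrite E1 mulVf // gt_eqF.
  have kp : 0 < k i i by rewrite kE invr_gt0.
  move: E2; rewrite (geC0_conj (ltW kp)) -expr2 => /eqP.
  by rewrite sqrf_eq1 => /orP [/eqP //|/eqP E]; move: kp; rewrite E oppr_gt0 ltr10.
suff -> : GsU k = (adjm k *m k = 1%:M) by [].
rewrite /GsB /=; congr (_ *m _ = _); apply/matrixP => i j; rewrite tuE adjmE.
have [/eqP/ube_eq [<-|[ui uj]]|nb] := boolP (blk_rel ube i j).
- rewrite mulrAC -signr_addb addbb mul1r.
  have [ui|ui] := boolP (ue i); first by rewrite us_mid.
  by rewrite !k1 // ue_us.
- by rewrite !us_mid // ui uj mulrAC -signr_addb addbb mul1r.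
rewrite [k j i]kb; last by rewrite blk_sym.
rewrite [k _ _]kb ?rmorph0 ?mulr0 ?mul0r //.
apply: contra nb; rewrite /blk_rel => /eqP; have := ube_us i; have := ube_us j.
by lia.
Qed.

(** The minimum of o, q and n - 1 - o: as many first columns of g are orthogonal, for K, to g x with
    x supported up to o, and have a leading minor already known to be invertible. *)
Definition iso_dim (o : nat) : nat :=
  if (o < q)%N then o else if (o < p)%N then q else (n - 1 - o)%N.

Lemma wmx_colE (x : 'cV[C]_n) i : (K *m x) i 0 = (-1) ^+ ue i * x (us i) 0.
Proof. exact: wmx_mulE. Qed.

Lemma vhermE (x y : 'cV[C]_n) :
  vherm K x y = \sum_i (x i 0)^* * ((-1) ^+ ue i * y (us i) 0).
Proof. by rewrite /vherm mxE; apply: eq_bigr => i _; rewrite wmx_colE !mxE. Qed.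

Lemma us_lt (i : 'I_n) (j : nat) : (j <= q)%N -> (us i < j)%N = (n - j <= i)%N.
Proof. by rewrite us_val; have := ltn_ord i; case: ifP; lia. Qed.

(* The last [n - iso_dim o] coordinates of [g x] cannot all vanish: otherwise [K g x]
   would be supported on the first [iso_dim o] coordinates, while it is orthogonal to the
   first [iso_dim o] columns of [g], whose leading minor is invertible. *)
Lemma pu_far_pivot (g : 'M[C]_n) (x : 'cV[C]_n) (o : 'I_n) : GsU g ->
  (forall j, (j <= o)%N -> lead j g \in unitmx) -> x o 0 = 1 ->
  (forall j : 'I_n, (o < j)%N -> x j 0 = 0) ->
  ~ (forall i : 'I_n, (i < n - iso_dim o)%N -> (g *m x) i 0 = 0).
Proof.
move=> gG gok xo xz vz; have gU := GsB_unit gG; have /GsUP gK := gG.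
have jo : (iso_dim o <= o)%N by rewrite /iso_dim; have := ltn_ord o; repeat case: ifP; lia.
have jq : (iso_dim o <= q)%N by rewrite /iso_dim; have := ltn_ord o; repeat case: ifP; lia.
have lgU : lead (iso_dim o) (adjm g) \in unitmx by rewrite lead_adj adjm_unit gok.
have Kv : K *m (g *m x) = 0.
  apply: (elimT (lead_kerP (iso_dim o) (adjm g)) lgU) => i ij.
    rewrite wmx_colE vz ?mulr0 // ltnNge -us_lt // usK -leqNgt //.
  rewrite !mulmxA gK wmx_colE xz ?mulr0 //.
  move: ij; rewrite us_val /iso_dim; have := ltn_ord i; have := ltn_ord o.
  by repeat case: ifP; lia.
have KU : K \in unitmx by apply/unitary_unit/wmx_unitary.
by have := vec_neq0 gU xo; rewrite (unit_ker KU Kv) eqxx.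
Qed.

(** The bound and the type of i0 are what allows exchanging o with i0 and their mirror images at
    once. For o < q, g x is isotropic; were its possible pivots all central, the definite central
    part of the form would make them vanish. *)
Lemma pu_pivot (g : 'M[C]_n) (x : 'cV[C]_n) (o : 'I_n) : GsU g ->
  (forall j, (j <= o)%N -> lead j g \in unitmx) -> x o 0 = 1 ->
  (forall j : 'I_n, (o < j)%N -> x j 0 = 0) ->
  (forall i : 'I_n, (i < o)%N -> (g *m x) i 0 = 0) ->
  exists i0 : 'I_n, [/\ (g *m x) i0 0 != 0, (o <= i0)%N, (i0 < n - iso_dim o)%N &
    ((o < q)%N -> ~~ ue i0)].
Proof.
move=> gG gok xo xz gx; have /GsUP gK := gG.
pose S (i : 'I_n) := [&& (o <= i)%N, (i < n - iso_dim o)%N & ((o < q)%N ==> ~~ ue i)].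
have [/existsP [i0 /andP [v0 /and3P [h1 h2 /implyP h3]]]|/existsPn H] :=
    boolP [exists i, ((g *m x) i 0 != 0) && S i].
  by exists i0.
have vS i : S i -> (g *m x) i 0 = 0.
  by move=> Si; have := H i; rewrite Si andbT negbK => /eqP.
case: (pu_far_pivot gG gok xo xz) => i ij.
have [io|oi] := ltnP i o; first exact: gx.
have [Si|] := boolP (S i); first exact: vS.
rewrite /S oi ij /= negb_imply negbK => /andP [oq ui].
(* The support of x lies in the first q coordinates, which span an isotropic subspace. *)
have H0 : vherm K (g *m x) (g *m x) = 0.
  rewrite (vherm_mul _ _ gK) vhermE big1 // => a _.
  have [ao|oa] := leqP a o; last by rewrite xz ?rmorph0 ?mul0r.
  rewrite [x (us a) 0]xz ?mulr0 // us_val; have := ltn_ord o; case: ifP; move: oq ao; lia.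
have E a : ((g *m x) a 0)^* * ((-1) ^+ ue a * (g *m x) (us a) 0) =
    - (if ue a then `|(g *m x) a 0| ^+ 2 else 0).
  have [ua|ua] := boolP (ue a); first by rewrite us_mid // normCK mulrC expr1 mulN1r mulNr.
  rewrite oppr0; have [ao|oa] := ltnP a o; first by rewrite gx // rmorph0 mul0r.
  have [aj|ja] := ltnP a (n - iso_dim o).
    by rewrite vS ?rmorph0 ?mul0r // /S oa aj ua implybT.
  rewrite [(g *m x) (us a) 0]gx ?mulr0 //; move: ja.
  by rewrite /iso_dim oq -us_lt // ltnW.
move: H0; rewrite vhermE (eq_bigr _ (fun a _ => E a)) sumrN => /eqP; rewrite oppr_eq0.
rewrite psumr_eq0; last by move=> a _; case: ifP => // _; apply: exprn_ge0.
move=> /allP /(_ i (mem_index_enum _)) /=; rewrite ui expf_eq0 normr_eq0.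
by move=> /andP [_ /eqP].
Qed.

Lemma GsU1 : GsU 1%:M.
Proof. by rewrite /GsB /= (tau1 R usK ue_us) mul1mx. Qed.

Lemma GsUM (x y : 'M[C]_n) : GsU x -> GsU y -> GsU (x *m y).
Proof.
by move=> xG yG; rewrite /GsB /= (tauM usK ue_us) -mulmxA (mulmxA (tu x)) xG mul1mx.
Qed.

(** Rows before o stay in place: for o < q the mirror image of i0 is not before o, for a central o
    so is i0, and for o >= p the bounds force i0 = o. *)
Lemma pu_step (o : 'I_n) (g : 'M[C]_n) : GsU g ->
  (forall j, (j <= o)%N -> lead j g \in unitmx) ->
  exists w, [/\ sperm w, GsU w & forall j, (j <= o.+1)%N -> lead j (w *m g) \in unitmx].
Proof.
move=> gG gok; have [x [xo xz gx]] := pivot_vec (erefl (o : nat)) (gok o (leqnn o)).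
have [i0 [v0 oi ij uo]] := pu_pivot gG gok xo xz gx.
have [lo li] := (ltn_ord o, ltn_ord i0).
have ik : us o = o <-> us i0 = i0.
  split=> /(congr1 val) /=; rewrite -/(nat_of_ord _) us_val => H; apply: ord_inj; rewrite us_val;
  move: H uo ij oi; rewrite ?ueE /iso_dim; repeat case: ifP; lia.
have ueo : ue o = ue i0.
  by move: uo ij oi; rewrite !ueE /iso_dim; repeat case: ifP; lia.
exists (wmx R (swap_perm usK ik) [ffun=> false]); split.
- by exists (swap_perm usK ik), [ffun=> false].
- apply: (GsB_wmx R usK ue_us) => i; first exact: swap_perm_comm.
  by rewrite !ffunE -!ueE (swap_perm_inv _ _ ue_us ueo); case: (ue i).
apply: (swap_row_step gok xo xz gx v0); first exact: swap_perm_k.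
move=> i io; rewrite ffunE; split=> //.
have [E|ne] := eqVneq i0 o.
  by rewrite permE; move: ik {v0 oi ij uo li ueo}; rewrite E => ik; apply: swap_funxx.
have l := ltn_ord i.
apply: swap_perm_id; rewrite -val_eqE /= -/(nat_of_ord _) ?us_val.
all: move: uo ij oi ne io; rewrite -val_eqE /= ?ueE /iso_dim; repeat case: ifP; lia.
Qed.

Lemma pu_cover (g : 'M[C]_n) : GsU g -> exists w, [/\ sperm w, GsU w & lead_ok (adjm w *m g)].
Proof.
move=> gG; apply: (@cover_adj _ _ GsU).
  by move=> x; apply: (GsB_adj usK ue_us).
by apply: (@cover_of_steps _ _ GsU GsU) gG; [exact: GsU1|exact: GsUM|exact: GsUM|exact: pu_step].
Qed.

(** * The matrix [cpq] and the transported Hermitian form *)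

Local Notation c := (@cpq R n p q).
Local Notation sh := (((Num.sqrt (2 : R))^-1)%:C%C : C).

Lemma sh_sq : sh * sh + sh * sh = 1.
Proof.
have s0 : Num.sqrt (2 : R) != 0 by rewrite gt_eqF // sqrtr_gt0.
have E : Num.sqrt (2 : R) * Num.sqrt 2 = 2 by rewrite -expr2 sqr_sqrtr.
rewrite -rmorphM -rmorphD /= -[RHS]/((1 : R)%:C%C); congr (_%:C%C).
by rewrite -invfM E; field.
Qed.

(* Row [i] of [cpq] has at most two nonzero entries: [fcoef i] in column [fcol i < p]
   and [scoef i] in column [scol i >= p]. *)
Definition fcol_nat (i : nat) : nat :=
  (if i < q then i + (p - q) else if i < p then i - q else (p - q) + (n - 1 - i))%N.
Definition scol_nat (i : nat) : nat := (if i < q then n - 1 - i else i)%N.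
Definition fcoef (i : nat) : C := if (i < q)%N then sh else if (i < p)%N then 1 else - sh.
Definition scoef (i : nat) : C := if (i < q)%N then sh else if (i < p)%N then 0 else sh.

Lemma fcol_lt (i : 'I_n) : (fcol_nat i < n)%N.
Proof. by rewrite /fcol_nat; have := ltn_ord i; repeat case: ifP; lia. Qed.
Lemma scol_lt (i : 'I_n) : (scol_nat i < n)%N.
Proof. by rewrite /scol_nat; have := ltn_ord i; repeat case: ifP; lia. Qed.
Definition fcol i := Ordinal (fcol_lt i).
Definition scol i := Ordinal (scol_lt i).

Lemma sigma_pre_lt (i : 'I_n) :
  ((if i < q then i + (p - q) else if i < p then i - q else i) < n)%N.
Proof. by have := ltn_ord i; repeat case: ifP; lia. Qed.

Lemma cpqE i l : c i l = fcoef i * (l == fcol i)%:R + scoef i * (l == scol i)%:R.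
Proof.
have lt := ltn_ord l; have il := ltn_ord i.
(* Row i of the permutation matrix has its entry 1 at the preimage of i under [sigma_pq]. *)
rewrite /cpq mxE (bigD1 (Ordinal (sigma_pre_lt i))) //= big1 ?addr0 => [|j ji]; last first.
  rewrite mxE ifN ?mul0r //; apply: contra ji => /eqP E; apply/eqP/ord_inj => /=.
  by move: E; have := ltn_ord j; rewrite /sigma_pq; repeat case: ifP; lia.
rewrite mxE ifT; last first.
  by apply/eqP; rewrite /sigma_pq /=; repeat case: ifP; lia.
rewrite mul1r mxE -!(inj_eq val_inj) /= /fcol_nat /scol_nat /fcoef /scoef.
case: (ltnP i q) => iq /=; [|case: (ltnP i p) => ip /=].
- rewrite ifF; last by apply/negbTE; lia.
  rewrite ifT; last by lia.
  have -> : (p - q + q + (q - 1 - (i + (p - q) - (p - q))) = n - 1 - i)%N by lia.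
  rewrite eq_sym; case: eqP => [->|]; last by case: eqP => _ _; rewrite mulr0 ?mulr1 add0r ?mulr0.
  by case: eqP => [E|_]; [exfalso; lia|rewrite mulr1 mulr0 addr0].
- rewrite ifT; last by lia.
  by rewrite mul0r addr0 mul1r eq_sym; case: eqP.
- rewrite ifF; last by apply/negbTE; lia.
  rewrite ifF; last by apply/negbTE; lia.
  have -> : (p - q + (q - 1 - (i - (p - q) - q)) = p - q + (n - 1 - i))%N by lia.
  rewrite eq_sym; case: eqP => [->|]; last by case: eqP => _ _; rewrite !(mulr0, mulr1, addr0).
  by case: eqP => [E|_]; [exfalso; lia|rewrite mulr1 mulr0 add0r].
Qed.

Lemma conj_coef (i : nat) : (fcoef i)^* = fcoef i /\ (scoef i)^* = scoef i.
Proof.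
rewrite /fcoef /scoef; case: ifP => _; [|case: ifP => _]; split;
  by rewrite ?rmorphN /= ?conjC_real ?rmorph1 ?rmorph0.
Qed.

Lemma cpq_mulE k (y : 'M[C]_(n, k)) i j :
  (c *m y) i j = fcoef i * y (fcol i) j + scoef i * y (scol i) j.
Proof.
rewrite mxE (eq_bigr (fun l => fcoef i * ((l == fcol i)%:R * y l j) +
    scoef i * ((l == scol i)%:R * y l j))); last first.
  by move=> l _; rewrite cpqE mulrDl !mulrA.
rewrite big_split /= -!mulr_sumr; congr (_ * _ + _ * _).
  rewrite (bigD1 (fcol i)) //= eqxx mul1r big1 ?addr0 // => l /negPf ->.
  by rewrite mul0r.
rewrite (bigD1 (scol i)) //= eqxx mul1r big1 ?addr0 // => l /negPf ->.
by rewrite mul0r.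
Qed.

(** One computation with two uses: a = b = 1 gives unitarity of [cpq], and a = -1, b = 1 the
    transported form. *)
Lemma cpq_signature (a b : C) i j :
  (c *m (diag_mx (\row_l (if (l < p)%N then a else b)) *m adjm c)) i j =
  if (q <= i < p)%N then a *+ (i == j)
  else sh * sh * (a + b) *+ (i == j) + sh * sh * (b - a) *+ (us i == j).
Proof.
have [c1 c2] := conj_coef j; have lt := ltn_ord j; have il := ltn_ord i.
have fp : (fcol i < p)%N by rewrite /= /fcol_nat; repeat case: ifP; lia.
have cross (k l : 'I_n) : scoef k * (fcol l == scol k)%:R = 0.
  have := ltn_ord k; have := ltn_ord l.
  rewrite -(inj_eq val_inj) /= /fcol_nat /scol_nat /scoef.
  case: (ltnP k q) => kq; [|case: (ltnP k p) => kp; first by rewrite mul0r];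
    by repeat case: ifP; move=> *; case: eqP => *; rewrite ?mulr0 //; exfalso; lia.
have E (l : 'I_n) : (diag_mx (\row_l (if (l < p)%N then a else b)) *m adjm c) l j =
    (if (l < p)%N then a else b) * (fcoef j * (l == fcol j)%:R + scoef j * (l == scol j)%:R).
  rewrite mul_diag_mx [LHS]mxE mxE adjmE cpqE rmorphD !rmorphM /= !conjC_nat.
  by rewrite c1 c2.
rewrite cpq_mulE !E fp.
rewrite cross addr0 mulrDr [X in _ + X]mulrDr.
have -> : scoef i * ((if (scol i < p)%N then a else b) * (fcoef j * (scol i == fcol j)%:R)) = 0.
  rewrite mulrCA [scoef i * _]mulrCA [scol i == _]eq_sym cross !mulr0 //.
rewrite add0r.
have -> : scoef i * ((if (scol i < p)%N then a else b) * (scoef j * (scol i == scol j)%:R)) =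
    scoef i * (b * (scoef j * (scol i == scol j)%:R)).
  rewrite /= /scol_nat /scoef; case: (ltnP i q) => iq; first by rewrite ifF //; apply/negbTE; lia.
  by case: (ltnP i p) => ip; rewrite ?mul0r.
rewrite -!(inj_eq val_inj) /= -/(nat_of_ord _) us_val.
rewrite /fcoef /scoef /fcol_nat /scol_nat; move: sh {E c1 c2 cross fp} => s.
case: (ltnP i q) => iq /=; [|case: (ltnP i p) => ip /=];
  (case: (ltnP j q) => jq /=; [|case: (ltnP j p) => jp /=]);
  repeat (case: eqP => ? /=); rewrite /= ?mulr0n ?mulr1n; try (exfalso; lia); ring.
Qed.

Lemma cpq_unitary : unitary c.
Proof.
apply: mulmx1C; apply/matrixP => i j; have := cpq_signature 1 1 i j.
have -> : diag_mx (\row_l (if (l < p)%N then 1 else 1)) = 1%:M :> 'M[C]_n.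
  by apply/matrixP => k l; rewrite !mxE if_same.
rewrite mul1mx subrr mulr0 mul0rn addr0 => ->.
by rewrite mulrDr mulr1 sh_sq if_same mxE.
Qed.

Lemma cpq_form : c *m Jpq n p *m adjm c = K.
Proof.
have -> : @Jpq R n p = diag_mx (\row_l (if (l < p)%N then -1 else 1)).
  by apply/matrixP => k l; rewrite !mxE; case: eqVneq => // _; rewrite ?mulr1n ?mulr0n.
rewrite -mulmxA; apply/matrixP => i j; rewrite cpq_signature mxE ueE.
case: (boolP (q <= i < p)%N) => H.
  have -> : us i = i by apply: us_mid; rewrite ueE.
  by case: eqVneq => _; rewrite ?mulr1n ?mulr0n ?mulr1 ?mulr0.
rewrite addNr mulr0 mul0rn add0r opprK mulrDr mulr1 sh_sq expr0 mul1r.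
by [].
Qed.

Lemma G0_iiiP (X : 'M[C]_n) : G0_iii n p q X <-> \det X = 1 /\ GsU X.
Proof.
have cu := cpq_unitary; have cf := cpq_form.
rewrite /G0_iii /=; move: (@cpq R n p q) cu cf => d du df.
have dU := unitary_unit du; have di := unitary_inv du; have dau := unitary_adj du.
have J1 : adjm (1%:M : 'M[C]_n) *m Jpq n p *m 1%:M = Jpq n p by rewrite adjm1 mul1mx mulmx1.
have [_ df'] := form_transport du df J1.
split=> [[h [[h1 hJ] ->]]|[X1 /GsUP XK]].
  split; first by rewrite !det_mulmx det_inv h1 mulr1 mulfV // -unitfE -unitmxE.
  by apply/GsUP; rewrite di; have [] := form_transport du df hJ.
exists (adjm d *m X *m d); split; last first.
  by rewrite di !mulmxA (mulmx1C du) mul1mx -mulmxA (mulmx1C du) mulmx1.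
split; first by rewrite !det_mulmx X1 mulr1 -det_mulmx du det1.
have [+ _] := form_transport dau (ltac:(by rewrite adjmK) : adjm d *m K *m adjm (adjm d) = Jpq n p) XK.
by rewrite adjmK.
Qed.

Variable L : 'M[C]_n.
Hypotheses (Ld : is_diag L) (Ls : simple_spectrum L) (Lp : LambdaShape_iii p q L).

Lemma shape_mirror (i : 'I_n) : L (us i) (us i) = - (L i i)^*.
Proof.
have [L1 L2] := Lp; have shape (a b : 'I_n) k : (k < q)%N -> a = (p + k)%N :> nat ->
    b = (q - 1 - k)%N :> nat -> L a a = - (L b b)^*.
  by move=> kq ak bk; have := L2 k kq; rewrite -ak -bk; rewrite /mxn !valK.
have [ui|ui] := boolP (ue i).
  rewrite us_mid //; move: ui; rewrite ueE => /andP [qi ip]; have := L1 i qi ip.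
  rewrite /mxn valK; case: (L i i) => a b /= ->.
  by apply/eqP; rewrite eq_complex /= oppr0 opprK !eqxx.
have l := ltn_ord i; have := us_val i; move: ui; rewrite ueE => ui; rewrite (negPf ui) => E.
have [iq|qi] := ltnP i q.
  by apply: (shape _ _ (q - 1 - i)%N); lia.
by rewrite (shape i (us i) (i - p)%N) ?rmorphN /= ?conjCK ?opprK //; lia.
Qed.

Lemma gsB_shape : gsB us ue L.
Proof.
apply/matrixP => i j; rewrite tuE mxE; have [<-|ij] := eqVneq i j.
  by rewrite mulrAC -signr_addb addbb mul1r shape_mirror rmorphN /= conjCK.
by rewrite !Ld ?rmorph0 ?oppr0 ?mulr0 ?mul0r // (inj_eq perm_inj) eq_sym.
Qed.

Lemma gsB_rediag : gsB us ue (rediag L).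
Proof.
apply/matrixP => i j; rewrite tuE mxE; have [<-|ij] := eqVneq i j.
  rewrite mulrAC -signr_addb addbb mul1r !mxE !eqxx conjC_real shape_mirror.
  by case: (L i i) => a b /=; rewrite rmorphN.
rewrite !mxE (inj_eq perm_inj) eq_sym (negPf ij) rmorph0 mulr0 mul0r oppr0 //.
Qed.

Definition realform_pu : realform L.
Proof.
apply: (@realformB R n ube L ube_mono us ue (q + q)%N ube_us usK ue_us).
- exact: pu_pos_diag.
- exact: pu_mid.
- exact: pu_cover.
- exact: gsB_rediag.
- by rewrite /gsB /= (tauD us ue) (tauN us ue) gsB_shape gsB_rediag opprD.
Defined.

(** The determinant of g has modulus 1, hence so has its n-th root, and the corresponding scalar
    matrix preserves the form. *)
Lemma pu_normalize (g : 'M[C]_n) : GsU g ->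
  exists t, [/\ supp diag_rel t, t \in unitmx & G0_iii n p q (invmx g *m t)].
Proof.
move=> gG; have gU := GsB_unit gG; have /GsUP gK := gG.
have dn : (\det g)^* * \det g = 1.
  have KU : \det K != 0 by rewrite -unitfE -unitmxE; apply/unitary_unit/wmx_unitary.
  by apply: (mulIf KU); rewrite mul1r -{2}gK !det_mulmx det_adjm mulrAC.
have [n0|n0] := posnP n.
  exists 1%:M; split; [exact: supp_scalar (@diag_refl n)|exact: unitmx1|].
  apply/G0_iiiP; rewrite mulmx1; split.
    by move: (invmx g) => h; move: h; rewrite n0 => h; apply: det_mx00.
  by rewrite /GsB /= (tau_inv usK ue_us gU) (GsB_tau gG) invmxK mulmxV.
pose a := n.-root (\det g); have an : a ^+ n = \det g by apply: rootCK.
have a1 : a^* * a = 1.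
  apply/eqP; rewrite -(pexpr_eq1 n0); first by rewrite exprMn -rmorphXn /= an dn.
  by rewrite mulrC -normCK exprn_ge0.
have a0 : a != 0 by apply: contra_eqN a1 => /eqP ->; rewrite mulr0 eq_sym oner_neq0.
exists a%:M; split; first exact: supp_scalar (@diag_refl n).
  by rewrite unitmxE det_scalar unitfE expf_neq0.
apply/G0_iiiP; split.
  by rewrite det_mulmx det_inv det_scalar an mulVf // -unitfE -unitmxE.
apply: GsUM; first by rewrite /GsB /= (tau_inv usK ue_us gU) (GsB_tau gG) invmxK mulmxV.
rewrite /GsB /=; apply/matrixP => i j; rewrite mul_mx_scalar [LHS]mxE tuE [RHS]mxE mxE.
rewrite (inj_eq perm_inj) eq_sym; case: eqVneq => [<-|_]; last by rewrite rmorph0 mulr0 mul0r mulr0.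
by rewrite mulrAC -signr_addb addbb mul1r mulr1n mulrC a1.
Qed.

Lemma case_iii_toda :
  (forall X, conj_class (G0_iii n p q) L X -> tangent_to (conj_class (G0_iii n p q) L) X (toda X)) /\
  linearizing_atlas (conj_class (G0_iii n p q) L) (@toda R n).
Proof.
apply: (case_toda Ld Ls (conj_class_eq Ld (rf := realform_pu) _ _)).
  by move=> h /G0_iiiP [].
exact: pu_normalize.
Qed.

End PseudoUnitary.

Theorem theorem1p3 (R : realType) (n : nat) (L : 'M[R[i]]_n)
    (G0 : set 'M[R[i]]_n) :
  is_diag L -> \tr L = 0 -> simple_spectrum L ->
  case_i L G0 \/ case_ii L G0 \/ case_iii L G0 ->
  (forall X, conj_class G0 L X -> tangent_to (conj_class G0 L) X (toda X)) /\
  linearizing_atlas (conj_class G0 L) (@toda R n).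
Proof.
move=> Ld _ Ls [[Lr ->]|[[m [nE [[Lq _] ->]]]|[p [q [nE [qp [Lp ->]]]]]]].
- exact: case_i_toda.
- by subst n; apply: case_ii_toda.
- by subst n; apply: case_iii_toda.
Qed.
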